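(* Let $p \ge 5$ be prime, let $k_0$ be an even integer with $2 \le k_0 \le p-3$, and let $n \ge 0$ be an integer. Then there exists a $p$-integral modular form $f_{k_0+(p-1)} \in \mathrm{M}_{k_0+(p-1)}$ such that $$G_{k_0+(n+1)(p-1)} \equiv E_{p-1}^n\, f_{k_0+(p-1)} \pmod{p^2}.$$
   Context: For even $w\ge 2$, let $B_w$ be the $w$-th Bernoulli number, $\sigma_{w-1}(n)=\sum_{d\mid n} d^{w-1}$, and define the Eisenstein series (as formal power series in $q$) by $G_w := -\frac{B_w}{2w}E_w := -\frac{B_w}{2w}+\sum_{n\ge 1}\sigma_{w-1}(n)q^n$; so $E_w$ has constant term $1$. For even $w$, $\mathrm{M}_w$ denotes the space of modular forms of weight $w$ on $\mathrm{SL}_2(\mathbb{Z})$ with rational Fourier coefficients, each form being identified with its Fourier expansion in $\mathbb{Q}[[q]]$. Let $\mathbb{Z}_{(p)}$ be the ring of $p$-integral rational numbers; a modular form is $p$-integral if all its Fourier coefficients lie in $\mathbb{Z}_{(p)}$. The congruence $\sum a(n)q^n\equiv\sum b(n)q^n \pmod{p^m}$ means $a(n)\equiv b(n)\pmod{p^m}$ for all $n$ (i.e. $a(n)-b(n)\in p^m\mathbb{Z}_{(p)}$). *)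

(* Defs.v *)
From HB Require Import structures.
From mathcomp Require Import all_boot all_order all_algebra.
From mathcomp Require Import all_classical all_reals all_analysis.
From mathcomp Require Import complex.

Set Implicit Arguments.
Unset Strict Implicit.
Unset Printing Implicit Defensive.

Import Order.TTheory GRing.Theory Num.Theory.
Import numFieldNormedType.Exports.

Local Open Scope classical_set_scope.
Local Open Scope ring_scope.
Local Open Scope complex_scope.

(* [bernoullis n] is the list B_0, ..., B_(n-1); the recursion is
   B_0 = 1 and \sum_(k <= n) 'C(n.+1, k) B_k = 0 for n > 0, solved for B_n
   (see bernoulliP). *)
Fixpoint bernoullis (n : nat) : seq rat :=
  if n is m.+1 then
    let s := bernoullis m in
    rcons s (((m == 0)%:R - \sum_(k < m) 'C(m.+1, k)%:R * s`_k) / m.+1%:R)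
  else [::].

Definition bernoulli (n : nat) : rat := (bernoullis n.+1)`_n.

Lemma size_bernoullis n : size (bernoullis n) = n.
Proof. by elim: n => //= n IHn; rewrite size_rcons IHn. Qed.

Lemma nth_bernoullis n k : (k < n)%N -> (bernoullis n)`_k = bernoulli k.
Proof.
elim: n => // n IHn; rewrite ltnS leq_eqVlt => /orP[/eqP->//|lt_kn].
by rewrite /= nth_rcons size_bernoullis lt_kn IHn.
Qed.

Lemma bernoulliP n :
  \sum_(k < n.+1) 'C(n.+1, k)%:R * bernoulli k = (n == 0)%:R.
Proof.
rewrite big_ord_recr /= {2}/bernoulli /= nth_rcons size_bernoullis ltnn eqxx.
rewrite binSn mulrC divfK ?pnatr_eq0//.
under [X in _ + (_ - X)]eq_bigr => k _ do rewrite nth_bernoullis//.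
by rewrite addrC subrK.
Qed.

(* A sequence a : nat -> rat stands for the power series
   \sum_n a_n q^n in Q[[q]]. *)
Definition qseries := nat -> rat.

Definition qone : qseries := fun n => (n == 0)%:R.

Definition qmul (a b : qseries) : qseries :=
  fun n => \sum_(i < n.+1) a i * b (n - i)%N.

Definition qexp (a : qseries) (m : nat) : qseries := iter m (qmul a) qone.

Definition sigma (k n : nat) : nat := (\sum_(d <- divisors n) d ^ k)%N.

Definition eisG (w : nat) : qseries := fun n =>
  if n == 0 then - bernoulli w / (2 * w)%:R else (sigma w.-1 n)%:R.

(* Normalization: eisG w = - B_w / 2w * eisE w. *)
Definition eisE (w : nat) : qseries := fun n =>
  (- bernoulli w / (2 * w)%:R)^-1 * eisG w n.

(* The local ring Z_(p). *)
Definition pintegral (p : nat) (x : rat) : Prop := ~~ (p %| `|denq x|)%N.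

Definition qpintegral (p : nat) (a : qseries) : Prop :=
  forall n, pintegral p (a n).

Definition qcongr (p m : nat) (a b : qseries) : Prop :=
  forall n, exists2 z, pintegral p z & a n - b n = p%:R ^+ m * z.

Section ModularForms.
Variable R : realType.

(* R[i]^o carries the topology and the normed module structure over R[i], so
   that derivability along 1 is complex differentiability. *)
Local Notation C := (R[i]^o).

Definition upper_half_plane : set C := [set z | 0 < complex.Im z].

Definition cexp (z : C) : C :=
  (expR (complex.Re z))%:C * (cos (complex.Im z) +i* sin (complex.Im z)).

Definition holomorphic_on_H (f : C -> C) : Prop :=
  forall z, upper_half_plane z -> derivable f z 1.

Definition automorphy_factor (g : 'M[int]_2) (z : C) : C :=
  (g 1 0)%:~R * z + (g 1 1)%:~R.

Definition moebius (g : 'M[int]_2) (z : C) : C :=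
  ((g 0 0)%:~R * z + (g 0 1)%:~R) / automorphy_factor g z.

Definition fourier_expansion (f : C -> C) (a : nat -> C) : Prop :=
  forall z, upper_half_plane z ->
    series (fun n => a n * cexp ((2 * pi)%:C * 'i * z) ^+ n : C) @ \oo --> f z.

(* The expansion without negative powers of q is holomorphy at the cusp. *)
Definition modular_form (w : nat) (f : C -> C) : Prop :=
  [/\ holomorphic_on_H f,
      forall (g : 'M[int]_2) z, \det g = 1 -> upper_half_plane z ->
        f (moebius g z) = automorphy_factor g z ^+ w * f z
    & exists a, fourier_expansion f a].

(* The space M_w of modular forms with rational Fourier coefficients,
   identified with their Fourier expansions. *)
Definition Mspace (w : nat) : set qseries :=
  [set a | exists2 f, modular_form w f
                    & fourier_expansion f (fun n => ratr (a n))].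

End ModularForms.

(* Main.v *)
(* Let E = E_(p-1) and, for each m, let G_m be the Eisenstein series of weight
   k0 + m(p-1).  Modulo p^2 and for m > 0, G_m agrees with its p-stabilization,
   whose coefficients are affine in m with slope divisible by p, by Kummer's
   congruences for the constant term and by Euler's theorem for the others; and
   E = 1 modulo p.  If g is the p-stabilization for m = 0 and H is a form of
   weight k0 + (p-1) with H = E g modulo p^2, then f = (n+1) G_1 - n H works.
   For k0 >= 4 take H = E G_0.  For k0 = 2, where G_0 is not modular, write
   Eis_w for the Eisenstein series of weight w and take
   H = E Eis_2 + q E'/(2(p-1)) - p Eis_(p+1); its first two terms are a
   combination of Eis_(p+1) and of products of Eisenstein series of weights >= 4
   by Rankin's identity, which follows from a Euclidean step on the solutions of
   a x + b y = N (Skoruppa).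
   For the modularity of Eis_k, k >= 4, the sums of (m z + n)^-k over the squares
   |m|, |n| <= N are exactly equivariant under z -> -1/z, and they converge to a
   multiple of Eis_k by Lipschitz's formula.  The latter comes from
   pi^2/sin^2 = sum of (z + n)^-2, a limit of the distribution relation of
   1/sin^2, by comparing Taylor coefficients in z; its expansion at 0 gives zeta(k). *)

Require Import Defs.
From mathcomp Require Import all_boot all_order all_algebra cyclic.
From mathcomp Require Import ring lra zify.

Set Implicit Arguments.
Unset Strict Implicit.
Unset Printing Implicit Defensive.

Import Order.TTheory GRing.Theory Num.Theory.

Local Open Scope ring_scope.

(** Weight 2 is special because [G_0] and its p-stabilization differ by a multiple of p^(k0-1):
    invisible modulo p^2 when k0 >= 4, but visible to first order in p when k0 = 2. There the term
    in q E' repairs the failing modularity of Eis_2, and p Eis_(p+1) absorbs the visible difference.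
    Kummer's congruence is needed as a law linear in m modulo p^2, more than an equality of
    residues. It comes from power sums over the units below p^5: after multiplication by c^k - 1 the
    weight occurs only in exponents of units, where Fermat's theorem makes everything affine. A
    modular form here is a holomorphic function on the half plane, so the analysis is done on finite
    sums with explicit errors. Holomorphy and invariance under z -> z + 1 are read off the
    q-expansion, the behaviour under z -> -1/z off the square sums, and the Euclidean algorithm
    generates SL_2(Z) from these two maps. Taylor coefficients are compared along z + i t with t > 0
    small: a polynomial of degree < J that is O(t^J) vanishes, which replaces the repeated
    differentiation of series. *)

(** * Bernoulli numbers and sums of powers *)

Lemma bin_shuffle n j l : (j + l <= n)%N ->
  ('C(n, j) * 'C(n - j, l) = 'C(n, l) * 'C(n - l, j))%N.
Proof.
move=> jln; apply/eqP.
(* After multiplication by this product both sides become n!, as for a trinomial coefficient. *)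
have fp : (0 < j`! * l`! * (n - j - l)`!)%N by rewrite !muln_gt0 !fact_gt0.
rewrite -(eqn_pmul2r fp); apply/eqP.
have a : ('C(n, j) * (j`! * (n - j)`!) = n`!)%N by apply: bin_fact; lia.
have b : ('C(n, l) * (l`! * (n - l)`!) = n`!)%N by apply: bin_fact; lia.
have c : ('C(n - j, l) * (l`! * (n - j - l)`!) = (n - j)`!)%N by apply: bin_fact; lia.
have d : ('C(n - l, j) * (j`! * (n - l - j)`!) = (n - l)`!)%N by apply: bin_fact; lia.
have e : (n - l - j = n - j - l)%N by lia.
rewrite e in d; nia.
Qed.

(** The range n does not depend on m, so that sums over l for several m can be exchanged with a sum
    over m. *)
Lemma exprD1_sub (x : rat) n m : (m <= n)%N ->
  (x + 1) ^+ m - x ^+ m = \sum_(l < n | (l < m)%N) 'C(m, l)%:R * x ^+ l.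
Proof.
move=> mn; rewrite addrC [x + 1]addrC exprDn big_ord_recr /= binn subnn expr0 mul1r.
rewrite mulr1n addrCA addNr addr0.
rewrite (big_ord_widen n (fun l => (1 ^+ (m - l) * x ^+ l) *+ 'C(m, l)))//.
by apply: eq_bigr => l _; rewrite expr1n mul1r mulr_natl.
Qed.

(** This is B_(k+1)(x + 1) - B_(k+1)(x) = (k + 1) x^k for the Bernoulli polynomial, whose constant
    term is left out on both sides. After the exchange of sums, the inner sum over j is the defining
    recursion, which leaves only l = k. *)
Lemma faulhaber_step k (x : rat) :
  \sum_(j < k.+1) 'C(k.+1, j)%:R * bernoulli j * (x + 1) ^+ (k.+1 - j) =
  \sum_(j < k.+1) 'C(k.+1, j)%:R * bernoulli j * x ^+ (k.+1 - j) + k.+1%:R * x ^+ k.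
Proof.
apply/eqP; rewrite [X in _ == X]addrC -subr_eq -sumrB; apply/eqP.
under eq_bigr => j _.
  rewrite -mulrBr (@exprD1_sub _ k.+1) ?leq_subr// mulr_sumr.
  over.
rewrite (exchange_big_dep xpredT)//=.
under eq_bigr => l _.
  under eq_bigr => j jl.
    have -> : 'C(k.+1, j)%:R * bernoulli j * ('C(k.+1 - j, l)%:R * x ^+ l) =
      'C(k.+1, l)%:R * x ^+ l * ('C((k - l).+1, j)%:R * bernoulli j) :> rat.
      rewrite mulrACA -natrM -subSn -1?ltnS// -bin_shuffle; last lia.
      rewrite natrM; ring.
    over.
  rewrite -mulr_sumr.
  have -> : \sum_(i < k.+1 | (l < k.+1 - i)%N) 'C((k - l).+1, i)%:R * bernoulli i
      = (k - l == 0)%N%:R :> rat.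
    have <- := bernoulliP (k - l).
    rewrite (big_ord_widen k.+1 (fun i => 'C((k - l).+1, i)%:R * bernoulli i)); last lia.
    by apply: eq_bigl => i; have := ltn_ord l; have := ltn_ord i; lia.
  over.
rewrite big_ord_recr /= big1 ?add0r; last first.
  by move=> i _; rewrite subn_eq0 leqNgt ltn_ord mulr0.
by rewrite subnn mulr1 binSn.
Qed.

(** Telescoping of [faulhaber_step]. The terms are put in increasing powers of N because for N = p^s
    the term i = 0, which is B_k N, dominates p-adically. *)
Lemma faulhaber k N :
  (\sum_(j < N) j ^ k)%:R =
  \sum_(i < k.+1) 'C(k, i)%:R * bernoulli (k - i) * N%:R ^+ i.+1 / i.+1%:R :> rat.
Proof.
have k0 : (k.+1%:R : rat) != 0 by rewrite pnatr_eq0.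
apply: (mulfI k0).
transitivity (\sum_(j < k.+1) 'C(k.+1, j)%:R * bernoulli j * N%:R ^+ (k.+1 - j)).
  elim: N => [|N IH].
    rewrite big_ord0 mulr0 big1// => j _.
    by rewrite subSn -1?ltnS// expr0n mulr0.
  by rewrite big_ord_recr natrD /= -[N.+1%:R]natr1 faulhaber_step mulrDr -IH natrX.
rewrite (reindex_inj rev_ord_inj) mulr_sumr /=; apply: eq_bigr => i _.
have ik : (i <= k)%N by rewrite -ltnS.
rewrite subSS (_ : k.+1 - (k - i) = i.+1)%N; last lia.
have -> : 'C(k.+1, k - i) = 'C(k.+1, i.+1).
  by rewrite -bin_sub; [congr 'C(_,_); lia|lia].
have i0 : (i.+1%:R : rat) != 0 by rewrite pnatr_eq0.
have h : k.+1%:R * 'C(k, i)%:R = i.+1%:R * 'C(k.+1, i.+1)%:R :> rat.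
  by rewrite -!natrM mul_bin_diag.
apply: (mulfI i0); rewrite !mulrA -h [RHS]mulrC; field.
by rewrite ?natr1 ?nat1r i0.
Qed.

(** * Generating series of the Bernoulli numbers, truncated *)

(** Equality of power series up to order K is encoded as divisibility of a difference of polynomials
    by X^K; identities between series then become explicit combinations checked by [ring]. *)
Lemma dvdXnP (F : fieldType) K (P : {poly F}) :
  reflect (forall i, (i < K)%N -> P`_i = 0) ('X^K %| P).
Proof.
apply: (iffP idP) => [/dvdpP[Q ->] i iK|h]; first by rewrite coefMXn iK.
have -> : P = drop_poly K P * 'X^K.
  apply/polyP => i; rewrite coefMXn coef_drop_poly; case: ltnP => [/h//|Ki].
  by rewrite subnK.
by rewrite dvdp_mull.
Qed.

Lemma dvdXn_deriv (F : fieldType) K (P : {poly F}) :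
  'X^K %| P -> 'X^(K.-1) %| P^`().
Proof.
move=> /dvdXnP h; apply/dvdXnP => i iK; rewrite coef_deriv h ?mul0rn//.
by case: K iK {h}.
Qed.

(** This and the next two are truncations of b = x/(e^x - 1), of e = (e^x - 1)/x and of e^x. *)
Definition bern_poly K : {poly rat} := \poly_(i < K) (bernoulli i / i`!%:R).
Definition eps_poly K : {poly rat} := \poly_(i < K) (i.+1`!%:R)^-1.
Definition exp_poly K : {poly rat} := \poly_(i < K) (i`!%:R)^-1.

Lemma fact_neq0 (F : numFieldType) n : n`!%:R != 0 :> F.
Proof. by rewrite pnatr_eq0 -lt0n fact_gt0. Qed.

Lemma bin_natE n i : (i <= n)%N ->
  'C(n, i)%:R = n`!%:R / (i`!%:R * (n - i)`!%:R) :> rat.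
Proof.
by move=> /bin_fact <-; rewrite natrM natrM mulfK // mulf_neq0 ?fact_neq0.
Qed.

Lemma bern_eps K : 'X^K %| bern_poly K * eps_poly K - 1.
Proof.
apply/dvdXnP => n nK; rewrite coefB coefM coef1.
have -> : (n == 0)%:R = (n.+1`!%:R)^-1 * (n == 0)%:R :> rat.
  by case: n nK => [|n] _; rewrite ?mulr0// fact1 invr1 mul1r.
rewrite -(bernoulliP n) mulr_sumr -sumrB big1// => i _.
have iK : (i <= n)%N by rewrite -ltnS.
rewrite !coef_poly !(leq_ltn_trans _ nK)// ?leq_subr//.
rewrite bin_natE; last exact: leqW.
rewrite subSn//.
have a := fact_neq0 rat n.+1; have b := fact_neq0 rat i.
have c := fact_neq0 rat (n - i).+1.
by field; rewrite a b c.
Qed.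

Lemma exp_eps K : 'X^K %| exp_poly K - (1 + 'X * eps_poly K).
Proof.
apply/dvdXnP => -[|n] nK; rewrite coefB coefD coef1 coefXM coef_poly nK /=.
  by rewrite fact0 invr1 addr0 subrr.
by rewrite coef_poly (ltn_trans _ nK)// add0r subrr.
Qed.

Lemma exp_deriv K : 'X^(K.-1) %| (exp_poly K)^`() - exp_poly K.
Proof.
apply/dvdXnP => n nK; have nK1 : (n.+1 < K)%N by case: K nK.
rewrite coefB coef_deriv !coef_poly nK1 (ltn_trans _ nK1)//.
rewrite factS natrM invfM -[X in X - _]mulr_natl mulrA mulfV ?mul1r ?subrr//.
by rewrite pnatr_eq0.
Qed.

(** The differential equation b^2 = b - x b - x b' of b = x/(e^x - 1), obtained by differentiating b
    e = 1 and 1 + x e = e^x. Differentiation costs one order of precision. *)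
Lemma bern_poly_sqr K : 'X^(K.-1) %|
  bern_poly K ^+ 2 - (bern_poly K - 'X * bern_poly K - 'X * (bern_poly K)^`()).
Proof.
set b := bern_poly K; set e := eps_poly K; set E := exp_poly K.
have K1 : ('X^(K.-1) : {poly rat}) %| 'X^K by rewrite dvdp_exp2l ?leq_pred.
have h1 : 'X^(K.-1) %| b * e - 1 := dvdp_trans K1 (bern_eps K).
have h2 := dvdXn_deriv (bern_eps K).
have h3 : 'X^(K.-1) %| E - (1 + 'X * e) := dvdp_trans K1 (exp_eps K).
have h4 := dvdXn_deriv (exp_eps K).
have h5 := exp_deriv K.
rewrite -/b -/e -/E in h2 h4 h5.
rewrite !derivE -/b -/e -/E in h2 h4 h5.
rewrite (_ : _ - _ = 'X * b * (b^`() * e + b * e^`() - 0)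
   - ('X * b^`() + 'X * b - b) * (b * e - 1) + b ^+ 2 * (E^`() - (0 + (1 * e + 'X * e^`()))
    - (E^`() - E) - (E - (1 + 'X * e)))); last by ring.
apply: dvdp_add; first by apply: dvdp_sub; apply: dvdp_mull.
by apply/dvdp_mull/dvdp_sub => //; apply: dvdp_sub.
Qed.

(** Euler's identity, the coefficient of x^n in b^2 = b - x b - x b'. It will give the constant term
    of Rankin's identity. *)
Lemma bernoulli_conv n : (0 < n)%N ->
  \sum_(j < n.+1) 'C(n, j)%:R * bernoulli j * bernoulli (n - j) =
  (1 - n%:R) * bernoulli n - n%:R * bernoulli n.-1.
Proof.
case: n => // n _; rewrite [_.-1]/=.
have /dvdXnP/(_ n.+1) := bern_poly_sqr n.+3; rewrite ltnS leqnn => /(_ isT).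
rewrite !(coefB, coefXM) /= coef_deriv expr2 coefM => /eqP.
rewrite subr_eq0 => /eqP h.
transitivity (n.+1`!%:R * \sum_(j < n.+2) (bern_poly n.+3)`_j * (bern_poly n.+3)`_(n.+1 - j)).
  rewrite mulr_sumr; apply: eq_bigr => j _.
  have jn : (j <= n.+1)%N by rewrite -ltnS.
  rewrite !coef_poly !ifT; try lia.
  rewrite bin_natE//.
  have a := fact_neq0 rat n.+1; have b := fact_neq0 rat j.
  have c := fact_neq0 rat (n.+1 - j).
  by field; rewrite b c.
rewrite h !coef_poly !ifT; try lia.
rewrite factS natrM -mulr_natl.
have a := fact_neq0 rat n; have b : n.+1%:R != 0 :> rat by rewrite pnatr_eq0.
by field; rewrite a ?nat1r ?natr1 b.
Qed.

Lemma coef_compN (P : {poly rat}) i : (P \Po (- 'X))`_i = (-1) ^+ i * P`_i.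
Proof.
have [->|/eqP P0] := P =P 0; first by rewrite comp_poly0 !coef0 mulr0.
rewrite comp_polyE coef_sum.
under eq_bigr do rewrite -scaleN1r exprZn scalerA coefZ coefXn.
have [iP|Pi] := ltnP i (size P).
  rewrite (bigD1 (Ordinal iP)) //= eqxx mulr1 big1 ?addr0 1?mulrC// => j ji.
  by move: ji; rewrite -val_eqE /= eq_sym => /negbTE->; rewrite mulr0.
rewrite nth_default // mulr0 big1 // => j _.
by rewrite eq_sym ltn_eqF ?mulr0// (leq_trans _ Pi).
Qed.

Lemma exp_opp K : 'X^K %| exp_poly K * (exp_poly K \Po (- 'X)) - 1.
Proof.
apply/dvdXnP => n nK; rewrite coefB coefM coef1.
have -> : (n == 0)%:R = (n`!%:R)^-1 * (-1 + 1) ^+ n :> rat.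
  by rewrite addNr expr0n; case: n nK => [|n] _; rewrite ?mulr0// fact0 invr1 mul1r.
rewrite exprDn mulr_sumr -sumrB big1// => i _.
have iK : (i <= n)%N by rewrite -ltnS.
rewrite coef_compN !coef_poly !(leq_ltn_trans _ nK)// ?leq_subr//.
rewrite -[_ *+ 'C(_, _)]mulr_natr bin_natE// expr1n.
have a := fact_neq0 rat n; have b := fact_neq0 rat i.
have c := fact_neq0 rat (n - i).
by field; rewrite a b c.
Qed.

Lemma dvdXn_compN K (P : {poly rat}) : 'X^K %| P -> 'X^K %| P \Po (- 'X).
Proof.
by move=> /dvdXnP h; apply/dvdXnP => i iK; rewrite coef_compN h ?mulr0.
Qed.

(** From b(-x) - b(x) = x, a consequence of e^x e^(-x) = 1. *)
Lemma bernoulli_odd n : odd n -> (1 < n)%N -> bernoulli n = 0.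
Proof.
move=> on n1; set K := n.+2.
set b := bern_poly K; set e := eps_poly K; set E := exp_poly K.
have Kd (P : {poly rat}) : 'X^K %| P -> 'X^(n.+1) %| P.
  by apply: dvdp_trans; rewrite dvdp_exp2l.
have h1 : 'X^(n.+1) %| b * e - 1 := Kd _ (bern_eps K).
have h1' := dvdXn_compN h1.
have h3 : 'X^K %| E - (1 + 'X * e) := exp_eps K.
have h3' := dvdXn_compN h3.
have h2 := exp_opp K; rewrite -/E in h2.
rewrite !(rmorphB, rmorphD, rmorphM, rmorph1) /= comp_polyX in h1' h3'.
set b' := b \Po _ in h1'; set e' := e \Po _ in h1' h3'; set E' := E \Po _ in h3' h2.
(* This is (1 + x e(x)) (1 - x e(-x)) = 1 divided by x, which explains the precision n + 2 at the
   start. *)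
have h4 : 'X^(n.+1) %| e - e' - 'X * e * e'.
  rewrite -(@dvdp_mul2l _ 'X) ?polyX_eq0// -exprS.
  rewrite (_ : 'X * (e - e' - 'X * e * e') = (E * E' - 1) - E' * (E - (1 + 'X * e))
     - (1 + 'X * e) * (E' - (1 + - 'X * e'))); last by ring.
  by apply: dvdp_sub; [apply: dvdp_sub|] => //; apply: dvdp_mull.
have : 'X^(n.+1) %| b' - b - 'X.
  rewrite (_ : b' - b - 'X = b * b' * (e - e' - 'X * e * e') - b' * (b * e - 1)
     + b * (b' * e' - 1) + 'X * (b * e * (b' * e' - 1) + (b * e - 1))); last by ring.
  apply: dvdp_add; last by apply/dvdp_mull/dvdp_add => //; apply/dvdp_mull.
  apply: dvdp_add; last by apply/dvdp_mull.
  by apply: dvdp_sub; apply: dvdp_mull.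
move=> /dvdXnP/(_ n (ltnSn n)); rewrite !coefB coef_compN coefX -signr_odd on.
rewrite (_ : (n == 1)%N = false) ?subr0; last by case: n n1 {K b e E Kd h1 h3 h1' h3' h2 b' e' E' h4 on} => [|[]].
rewrite coef_poly ifT; last by rewrite /K; lia.
rewrite expr1 mulN1r -opprD => /eqP; rewrite oppr_eq0 -mulr2n mulrn_eq0 /=.
by rewrite mulf_eq0 invr_eq0 (negbTE (fact_neq0 _ _)) orbF => /eqP.
Qed.

(** * Skoruppa's Euclidean step on the solutions of a x + b y = N *)

Section Skoruppa.
Variable N : nat.
Local Notation I := 'I_N.+1.

(** Positivity bounds all four unknowns by N, so the solutions live in a finite type. *)
Definition quad (a b x y : nat) : bool :=
  [&& 0 < a, 0 < b, 0 < x, 0 < y & a * x + b * y == N]%N.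

Definition qsum (P : nat -> nat -> nat -> nat -> bool)
    (F : nat -> nat -> nat -> nat -> rat) : rat :=
  \sum_(t : (I * I) * (I * I) | quad t.1.1 t.1.2 t.2.1 t.2.2 && P t.1.1 t.1.2 t.2.1 t.2.2)
    F t.1.1 t.1.2 t.2.1 t.2.2.

Lemma quad_le a b x y : quad a b x y -> (a + b < N.+1)%N /\ (x + y < N.+1)%N.
Proof.
move=> /and5P[a0 b0 x0 y0 /eqP <-]; rewrite !ltnS; split; apply: leq_add.
- exact: leq_pmulr.
- exact: leq_pmulr.
- exact: leq_pmull.
- exact: leq_pmull.
Qed.

Lemma qsum_swap P F : qsum P F = qsum (fun a b x y => P b a y x) (fun a b x y => F b a y x).
Proof.
rewrite /qsum (reindex_inj (h := fun t : (I * I) * (I * I) => ((t.1.2, t.1.1), (t.2.2, t.2.1)))) /=.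
  by apply: eq_bigl => -[[a b] [x y]] /=; rewrite /quad addnC; congr (_ && _); lia.
by move=> [[a b] [x y]] [[a' b'] [x' y']] /= [-> -> -> ->].
Qed.

(** Since a x + b y = a (x - y) + (a + b) y, the map (a, b, x, y) -> (a, a + b, x - y, y) is a
    bijection from the solutions with y < x to those with a < b. *)
Lemma qsum_euclid (f : nat -> nat -> rat) :
  qsum (fun a b x y => y < x)%N (fun a b x y => f a (a + b)%N) =
  qsum (fun a b x y => a < b)%N (fun a b x y => f a b).
Proof.
rewrite /qsum (reindex_onto
  (fun t : (I * I) * (I * I) => ((t.1.1, inord (t.1.2 - t.1.1)%N), (inord (t.2.1 + t.2.2)%N, t.2.2)))
  (fun t : (I * I) * (I * I) => ((t.1.1, inord (t.1.1 + t.1.2)%N), (inord (t.2.1 - t.2.2)%N, t.2.2)))) /=; last first.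
  move=> [[a b] [x y]] /= /andP[/quad_le[h1 _] yx].
  have h2 : (x - y < N.+1)%N by have := ltn_ord x; lia.
  have bN := ltn_ord b; have xN := ltn_ord x.
  by congr (_, _, (_, _)); apply: val_inj; rewrite /= !inordK; lia.
have inK (u v : I) : nat_of_ord (inord (u - v) : I) = (u - v)%N.
  by rewrite inordK // ltnS (leq_trans (leq_subr _ _)) // -ltnS.
(* A sum beyond N is sent to 0 by [inord]; the condition [y < x] then fails and excludes it. *)
have inD (u v : I) : nat_of_ord (inord (u + v) : I) = (if (u + v < N.+1)%N then u + v else 0)%N.
  by rewrite /inord val_insubd.
have key (t : (I * I) * (I * I)) :
  (quad t.1.1 (inord (t.1.2 - t.1.1) : I) (inord (t.2.1 + t.2.2) : I) t.2.2 &&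
   (t.2.2 < (inord (t.2.1 + t.2.2) : I))%N) =
  (quad t.1.1 t.1.2 t.2.1 t.2.2 && (t.1.1 < t.1.2)%N).
  case: t => [[a b] [x y]] /=; rewrite inK inD.
  apply/idP/idP.
    case: ifP => xyN; last by rewrite ltn0 andbF.
    move=> /andP[/and5P[a0 b0 x0 y0 /eqP eN] yx].
    have ab : (a < b)%N by lia.
    rewrite ab andbT /quad a0 (ltn_trans a0 ab) y0 (_ : 0 < x)%N; last lia.
    apply/eqP; move: eN; rewrite mulnDr mulnBl.
    have : (a * y <= b * y)%N by rewrite leq_mul2r ltnW ?orbT.
    lia.
  move=> /andP[q ab]; have [h1 h2] := quad_le q; rewrite h2.
  move: q => /and5P[a0 b0 x0 y0 /eqP eN].
  rewrite /quad a0 y0 subn_gt0 ab addn_gt0 x0 (_ : y < x + y)%N; last lia.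
  rewrite andbT /=.
  apply/eqP; move: eN; rewrite mulnDr mulnBl.
  have : (a * y <= b * y)%N by rewrite leq_mul2r ltnW ?orbT.
  lia.
apply: eq_big => [t|t]; rewrite key; last first.
  case: t => [[a b] [x y]] /= /andP[/andP[q ab] _].
  by rewrite inK subnKC // ltnW.
case: t => [[a b] [x y]] /=; rewrite andb_idr // => /andP[q ab].
have [h1 h2] := quad_le q.
apply/eqP; congr (_, _, (_, _)); apply: val_inj => /=.
  by rewrite inK subnKC ?inordK // ltnW.
by rewrite inD h2 addnK inordK.
Qed.

Lemma qsumD P F G : qsum P (fun a b x y => F a b x y + G a b x y) = qsum P F + qsum P G.
Proof. exact: big_split. Qed.

Lemma qsumN P F : qsum P (fun a b x y => - F a b x y) = - qsum P F.
Proof. exact: sumrN. Qed.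

Lemma qsumID Q P F : qsum P F =
  qsum (fun a b x y => P a b x y && Q a b x y) F + qsum (fun a b x y => P a b x y && ~~ Q a b x y) F.
Proof.
rewrite /qsum (bigID (fun t : (I * I) * (I * I) => Q t.1.1 t.1.2 t.2.1 t.2.2)) /=.
by congr (_ + _); apply: eq_bigl => t; rewrite andbA.
Qed.

Lemma eq_qsum (P Q : nat -> nat -> nat -> nat -> bool) F G :
  (forall a b x y, quad a b x y -> P a b x y = Q a b x y) ->
  (forall a b x y, quad a b x y -> P a b x y -> F a b x y = G a b x y) -> qsum P F = qsum Q G.
Proof.
move=> PQ FG; apply: eq_big => [t|t /andP[q p]]; last exact: FG.
by case q: (quad _ _ _ _) => //=; apply: PQ.
Qed.

(* The Euclidean step pairs the solutions with y < x and those with a < b;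
   it is applied to the functions (a - b)^w, b^w and a^w. *)
Lemma qsum_odd_part w : (0 < w)%N -> ~~ odd w ->
  qsum (fun _ _ _ _ => true)
    (fun a b _ _ => (a + b)%:R ^+ w - (a%:R - b%:R) ^+ w) =
  qsum (fun _ _ x y => x == y) (fun a b _ _ => (a + b)%:R ^+ w + a%:R ^+ w + b%:R ^+ w) -
  qsum (fun a b _ _ => a == b) (fun a b _ _ => a%:R ^+ w + b%:R ^+ w).
Proof.
move=> w0 ew.
pose T := fun _ _ _ _ : nat => true.
pose lt1 := fun a b _ _ : nat => (a < b)%N; pose gt1 := fun a b _ _ : nat => (b < a)%N.
pose eq1 := fun a b _ _ : nat => (a == b)%N.
pose lt2 := fun _ _ x y : nat => (x < y)%N; pose gt2 := fun _ _ x y : nat => (y < x)%N.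
pose eq2 := fun _ _ x y : nat => (x == y)%N.
pose A := fun a _ _ _ : nat => (a%:R : rat) ^+ w.
pose B := fun _ b _ _ : nat => (b%:R : rat) ^+ w.
pose S := fun a b _ _ : nat => ((a + b)%:R : rat) ^+ w.
pose D := fun a b _ _ : nat => ((a%:R - b%:R) : rat) ^+ w.
have split1 F : qsum T F = qsum lt1 F + qsum gt1 F + qsum eq1 F.
  rewrite (qsumID lt1) -addrA; congr (_ + _).
  by rewrite (qsumID gt1); congr (_ + _); apply: eq_qsum => // a b x y _;
    rewrite /lt1 /gt1 /eq1 /T /=; lia.
have split2 F : qsum T F = qsum lt2 F + qsum gt2 F + qsum eq2 F.
  rewrite (qsumID lt2) -addrA; congr (_ + _).
  by rewrite (qsumID gt2); congr (_ + _); apply: eq_qsum => // a b x y _;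
    rewrite /lt2 /gt2 /eq2 /T /=; lia.
have DS a b : (a%:R - b%:R) ^+ w = (b%:R - a%:R) ^+ w :> rat.
  by rewrite -opprB exprNn -signr_odd (negbTE ew) mul1r.
have e1 : qsum gt2 S = qsum lt1 B := qsum_euclid (fun _ b => b%:R ^+ w).
have e2 : qsum lt2 S = qsum gt1 A.
  rewrite qsum_swap [RHS]qsum_swap -e1; apply: eq_qsum => // a b x y _ _.
  by rewrite /S addnC.
have e3 : qsum gt2 B = qsum lt1 D.
  rewrite -[RHS](qsum_euclid (fun a b => (a%:R - b%:R) ^+ w)).
  apply: eq_qsum => // a b x y _ _.
  by rewrite DS natrD addrC addKr.
have e4 : qsum lt2 A = qsum gt1 D.
  rewrite qsum_swap [RHS]qsum_swap [LHS]e3; apply: eq_qsum => // a b x y _ _.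
  by rewrite /D DS.
have e5 : qsum gt2 A = qsum lt1 A := qsum_euclid (fun a _ => a%:R ^+ w).
have e6 : qsum lt2 B = qsum gt1 B by rewrite qsum_swap [RHS]qsum_swap [LHS]e5.
have e7 : qsum eq1 D = 0.
  by rewrite /qsum big1 // => t /andP[_ /eqP ab]; rewrite /D ab subrr expr0n gtn_eqF.
have tA := split1 A; rewrite split2 in tA.
have tB := split1 B; rewrite split2 in tB.
rewrite (qsumD _ S (fun a b x y => - D a b x y)) qsumN.
rewrite (qsumD _ (fun a b x y => S a b x y + A a b x y) B) (qsumD _ S A) (qsumD _ A B).
have := split2 S; have := split1 D.
rewrite -/T -/eq1 -/eq2; lra.
Qed.
End Skoruppa.

(** * Divisor sums and Rankin's identity *)

Lemma big_divisors (V : nmodType) N (F : nat -> V) : (0 < N)%N ->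
  \sum_(d <- divisors N) F d = \sum_(d < N.+1 | (d %| N)%N) F d.
Proof.
move=> N0; rewrite -(big_mkord (fun d => d %| N)%N) -big_filter.
apply/perm_big/uniq_perm; rewrite ?divisors_uniq ?filter_uniq ?iota_uniq// => d.
rewrite mem_filter mem_index_iota -dvdn_divisors// ltnS andbC.
by apply/idP/andP => [dN|[]//]; split=> //; apply: dvdn_leq.
Qed.

Lemma sum_divisors_inv (V : nmodType) N (F : nat -> V) : (0 < N)%N ->
  \sum_(d <- divisors N) F (N %/ d)%N = \sum_(d <- divisors N) F d.
Proof.
move=> N0; rewrite -(big_map (fun d => N %/ d)%N xpredT).
apply/perm_big/uniq_perm; rewrite ?divisors_uniq//.
  rewrite map_inj_in_uniq ?divisors_uniq// => d e; rewrite -!dvdn_divisors//.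
  by move=> dN eN /(congr1 (divn N)); rewrite !divnA // !mulKn.
move=> d; apply/mapP/idP => [[e]|]; rewrite -!dvdn_divisors//.
  by move=> eN ->; apply: dvdn_div.
move=> dN; exists (N %/ d)%N; first by rewrite -dvdn_divisors// dvdn_div.
by rewrite divnA // mulKn.
Qed.

Section QuadSums.
Variable N : nat.
Hypothesis N0 : (0 < N)%N.
Local Notation I := 'I_N.+1.

Lemma qsum_transpose P F : qsum N P F =
  qsum N (fun a b x y => P x y a b) (fun a b x y => F x y a b).
Proof.
rewrite /qsum (reindex_inj (h := fun t : (I * I) * (I * I) => (t.2, t.1))) /=.
  apply: eq_bigl => -[[a b] [x y]] /=; rewrite /quad mulnC [(y * b)%N]mulnC.
  by congr (_ && _); lia.
by move=> [a b] [c d] /= [-> ->].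
Qed.

(** When x = y the equation reads (a + b) x = N: e = a + b is a divisor of N, and a is free between
    0 and e. *)
Lemma qsum_xx (F : nat -> nat -> nat -> rat) :
  qsum N (fun _ _ x y => x == y) (fun a b x _ => F a b x) =
  \sum_(e <- divisors N) \sum_(0 <= a < e | (0 < a)%N) F a (e - a)%N (N %/ e)%N.
Proof.
rewrite big_divisors //.
transitivity (\sum_(e < N.+1 | (e %| N)%N) \sum_(a : I | (0 < a < e)%N) F a (e - a)%N (N %/ e)%N); last first.
  apply: eq_bigr => e _; rewrite big_mkord.
  rewrite (big_ord_widen_cond N.+1 (fun a => 0 < a)%N (fun a => F a (e - a)%N (N %/ e)%N))//.
  exact: ltnW.
rewrite pair_big_dep /= /qsum.
rewrite (reindex_onto
  (fun u : I * I => ((u.2, inord (u.1 - u.2)), (inord (N %/ u.1), inord (N %/ u.1))))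
  (fun t : (I * I) * (I * I) => (inord (t.1.1 + t.1.2), t.1.1))) /=; last first.
  move=> [[a b] [x y]] /= /andP[q /eqP xy]; have [h1 h2] := quad_le q.
  have bN := ltn_ord b; have xN := ltn_ord x.
  move: q => /and5P[a0 b0 x0 y0 /eqP eN].
  have h : (N %/ (a + b) = x)%N.
    have ab0 : (0 < a + b)%N by rewrite addn_gt0 a0.
    by apply/eqP; rewrite eq_sym eqn_div //; [nia|apply/dvdnP; exists (x : nat); nia].
  congr (_, _, (_, _)); apply: val_inj; rewrite /= inordK // inordK ?h// 1?addKn//.
have inB (u v : I) : nat_of_ord (inord (u - v) : I) = (u - v)%N.
  by rewrite inordK // ltnS (leq_trans (leq_subr _ _)) // -ltnS.
have inV (u : I) : nat_of_ord (inord (N %/ u) : I) = (N %/ u)%N.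
  by rewrite inordK // ltnS leq_div.
have inD (u v : I) : nat_of_ord (inord (u + v) : I) = (if (u + v < N.+1)%N then u + v else 0)%N.
  by rewrite /inord val_insubd.
apply: eq_big => [[e a]|[e a]] /=; last by rewrite inB inV.
rewrite eqxx andbT /quad inB inV.
apply/idP/idP.
  move=> /andP[/and5P[a0 ea x0 _ /eqP eN] _].
  have ae : (a < e)%N by lia.
  rewrite a0 ae !andbT; apply/dvdnP; exists (N %/ e)%N.
  by apply/esym; rewrite -[RHS]eN -mulnDl subnKC 1?mulnC // ltnW.
move=> /andP[eN /andP[a0 ae]].
have e0 : (0 < e)%N by apply: leq_trans ae.
have q0 : (0 < N %/ e)%N by rewrite divn_gt0 // dvdn_leq.
rewrite a0 subn_gt0 ae q0 /= -mulnDl subnKC ?(ltnW ae)// mulnC divnK // eqxx /=.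
by apply/eqP; congr (_, _); apply: val_inj; rewrite /= inordK.
Qed.

(** The Eisenstein series without its constant term. The value 0 at 0 makes the full convolution
    over 0 <= i <= N count exactly the positive solutions. *)
Definition dsig k m : rat := if m == 0%N then 0 else (sigma k m)%:R.

Lemma sigma_pairs k m : (m <= N)%N ->
  dsig k m = \sum_(u : I * I | [&& 0 < u.1, 0 < u.2 & u.1 * u.2 == m]%N) u.1%:R ^+ k.
Proof.
rewrite /dsig; case: eqP => [-> _|/eqP m0 mN].
  by rewrite big1 // => -[a x] /= /and3P[a0 x0]; rewrite muln_eq0; lia.
rewrite -lt0n in m0.
rewrite /sigma big_divisors // natr_sum.
under eq_bigr do rewrite natrX.
rewrite (big_ord_widen_cond N.+1 (fun d => d %| m)%N (fun d => d%:R ^+ k)) //.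
rewrite [RHS](reindex_onto (fun a : I => (a, inord (m %/ a))) fst) /=; last first.
  move=> [a x] /= /and3P[a0 x0 /eqP e]; congr (_, _); apply: val_inj => /=.
  by rewrite -e mulKn // inordK.
apply: eq_bigl => a; rewrite eqxx andbT.
rewrite inordK; last by rewrite ltnS (leq_trans (leq_div _ _)).
apply/idP/idP.
  move=> /andP[am _]; have a0 : (0 < a)%N by apply: dvdn_gt0 am.
  by rewrite a0 divn_gt0 // dvdn_leq //= mulnC divnK.
move=> /and3P[a0 x0 /eqP e]; rewrite -{1}e dvdn_mulr //= ltnS.
by rewrite -e leq_pmulr.
Qed.

(** Write i = a x and N - i = b y. *)
Lemma dsig_conv r s :
  \sum_(i < N.+1) dsig r i * dsig s (N - i)%N =
  qsum N (fun _ _ _ _ => true) (fun a b _ _ => a%:R ^+ r * b%:R ^+ s).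
Proof.
under eq_bigr => i _.
  rewrite (sigma_pairs r (m := i)) -1?ltnS // (sigma_pairs s (m := (N - i)%N)) ?leq_subr //.
  rewrite big_distrlr /= pair_big /=.
  over.
rewrite (exchange_big_dep xpredT) //= /qsum.
rewrite (reindex_inj (h := fun t : (I * I) * (I * I) => ((t.1.1, t.2.1), (t.1.2, t.2.2)))) /=; last first.
  by move=> [[a b] [x y]] [[a' b'] [x' y']] /= [-> -> -> ->].
rewrite [RHS]big_mkcond; apply: eq_bigr => -[[a b] [x y]] _ /=.
rewrite andbT; case: ifPn => q.
  have /and5P[a0 b0 x0 y0 /eqP eN] := q.
  have axN : (a * x < N.+1)%N by rewrite ltnS; lia.
  rewrite (big_pred1 (Ordinal axN)) // => i; rewrite a0 b0 x0 y0 /=.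
  rewrite -[RHS]val_eqE /= eq_sym; case: eqP => [->|]//=.
  by apply/eqP; lia.
rewrite big1 // => i /andP[/and3P[a0 x0 /eqP e1] /and3P[b0 y0 /eqP e2]].
by case/negP: q; rewrite /quad a0 b0 x0 y0 e1 e2 /= subnKC // -ltnS.
Qed.
End QuadSums.

Definition ecst w : rat := - bernoulli w / (2 * w)%:R.

Lemma eisGE w m : eisG w m = ecst w * (m == 0%N)%:R + dsig w.-1 m.
Proof. by rewrite /eisG /dsig; case: eqP => _; rewrite ?mulr1 ?addr0 ?mulr0 ?add0r. Qed.

Lemma dsigE k N : (0 < N)%N -> dsig k N = \sum_(e <- divisors N) e%:R ^+ k.
Proof.
case: N => // N _; rewrite /dsig /sigma /= natr_sum.
by apply: eq_bigr => e _; rewrite natrX.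
Qed.

Lemma bernoulli0 : bernoulli 0 = 1.
Proof. by have := bernoulliP 0; rewrite big_ord1 bin0 mul1r. Qed.
Lemma bernoulli1 : bernoulli 1 = - 2%:R^-1.
Proof.
have := bernoulliP 1; rewrite !big_ord_recl big_ord0 /= bernoulli0.
by rewrite (_ : 'C(2, 0) = 1)%N // (_ : 'C(2, _) = 2)%N //; lra.
Qed.

Lemma qmul_eisG r s N : (0 < N)%N -> qmul (eisG r) (eisG s) N =
  \sum_(i < N.+1) dsig r.-1 i * dsig s.-1 (N - i)%N
  + ecst r * dsig s.-1 N + dsig r.-1 N * ecst s.
Proof.
case: N => // N _.
transitivity (ecst r * eisG s N.+1 + \sum_(i < N) dsig r.-1 i.+1 * dsig s.-1 (N - i)%N
   + eisG r N.+1 * ecst s).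
  rewrite /qmul big_ord_recl big_ord_recr /= addrA; congr (_ + _ + _).
  - apply: eq_bigr => i _; rewrite !eisGE /bump add1n subSS.
    have -> : (N - i == 0)%N = false by have := ltn_ord i; lia.
    by rewrite !mulr0 !add0r.
  - by rewrite (_ : N.+1 - _ = 0)%N // /bump add1n subnn.
rewrite big_ord_recl big_ord_recr /= !eisGE /= (_ : N.+1 - bump 0 N = 0)%N ?/bump ?add1n ?subnn //.
have d0 k : dsig k 0 = 0 by [].
set s1 := \sum_(i < N) _.
by rewrite !d0; ring.
Qed.

(** Faulhaber's formula with its two leading terms made explicit by B_0 = 1 and B_1 = -1/2. As w is
    even, an even exponent j <= w - 2 would carry a Bernoulli number of odd index > 1, which is
    0. *)
Lemma sum_powers w e : ~~ odd w -> (0 < w)%N ->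
  (\sum_(a < e) a ^ w)%:R = e%:R ^+ w.+1 / w.+1%:R - e%:R ^+ w / 2%:R +
   \sum_(j < w.+1 | odd j) 'C(w, j.-1)%:R * bernoulli (w - j).+1 / j%:R * e%:R ^+ j :> rat.
Proof.
move=> ew w0; rewrite faulhaber big_ord_recr /= subnn bernoulli0 binn !mul1r addrC -addrA.
congr (_ + _); case: w w0 ew => // w _ ew.
rewrite big_ord_recr /= binSn subSnn bernoulli1 addrC; congr (_ + _).
  have w0 : w.+1%:R != 0 :> rat by rewrite pnatr_eq0.
  by field; rewrite ?natr1 ?nat1r w0.
rewrite [RHS]big_mkcond big_ord_recl /= add0r big_ord_recr /= /bump add1n.
have ow : odd w by lia.
rewrite /= ow addr0; apply: eq_bigr => i _; rewrite !add1n /= subSS.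
case: ifPn => oi; first by rewrite -subSn ?(ltnW (ltn_ord i)) //; ring.
have -> : bernoulli (w.+1 - i) = 0 by apply: bernoulli_odd; have := ltn_ord i; lia.
by ring.
Qed.

Lemma odd_binomial w (x y : rat) :
  (x + y) ^+ w - (x - y) ^+ w =
  \sum_(j < w.+1 | odd j) 2%:R * 'C(w, j)%:R * (x ^+ (w - j) * y ^+ j).
Proof.
rewrite exprDn exprBn -sumrB [RHS]big_mkcond; apply: eq_bigr => j _.
rewrite -mulrnBl -[LHS]mulr_natr -signr_odd; case: ifP => oj.
  by rewrite expr1; ring.
by rewrite expr0; ring.
Qed.

(** Evaluates the two diagonals of [qsum_odd_part]. The one with x = y consists of power sums up to
    a divisor e, hence of Bernoulli numbers; the one with a = b counts N/a - 1 pairs (x, y) for each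
    divisor a, whence the term N sigma_(w-1)(N). *)
Lemma sum_powers_divisors w N : ~~ odd w -> (0 < w)%N -> (0 < N)%N ->
  qsum N (fun _ _ _ _ => true)
    (fun a b _ _ => (a + b)%:R ^+ w - (a%:R - b%:R) ^+ w) =
  w.+3%:R / w.+1%:R * dsig w.+1 N - 2%:R * N%:R * dsig w.-1 N +
  2%:R * \sum_(j < w.+1 | odd j) 'C(w, j.-1)%:R * bernoulli (w - j).+1 / j%:R * dsig j N.
Proof.
move=> ew w0 N0; rewrite qsum_odd_part //.
rewrite (qsum_xx N0 (fun a b _ => (a + b)%:R ^+ w + a%:R ^+ w + b%:R ^+ w)).
rewrite (@eq_qsum N _ (fun a b _ _ => a == b) _ (fun a _ _ _ => a%:R ^+ w + a%:R ^+ w)) //; last first.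
  by move=> a b x y _ /eqP->.
rewrite qsum_transpose //= (qsum_xx N0 (fun _ _ x => x%:R ^+ w + x%:R ^+ w)).
under [X in X - _]eq_big_seq => e.
  rewrite -dvdn_divisors // => eN; have e0 : (0 < e)%N by apply: dvdn_gt0 eN.
  have -> : \sum_(0 <= a < e | (0 < a)%N) ((a + (e - a))%:R ^+ w + a%:R ^+ w + (e - a)%:R ^+ w)
    = (e%:R - 1) * e%:R ^+ w + 2%:R * (\sum_(a < e) a ^ w)%:R :> rat.
    rewrite big_mkord; case: e e0 eN => // e _ eN.
    rewrite big_mkcond [in LHS]big_ord_recl /= add0r [in RHS]big_ord_recl exp0n // add0n.
    under eq_bigr => i _.
      rewrite /bump /= !add1n subnKC; last by rewrite ltnW // ltnS.
      over.
    rewrite !big_split /= sumr_const card_ord.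
    have h1 : \sum_(i < e) i.+1%:R ^+ w = (\sum_(i < e) bump 0 i ^ w)%N%:R :> rat.
      by rewrite natr_sum; apply: eq_bigr => i _; rewrite natrX.
    have h2 : \sum_(i < e) (e.+1 - i.+1)%N%:R ^+ w = (\sum_(i < e) bump 0 i ^ w)%N%:R :> rat.
      rewrite -h1 [RHS](reindex_inj rev_ord_inj) /=; apply: eq_bigr => i _.
      by congr (_%:R ^+ _); have := ltn_ord i; lia.
    by rewrite h1 h2 -[_ *+ e]mulr_natl -[e%:R](addrK 1) natr1; ring.
  rewrite (sum_powers _ ew w0).
  over.
under [X in _ - X]eq_big_seq => e.
  rewrite -dvdn_divisors // => eN; have e0 : (0 < e)%N by apply: dvdn_gt0 eN.
  have -> : \sum_(0 <= a < e | (0 < a)%N) ((N %/ e)%:R ^+ w + (N %/ e)%:R ^+ w)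
    = 2%:R * ((N %/ (N %/ e))%:R - 1) * (N %/ e)%:R ^+ w :> rat.
    rewrite divnA // mulKn // big_mkord; case: e e0 eN => // e _ eN.
    rewrite big_mkcond big_ord_recl /= add0r sumr_const card_ord.
    by rewrite -[_ *+ e]mulr_natl -[e%:R](addrK 1) natr1; ring.
  over.
rewrite (sum_divisors_inv (fun d => 2%:R * ((N %/ d)%:R - 1) * d%:R ^+ w)) //.
rewrite -sumrB !dsigE // [w.+3%:R / _ * _]mulr_sumr [2%:R * N%:R * _]mulr_sumr -sumrB.
under [X in _ = _ + _ * X]eq_bigr do rewrite dsigE // mulr_sumr.
rewrite exchange_big mulr_sumr -big_split /=.
apply: eq_big_seq => e; rewrite -dvdn_divisors // => eN.
have e0 : (0 < e)%N by apply: dvdn_gt0 eN.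
have -> : (N %/ e)%:R = N%:R / e%:R :> rat.
  apply: (canRL (mulfK _)); first by rewrite pnatr_eq0 -lt0n.
  by rewrite -natrM divnK.
rewrite mulrDr; set S := \sum_(j < _ | _) _.
have e0' : e%:R != 0 :> rat by rewrite pnatr_eq0 -lt0n.
have w1 : w.+1%:R != 0 :> rat by rewrite pnatr_eq0.
have -> : w.+3%:R = w.+1%:R + 2%:R :> rat by rewrite -natrD addn2.
case: w ew w0 S w1 => // w _ _ S w1; rewrite [w.+1.-1]/= !exprS.
by field; rewrite e0' andbT -natrD pnatr_eq0.
Qed.

(** Rankin's identity in degree 0: Euler's identity for w + 2, rescaled by B_m = -2 m [ecst m]. Its
    two extreme terms are moved to the left, turning w + 1 into w + 3. *)
Lemma ecst_conv w : ~~ odd w -> (1 < w)%N ->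
  w.+3%:R / w.+1%:R * ecst w.+2 =
  2%:R * \sum_(j < w.+1 | odd j) 'C(w, j)%:R * (ecst (w - j).+1 * ecst j.+1).
Proof.
move=> ew w1; have := bernoulli_conv (ltn0Sn w.+1).
rewrite big_ord_recl big_ord_recr /= bin0 subn0 bernoulli0 /bump add1n subnn binn bernoulli0.
rewrite [bernoulli w.+1]bernoulli_odd /= ?ew //; last lia.
have -> : \sum_(i < w.+1) 'C(w.+2, bump 0 i)%:R * bernoulli (bump 0 i) * bernoulli (w.+2 - bump 0 i)
  = 4%:R * w.+2%:R * w.+1%:R * \sum_(j < w.+1 | odd j) 'C(w, j)%:R * (ecst (w - j).+1 * ecst j.+1).
  rewrite mulr_sumr [RHS]big_mkcond; apply: eq_bigr => j _.
  have jw : (j <= w)%N by rewrite -ltnS.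
  rewrite /bump add1n subSS subSn //; case: ifPn => oj; last first.
    have [j0|j0] := posnP j; last by rewrite (bernoulli_odd (n := j.+1)) ?mulr0 ?mul0r //; lia.
    rewrite (bernoulli_odd (n := (w - j).+1)) ?mulr0 //; lia.
  have h : w.+2%:R * w.+1%:R * 'C(w, j)%:R = 'C(w.+2, j.+1)%:R * (w - j).+1%:R * j.+1%:R :> rat.
    rewrite -!natrM; congr _%:R; have := mul_bin_down w.+1 j; rewrite /= => h.
    by rewrite -mulnA h mulnCA mul_bin_diag subSn //; ring.
  have a : (w - j).+1%:R != 0 :> rat by rewrite pnatr_eq0.
  have b : j.+1%:R != 0 :> rat by rewrite pnatr_eq0.
  apply: (mulIf a); apply: (mulIf b).
  rewrite [LHS](_ : _ = 'C(w.+2, j.+1)%:R * (w - j).+1%:R * j.+1%:R * (bernoulli j.+1 * bernoulli (w - j).+1)); last by ring.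
  rewrite -h /ecst !natrM.
  by field; rewrite ?nat1r -?natrD !pnatr_eq0.
set S := \sum_(j < _ | _) _.
have a : w.+1%:R != 0 :> rat by rewrite pnatr_eq0.
have b : w.+2%:R != 0 :> rat by rewrite pnatr_eq0.
move=> h; rewrite /ecst natrM.
have {}h : 4%:R * w.+2%:R * w.+1%:R * S = - w.+3%:R * bernoulli w.+2.
  have -> : w.+3%:R = w.+2%:R + 1 :> rat by rewrite natr1.
  by move: h; rewrite mulr0 !mul1r !mulr1; lra.
apply: (mulfI a); apply: (mulfI b); apply: (mulIf (_ : 2%:R != 0)) => //.
rewrite [RHS](_ : _ = 4%:R * w.+2%:R * w.+1%:R * S); last by ring.
rewrite h; by field; rewrite ?nat1r -?natrD !pnatr_eq0.
Qed.

(** For N > 0 the products of the non-constant parts count the solutions of a x + b y = N with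
    weight the odd part in b of (a + b)^w, which [sum_powers_divisors] evaluates. *)
Theorem eisG_rankin w N : ~~ odd w -> (1 < w)%N ->
  w.+3%:R / w.+1%:R * eisG w.+2 N =
  2%:R * \sum_(j < w.+1 | odd j) 'C(w, j)%:R * qmul (eisG (w - j).+1) (eisG j.+1) N
  + 2%:R * N%:R * eisG w N.
Proof.
move=> ew w1; have [->|N0] := posnP N.
  rewrite mulr0 mul0r addr0 eisGE /= mulr1 addr0 ecst_conv //.
  congr (_ * _); apply: eq_bigr => j _; congr (_ * _).
  by rewrite /qmul big_ord1 !eisGE /= /dsig /= !addr0 !mulr1.
under eq_bigr => j _ do rewrite qmul_eisG // !mulrDr.
rewrite !big_split /=.
have e1 : \sum_(j < w.+1 | odd j) 'C(w, j)%:R * (dsig (w - j) N * ecst j.+1) =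
   \sum_(j < w.+1 | odd j) 'C(w, j)%:R * (ecst (w - j).+1 * dsig j N).
  rewrite (reindex_inj rev_ord_inj) /=; apply: eq_big => [j|j oj].
    by have := ltn_ord j; lia.
  have jw : (j <= w)%N by rewrite -ltnS.
  by rewrite ?subSS subKn // bin_sub // [ecst _ * _]mulrC.
have e2 : 2%:R * \sum_(j < w.+1 | odd j) 'C(w, j)%:R * (\sum_(i < N.+1) dsig (w - j) i * dsig j (N - i)%N)
  = qsum N (fun _ _ _ _ => true)
    (fun a b _ _ => (a + b)%:R ^+ w - (a%:R - b%:R) ^+ w).
  under eq_bigr do rewrite dsig_conv //.
  rewrite mulr_sumr /qsum.
  under eq_bigr do rewrite !mulr_sumr.
  rewrite exchange_big /=; apply: eq_bigr => t _.
  by rewrite natrD odd_binomial; apply: eq_bigr => j _; rewrite mulrA.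
rewrite e1 !mulrDr e2 sum_powers_divisors //; last exact: ltnW.
(* The cross terms with a constant term cancel the Bernoulli sum of [sum_powers_divisors]: each
   occurs twice, by the symmetry [e1], and carries a factor -1/2. *)
have e3 : \sum_(j < w.+1 | odd j) 'C(w, j)%:R * (ecst (w - j).+1 * dsig j N) =
  - 2%:R^-1 * \sum_(j < w.+1 | odd j) 'C(w, j.-1)%:R * bernoulli (w - j).+1 / j%:R * dsig j N.
  rewrite mulr_sumr; apply: eq_bigr => j oj; rewrite /ecst natrM.
  case: j oj => -[|j] //= jw _; have {}jw : (j < w)%N by [].
  rewrite (subnSK jw).
  have a : (w - j)%:R != 0 :> rat by rewrite pnatr_eq0 subn_eq0 -ltnNge.
  have b : j.+1%:R != 0 :> rat by rewrite pnatr_eq0.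
  have h : 'C(w, j.+1)%:R * j.+1%:R = 'C(w, j)%:R * (w - j)%:R :> rat.
    by rewrite -!natrM; congr _%:R; have := mul_bin_left w j; lia.
  apply: (mulIf a); apply: (mulIf b).
  transitivity (- 2%:R^-1 * ('C(w, j.+1)%:R * j.+1%:R) * bernoulli (w - j) * dsig j.+1 N).
    by field.
  by rewrite h; field; rewrite ?nat1r -?natrD !pnatr_eq0.
rewrite e3 !eisGE gtn_eqF //=; by field; rewrite ?nat1r -?natrD !pnatr_eq0.
Qed.

(** * Arithmetic in Z_(p) *)

Definition dvp (p m : nat) (x : rat) : Prop :=
  exists2 z, pintegral p z & x = p%:R ^+ m * z.

Section PIntegral.
Variable p : nat.
Hypothesis p_pr : prime p.

(** Any denominator prime to p will do, reduced or not; this makes sums and products immediate. *)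
Lemma pintegralP x :
  pintegral p x <-> exists2 d, ~~ (p %| d)%N & exists a : int, x * d%:R = a%:~R.
Proof.
split=> [px|[d pNd [a xd]]].
  exists `|denq x|%N => //; exists (numq x).
  by rewrite numqE pmulrn absz_denq.
have d0 : (d%:R : rat) != 0.
  by rewrite pnatr_eq0; apply: contra pNd => /eqP->; rewrite dvdn0.
have xE : x = fracq (a, d%:Z).
  apply: (mulIf d0); rewrite xd fracqE /=.
  by rewrite -pmulrn divfK.
apply: contra pNd => /dvdn_trans; apply.
rewrite xE den_fracq /=.
rewrite (_ : (d%:Z != 0) = true) ?dvdn_div ?dvdn_gcdr //.
by move: d0; rewrite pnatr_eq0.
Qed.

Lemma pint_int (a : int) : pintegral p a%:~R.
Proof. by rewrite /pintegral denq_int dvdn1; case: p p_pr => [|[]]. Qed.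

Lemma pint_nat n : pintegral p n%:R.
Proof. by rewrite pmulrn; apply: pint_int. Qed.

Lemma pint0 : pintegral p 0. Proof. exact: (pint_nat 0). Qed.
Lemma pint1 : pintegral p 1. Proof. exact: (pint_nat 1). Qed.

Lemma pintD x y : pintegral p x -> pintegral p y -> pintegral p (x + y).
Proof.
move=> /pintegralP[d pd [a xd]] /pintegralP[e pe [b ye]]; apply/pintegralP.
exists (d * e)%N; first by rewrite Euclid_dvdM // negb_or pd.
exists (a * e%:Z + b * d%:Z).
by rewrite natrM mulrDl mulrA xd [d%:R * _]mulrC mulrA ye rmorphD /= !rmorphM.
Qed.

Lemma pintM x y : pintegral p x -> pintegral p y -> pintegral p (x * y).
Proof.
move=> /pintegralP[d pd [a xd]] /pintegralP[e pe [b ye]]; apply/pintegralP.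
exists (d * e)%N; first by rewrite Euclid_dvdM // negb_or pd.
by exists (a * b); rewrite natrM mulrACA xd ye rmorphM.
Qed.

Lemma pintN x : pintegral p x -> pintegral p (- x).
Proof. by rewrite /pintegral denqN. Qed.

Lemma pintB x y : pintegral p x -> pintegral p y -> pintegral p (x - y).
Proof. by move=> px py; apply: pintD px (pintN py). Qed.

Lemma pintX x n : pintegral p x -> pintegral p (x ^+ n).
Proof.
move=> px; elim: n => [|n IH]; first by rewrite expr0; exact: pint1.
by rewrite exprS; apply: pintM.
Qed.

Lemma pint_sum I (r : seq I) (P : pred I) (F : I -> rat) :
  (forall i, P i -> pintegral p (F i)) -> pintegral p (\sum_(i <- r | P i) F i).
Proof. by move=> pF; elim/big_rec: _ => [|i x Pi px]; [exact: pint0|apply/pintD/px/pF]. Qed.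

Lemma pintV n : ~~ (p %| n)%N -> pintegral p n%:R^-1.
Proof.
move=> pn; apply/pintegralP; exists n => //; exists 1.
by rewrite mulVf // pnatr_eq0; apply: contra pn => /eqP->; rewrite dvdn0.
Qed.

Lemma dvp_pint m x : dvp p m x -> pintegral p x.
Proof. by move=> [z pz ->]; apply: pintM pz; apply/pintX/pint_nat. Qed.

Lemma pint_dvp0 x : pintegral p x -> dvp p 0 x.
Proof. by exists x => //; rewrite mul1r. Qed.

Lemma dvp_leq m n x : (n <= m)%N -> dvp p m x -> dvp p n x.
Proof.
move=> nm [z pz ->]; exists (p%:R ^+ (m - n) * z).
  by apply: pintM pz; apply/pintX/pint_nat.
by rewrite mulrA -exprD subnKC.
Qed.

Lemma dvp0 m : dvp p m 0.
Proof. by exists 0; rewrite ?mulr0 //; exact: pint0. Qed.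

Lemma dvpD m x y : dvp p m x -> dvp p m y -> dvp p m (x + y).
Proof.
by move=> [a pa ->] [b pb ->]; exists (a + b); rewrite ?mulrDr //; apply: pintD.
Qed.

Lemma dvpN m x : dvp p m x -> dvp p m (- x).
Proof. by move=> [a pa ->]; exists (- a); rewrite ?mulrN //; apply: pintN. Qed.

Lemma dvpB m x y : dvp p m x -> dvp p m y -> dvp p m (x - y).
Proof. by move=> px py; apply: dvpD px (dvpN py). Qed.

Lemma dvpM m n x y : dvp p m x -> dvp p n y -> dvp p (m + n) (x * y).
Proof.
move=> [a pa ->] [b pb ->]; exists (a * b); first exact: pintM.
by rewrite exprD mulrACA.
Qed.

Lemma dvpMl m x y : pintegral p x -> dvp p m y -> dvp p m (x * y).
Proof. by move=> px /(dvpM (pint_dvp0 px)). Qed.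

Lemma dvpMr m x y : dvp p m x -> pintegral p y -> dvp p m (x * y).
Proof. by rewrite mulrC => px py; apply: dvpMl. Qed.

Lemma dvp_sum m I (r : seq I) (P : pred I) (F : I -> rat) :
  (forall i, P i -> dvp p m (F i)) -> dvp p m (\sum_(i <- r | P i) F i).
Proof. by move=> pF; elim/big_rec: _ => [|i x Pi px]; [exact: dvp0|apply/dvpD/px/pF]. Qed.

Lemma dvp_p m : dvp p m (p%:R ^+ m).
Proof. by exists 1; rewrite ?mulr1 //; exact: pint1. Qed.

Lemma dvp_nat m n : (p ^ m %| n)%N -> dvp p m n%:R.
Proof.
by case/dvdnP=> k ->; exists k%:R; [exact: pint_nat|rewrite natrM natrX mulrC].
Qed.

Lemma dvpX m k x : dvp p m x -> dvp p (m * k) (x ^+ k).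
Proof.
move=> [z pz ->]; exists (z ^+ k); first exact: pintX.
by rewrite exprMn -exprM.
Qed.

Lemma dvp_natE m n : dvp p m n%:R -> (p ^ m %| n)%N.
Proof.
move=> [z /pintegralP[d pd [a zd]] nE].
have : (n * d)%:R = (p ^ m)%:R * a%:~R :> rat.
  by rewrite natrM nE -mulrA zd natrX.
rewrite !pmulrn -rmorphM /= => /intr_inj h.
have : (p ^ m %| n * d)%N.
  have -> : (n * d = `|((p ^ m)%N%:Z * a)%R|)%N by rewrite -h.
  by rewrite abszM dvdn_mulr.
by rewrite Gauss_dvdl // coprimeXl // prime_coprime.
Qed.

(** Z_(p) is a local ring: a numerator prime to p may become a denominator. *)
Lemma pint_unit x : pintegral p x -> ~ dvp p 1 x -> pintegral p x^-1.
Proof.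
move=> /pintegralP[d pd [a xd]] nx.
have pa : ~~ (p %| `|a|)%N.
  apply: contra_notN nx => pa.
  have d0 : (d%:R : rat) != 0.
    by rewrite pnatr_eq0; apply: contra pd => /eqP->; rewrite dvdn0.
  have -> : x = a%:~R * d%:R^-1 by rewrite -xd mulfK.
  apply: dvpMr (pintV pd).
  have : dvp p 1 (`|a|%N)%:R by apply: dvp_nat; rewrite expn1.
  rewrite pmulrn abszE; case: (ger0P a) => // _.
  by move/dvpN; rewrite -rmorphN opprK.
have d0 : (d%:R : rat) != 0.
  by rewrite pnatr_eq0; apply: contra pd => /eqP->; rewrite dvdn0.
have -> : x^-1 = d%:R / a%:~R.
  by rewrite -xd invfM mulrCA divff ?mulr1.
apply: pintM; first exact: pint_nat.
have := pintV pa; rewrite pmulrn abszE; case: (ger0P a) => // _.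
by move/pintN; rewrite rmorphN /= invrN opprK.
Qed.

Hypothesis p5 : (5 <= p)%N.

Let p0 : p%:R != 0 :> rat.
Proof. by rewrite pnatr_eq0 -lt0n prime_gt0. Qed.

Lemma dvp_pow_div m a n : (0 < n)%N -> (m + logn p n <= a)%N ->
  dvp p m (p%:R ^+ a / n%:R).
Proof.
move=> n0 h; have [u pu nE] := pfactor_coprime p_pr n0.
have pu' : ~~ (p %| u)%N by rewrite -prime_coprime.
have -> : p%:R ^+ a / n%:R = p%:R ^+ (a - logn p n) * u%:R^-1 :> rat.
  rewrite {1}nE natrM natrX invfM -{1}(subnK (leq_trans (leq_addl m _) h)) exprD.
  have q0 : p%:R ^+ logn p n != 0 :> rat by rewrite expf_neq0.
  have u0 : u%:R != 0 :> rat by rewrite pnatr_eq0; apply: contra pu' => /eqP->; rewrite dvdn0.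
  by field; rewrite u0 q0.
apply: dvpMr (pintV pu') => //; apply: (@dvp_leq (a - logn p n)); first lia.
exact: dvp_p.
Qed.

Lemma logn_leq n : (0 < n)%N -> (logn p n < n)%N.
Proof.
move=> n0; apply: leq_trans (dvdn_leq n0 (pfactor_dvdnn p n)).
exact/ltn_expl/prime_gt1.
Qed.

(** One better than [logn_leq]: it leaves p^i / (i + 1) divisible by p. *)
Lemma logn_leqS i : (0 < i)%N -> (logn p i.+1 < i)%N.
Proof.
move=> i0; set v := logn p i.+1.
have h : (p ^ v <= i.+1)%N by apply: dvdn_leq => //; apply: pfactor_dvdnn.
have [->//|v0] := posnP v.
suff : (v.+2 <= p ^ v)%N by lia.
elim: v v0 {h} => // v IH _; rewrite expnS.
by have [->|/IH] := posnP v; [rewrite expn0; lia | nia].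
Qed.

(** * Kummer's congruences modulo p^2 *)

(** A weak form of von Staudt's theorem. In Faulhaber's formula for N = p the first term is p B_k,
    and the others involve p B_j with j < k, p-integral by induction, times p^(i+1) / (i + 2). *)
Lemma bernoulli_mod k :
  dvp p 1 (p%:R * bernoulli k - (\sum_(j < p) j ^ k)%:R).
Proof.
elim/ltn_ind: k => k IH.
have pB j : (j < k)%N -> pintegral p (p%:R * bernoulli j).
  move=> /IH h; rewrite -[_ * _](subrK (\sum_(i < p) i ^ j)%:R).
  apply: pintD => //; first exact: dvp_pint h.
  exact: pint_nat.
rewrite faulhaber big_ord_recl /= bin0 mul1r subn0 expr1 divr1 [_ * p%:R]mulrC opprD addrA.
rewrite subrr sub0r; apply: dvpN => //; apply: dvp_sum => // i _.
rewrite /bump add1n.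
have -> : 'C(k, i.+1)%:R * bernoulli (k - i.+1) * p%:R ^+ i.+2 / i.+2%:R =
  'C(k, i.+1)%:R * (p%:R * bernoulli (k - i.+1)) * (p%:R ^+ i.+1 / i.+2%:R) :> rat.
  by rewrite [p%:R ^+ i.+2]exprS; ring.
apply: dvpMl => //.
  by apply: pintM (pint_nat _) (pB _ _) => //; have := ltn_ord i; lia.
by apply: dvp_pow_div => //; have := logn_leqS (ltn0Sn i); lia.
Qed.

Lemma pint_pB k : pintegral p (p%:R * bernoulli k).
Proof.
rewrite -[_ * _](subrK (\sum_(i < p) i ^ k)%:R).
by apply: pintD (pint_nat _) => //; apply: dvp_pint (bernoulli_mod k).
Qed.

Lemma dvp_modn m a b : a = b %[mod p ^ m] -> dvp p m (a%:R - b%:R).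
Proof.
wlog ba : a b / (b <= a)%N.
  move=> H; have [/H//|/ltnW ab] := leqP b a.
  by move=> /esym/(H _ _ ab); rewrite -opprB => /dvpN; rewrite opprK; apply.
by move=> /eqP; rewrite eqn_mod_dvd // -natrB // => /dvp_nat; apply.
Qed.

Lemma dvp_fermat d : ~~ (p %| d)%N -> dvp p 1 (d%:R ^+ p.-1 - 1).
Proof.
move=> pd; rewrite -natrX; apply: (@dvp_modn 1 _ 1).
by rewrite expn1 -(totient_prime p_pr) Euler_exp_totient // coprime_sym prime_coprime.
Qed.

(** By Fermat the power sum is p - 1 modulo p. So B_(p-1) has p in its denominator, and this is why
    E = 1 modulo p. *)
Lemma bernoulli_pm1 : dvp p 1 (p%:R * bernoulli p.-1 + 1).
Proof.
have pp := prime_gt1 p_pr.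
have := bernoulli_mod p.-1; rewrite -(big_mkord xpredT (fun j => j ^ p.-1)%N).
rewrite big_ltn ?(ltnW pp) // exp0n ?add0n; last by rewrite -subn1 subn_gt0.
rewrite natr_sum => h.
rewrite (_ : _ + 1 = (p%:R * bernoulli p.-1 - \sum_(1 <= i < p) (i ^ p.-1)%:R) +
   (\sum_(1 <= i < p) ((i ^ p.-1)%:R - 1) + p%:R)); last first.
  by rewrite sumrB sumr_const_nat natrB ?(ltnW pp) //; ring.
apply: dvpD => //; apply: dvpD; last exact: (dvp_p 1).
rewrite big_nat; apply: dvp_sum => i /andP[i0 ip]; rewrite natrX; apply: dvp_fermat.
by rewrite gtnNdvd.
Qed.

Definition bern_quot k : rat := bernoulli k / k%:R.

(** Makes the error terms below uniform in k: no power of p dividing k survives in a denominator. *)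
Lemma bin_divk k i : (0 < k)%N -> (0 < i)%N -> 'C(k, i)%:R / k%:R = 'C(k.-1, i.-1)%:R / i%:R :> rat.
Proof.
case: k i => // k [//|i] _ _ /=.
have a : k.+1%:R != 0 :> rat by rewrite pnatr_eq0.
have b : i.+1%:R != 0 :> rat by rewrite pnatr_eq0.
by apply/eqP; rewrite eqr_div // -!natrM mulnC -mul_bin_diag mulnC.
Qed.

(** B_k / k is the p-adic limit of the power sums below p^s divided by k p^s; these are the error
    terms of Faulhaber's formula. *)
Lemma bdivk_sum k s : (0 < k)%N -> (4 <= s)%N ->
  dvp p 2 ((\sum_(j < p ^ s) j ^ k)%:R / (k%:R * (p ^ s)%:R) - bern_quot k).
Proof.
move=> k0 s4; rewrite faulhaber big_ord_recl /= bin0 mul1r subn0 expr1 divr1.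
have k0' : k%:R != 0 :> rat by rewrite pnatr_eq0 -lt0n.
have N0 : (p ^ s)%:R != 0 :> rat by rewrite natrX expf_neq0.
rewrite mulrDl /bern_quot [X in X + _ - _](_ : _ = bernoulli k / k%:R); last first.
  by field; rewrite k0' N0.
rewrite addrAC subrr add0r mulr_suml; apply: dvp_sum => // i _.
rewrite /bump add1n.
have -> : 'C(k, i.+1)%:R * bernoulli (k - i.+1) * (p ^ s)%:R ^+ i.+2 / i.+2%:R / (k%:R * (p ^ s)%:R) =
   'C(k, i.+1)%:R / k%:R * bernoulli (k - i.+1) * (p ^ s)%:R ^+ i.+1 / i.+2%:R.
  rewrite [(p ^ s)%:R ^+ i.+2]exprS.
  have i0 : i.+2%:R != 0 :> rat by rewrite pnatr_eq0.
  by field; rewrite k0' N0 -natrD pnatr_eq0.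
rewrite bin_divk //=.
have i1 : i.+1%:R != 0 :> rat by rewrite pnatr_eq0.
have i2 : i.+2%:R != 0 :> rat by rewrite pnatr_eq0.
(* One factor p is spent on the denominator of the Bernoulli number, hence the exponent s (i + 1) -
   1. *)
have -> : 'C(k.-1, i)%:R / i.+1%:R * bernoulli (k - i.+1) * (p ^ s)%:R ^+ i.+1 / i.+2%:R =
   'C(k.-1, i)%:R * (p%:R * bernoulli (k - i.+1)) * (p%:R ^+ (s * i.+1).-1 / (i.+1 * i.+2)%N%:R).
  rewrite natrX -exprM -{1}[(s * i.+1)%N]prednK; last by rewrite muln_gt0; lia.
  by rewrite exprS natrM; field; rewrite ?nat1r -?natrD !pnatr_eq0.
apply: dvpMl => //; first by apply: pintM (pint_nat _) (pint_pB _).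
apply: dvp_pow_div => //; rewrite lognM //.
have := logn_leq (ltn0Sn i); have := logn_leqS (ltn0Sn i); nia.
Qed.

Definition unit_power_sum s k : nat := \sum_(j < p ^ s | ~~ (p %| j)%N) j ^ k.

Lemma sum_pow_split s k :
  (\sum_(j < p ^ s.+1) j ^ k = unit_power_sum s.+1 k + p ^ k * \sum_(j < p ^ s) j ^ k)%N.
Proof.
rewrite (bigID (fun j : 'I_(p ^ s.+1) => ~~ (p %| j)%N)) /=; congr (_ + _)%N.
rewrite big_distrr /=.
have pp := prime_gt0 p_pr.
have bnd (j : 'I_(p ^ s)) : (p * j < p ^ s.+1)%N by rewrite expnS ltn_pmul2l.
have bnd' (j : 'I_(p ^ s.+1)) : (j %/ p < p ^ s)%N.
  by rewrite ltn_divLR // mulnC -expnS.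
rewrite (reindex_onto (fun j : 'I_(p ^ s) => Ordinal (bnd j)) (fun j => Ordinal (bnd' j))) /=; last first.
  by move=> j /negPn pj; apply: val_inj; rewrite /= mulnC divnK.
apply: eq_big => [j|j _]; last by rewrite expnMn.
rewrite dvdn_mulr //=; apply/eqP/val_inj => /=.
by rewrite mulKn.
Qed.

(** The multiples of p below p^5 contribute p^k times the power sum below p^4. Removing them leaves
    the Euler factor 1 - p^(k-1). *)
Lemma kummer_U k : (2 <= k)%N ->
  dvp p 2 ((unit_power_sum 5 k)%:R / (k%:R * (p ^ 5)%:R) - (1 - p%:R ^+ k.-1) * bern_quot k).
Proof.
move=> k2; have k0 : (0 < k)%N by apply: leq_trans k2.
have h5 := bdivk_sum k0 (isT : 4 <= 5)%N; have h4 := bdivk_sum k0 (leqnn 4).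
have k0' : k%:R != 0 :> rat by rewrite pnatr_eq0 -lt0n.
rewrite sum_pow_split natrD natrM in h5.
set a := (unit_power_sum 5 k)%:R in h5 *; set b : rat := (\sum_(j < p ^ 4) j ^ k)%:R in h4 h5.
rewrite (_ : _ - _ = ((a + (p ^ k)%:R * b) / (k%:R * (p ^ 5)%:R) - bern_quot k)
   - p%:R ^+ k.-1 * (b / (k%:R * (p ^ 4)%:R) - bern_quot k)); last first.
  have kE : p%:R ^+ k = p%:R * p%:R ^+ k.-1 :> rat by rewrite -exprS prednK.
  rewrite !natrX kE.
  by field; rewrite k0' p0.
by apply: dvpB h5 _ => //; apply: dvpMl h4 => //; apply/pintX/pint_nat.
Qed.

(** A form of Voronoi's congruence. Multiplication by c permutes the units modulo N = p^5; writing c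
    j = r + N q, the sum of (c j)^k - r^k is k N q r^(k-1) to first order, and the higher terms stay
    divisible by p^2 after division by k N. The gain is that on the right the weight appears only as
    an exponent of the unit r. *)
Lemma kummer_regular c k : (2 <= k)%N -> ~~ (p %| c)%N ->
  dvp p 2 ((c%:R ^+ k - 1) * ((1 - p%:R ^+ k.-1) * bern_quot k) -
    \sum_(j < p ^ 5 | ~~ (p %| j)%N) ((c * j) %/ p ^ 5)%:R * ((c * j) %% p ^ 5)%:R ^+ k.-1).
Proof.
move=> k2 pc; have k0 : (0 < k)%N by apply: leq_trans k2.
have k0' : k%:R != 0 :> rat by rewrite pnatr_eq0 -lt0n.
set N := (p ^ 5)%N; have N0 : (0 < N)%N by rewrite expn_gt0 prime_gt0.
have N0' : N%:R != 0 :> rat by rewrite pnatr_eq0 -lt0n.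
have pN : (p %| N)%N by rewrite dvdn_exp.
set X := _ * bern_quot k; pose q j := ((c * j) %/ N)%N; pose r j := ((c * j) %% N)%N.
have pr j : (p %| r j)%N = (p %| j)%N.
  by rewrite /dvdn modn_dvdm // -/(dvdn p (c * j)) Euclid_dvdM // (negbTE pc).
have -> : (c%:R ^+ k - 1) * X - \sum_(j < N | ~~ (p %| j)%N) (q j)%:R * (r j)%:R ^+ k.-1 =
    - ((c%:R ^+ k - 1) * ((unit_power_sum 5 k)%:R / (k%:R * N%:R) - X)) +
    ((c%:R ^+ k - 1) * (unit_power_sum 5 k)%:R / (k%:R * N%:R) - \sum_(j < N | ~~ (p %| j)%N) (q j)%:R * (r j)%:R ^+ k.-1).
  by ring.
apply: dvpD => //.
  apply: dvpN => //; apply: dvpMl (kummer_U k2) => //.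
  by apply: pintB (pint1) => //; apply/pintX/pint_nat.
have rlt (j : 'I_N) : (r j < N)%N by rewrite ltn_mod.
(* j -> c j mod N is a permutation that preserves the multiples of p, so the residues r have the
   same power sum as j. *)
have e1 : (unit_power_sum 5 k)%:R = \sum_(j < N | ~~ (p %| j)%N) (r j)%:R ^+ k :> rat.
  rewrite /unit_power_sum natr_sum -/N (reindex_inj (h := fun j : 'I_N => Ordinal (rlt j))) /=.
    by apply: eq_big => [j|j _]; rewrite ?pr ?natrX.
  move=> i j [] /eqP; rewrite /r => ij; apply/val_inj => /=.
  wlog le_ij : i j ij / (j <= i)%N.
    move=> H; have [/H->//|/ltnW ji] := leqP j i; apply/esym/H => //.
    by rewrite eq_sym.
  move: ij; rewrite eqn_mod_dvd ?leq_mul2l ?le_ij ?orbT // -mulnBr Gauss_dvdr.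
    have ij : (i - j < N)%N by apply: leq_ltn_trans (leq_subr _ _) (ltn_ord i).
    have [ji0|ij0] := posnP (i - j); first by move=> _; lia.
    by move=> /(dvdn_leq ij0); rewrite leqNgt ij.
  by rewrite coprimeXl // prime_coprime.
have e2 : c%:R ^+ k * (unit_power_sum 5 k)%:R = \sum_(j < N | ~~ (p %| j)%N) ((r j)%:R + N%:R * (q j)%:R) ^+ k :> rat.
  rewrite /unit_power_sum natr_sum mulr_sumr; apply: eq_bigr => j _.
  by rewrite natrX -exprMn -!natrM -natrD /r /q addnC [(N * _)%N]mulnC -divn_eq.
rewrite mulrBl mul1r e2 e1 -sumrB mulr_suml -sumrB; apply: dvp_sum => // j _.
rewrite exprDn big_ord_recl /= subn0 expr0 mulr1 bin0 mulr1n addrAC subrr add0r.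
case: k k2 k0 k0' {X e1 e2} => [//|k] k2 k0 k0'.
rewrite big_ord_recl /= !subSS subn0 expr1 bin1 mulrDl.
rewrite [X in X + _ - _](_ : _ = (q j)%:R * (r j)%:R ^+ k); last first.
  by rewrite -[_ *+ k.+1]mulr_natr; field; rewrite ?nat1r ?k0' N0'.
rewrite addrAC subrr add0r mulr_suml; apply: dvp_sum => // i _.
rewrite /bump !add1n subSS -[_ *+ 'C(_,_)]mulr_natr.
have -> : (r j)%:R ^+ (k - i.+1) * (N%:R * (q j)%:R) ^+ i.+2 * 'C(k.+1, i.+2)%:R / (k.+1%:R * N%:R) =
  (r j)%:R ^+ (k - i.+1) * (q j)%:R ^+ i.+2 * N%:R ^+ i.+1 * ('C(k.+1, i.+2)%:R / k.+1%:R) :> rat.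
  by rewrite exprMn [N%:R ^+ i.+2]exprS; field; rewrite ?nat1r ?k0' N0'.
have Np : N%:R ^+ i.+1 = p%:R ^+ (5 * i.+1) :> rat by rewrite exprM /N [X in X ^+ _]natrX.
rewrite bin_divk //=.
have -> : (r j)%:R ^+ (k - i.+1) * (q j)%:R ^+ i.+2 * N%:R ^+ i.+1 * ('C(k, i.+1)%:R / i.+2%:R) =
  (r j)%:R ^+ (k - i.+1) * (q j)%:R ^+ i.+2 * 'C(k, i.+1)%:R * (p%:R ^+ (5 * i.+1) / i.+2%:R) :> rat.
  by rewrite -Np !mulrA; congr (_ / _); rewrite mulrAC.
apply: dvpMl => //.
  by do 2?apply: (pintM); try apply: (pintX); apply: pint_nat.
apply: dvp_pow_div => //.
by have := logn_leq (ltn0Sn i.+1); lia.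
Qed.

(** Such a function is known modulo p^2 at every m once it is known at 0 and 1, which is how [G_1]
    will determine all weights. *)
Definition paffine (h : nat -> rat) : Prop :=
  [/\ pintegral p (h 0%N) & exists2 B, pintegral p B &
    forall m, dvp p 2 (h m - h 0%N - p%:R * m%:R * B)].

Lemma paffine_sum I (s : seq I) (P : pred I) (F : I -> nat -> rat) :
  (forall i, P i -> paffine (F i)) -> paffine (fun m => \sum_(i <- s | P i) F i m).
Proof.
move=> H; split; first by apply: pint_sum => // i /H[].
elim: s => [|i s [B pB hB]].
  exists 0; first exact: pint0.
  by move=> m; rewrite !big_nil mulr0 !subr0; apply: dvp0.
case Pi: (P i); last by exists B => // m; rewrite !big_cons Pi.
have [_ [C pC hC]] := H i Pi.
exists (C + B); first exact: pintD.
move=> m; rewrite !big_cons Pi.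
set S := \sum_(_ <- _ | _) _; set S0 := \sum_(_ <- _ | _) _.
rewrite (_ : _ - _ = (F i m - F i 0%N - p%:R * m%:R * C) + (S - S0 - p%:R * m%:R * B)); last by ring.
exact: dvpD (hC m) (hB m).
Qed.

Lemma paffineMl a h : pintegral p a -> paffine h -> paffine (fun m => a * h m).
Proof.
move=> pa [h0 [B pB hB]]; split; first exact: pintM.
exists (a * B) => [|m]; first exact: pintM.
rewrite (_ : _ - _ = a * (h m - h 0%N - p%:R * m%:R * B)); last by ring.
exact: dvpMl pa (hB m).
Qed.

Lemma dvp_exp1 x m : dvp p 1 x -> dvp p 2 ((1 + x) ^+ m - 1 - m%:R * x).
Proof.
move=> px; have x2 : dvp p 2 (x ^+ 2) := dvpX 2 px.
elim: m => [|m IH]; first by rewrite expr0 subrr mul0r subr0; apply: dvp0.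
rewrite (_ : _ - _ = (1 + x) * ((1 + x) ^+ m - 1 - m%:R * x) + m%:R * x ^+ 2); last first.
  by rewrite exprS -natr1; ring.
apply: dvpD; last by apply: dvpMl x2; apply: pint_nat.
by apply: dvpMl IH; apply: pintD pint1 (dvp_pint px).
Qed.

(** By Fermat d^(p-1) = 1 + p z, and (1 + p z)^m = 1 + m p z modulo p^2. *)
Lemma paffine_pow d k : (0 < k)%N -> ~~ (p %| d)%N ->
  paffine (fun m => d%:R ^+ (k + m * p.-1).-1).
Proof.
move=> k0 pd; have [z pz dz] := dvp_fermat pd.
split; first by apply/pintX/pint_nat.
exists (d%:R ^+ k.-1 * z) => [|m]; first by apply/pintM/pz => //; apply/pintX/pint_nat.
rewrite mul0n addn0 (_ : (k + m * p.-1).-1 = k.-1 + p.-1 * m)%N; last first.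
  by rewrite (mulnC p.-1); case: k k0.
rewrite exprD exprM.
have -> : d%:R ^+ p.-1 = 1 + p%:R * z :> rat by rewrite -[p%:R]expr1 -dz addrC subrK.
rewrite (_ : _ - _ = d%:R ^+ k.-1 * ((1 + p%:R * z) ^+ m - 1 - m%:R * (p%:R * z))); last by ring.
apply: dvpMl => //; first by apply/pintX/pint_nat.
by apply: dvp_exp1; exists z.
Qed.

(** A quotient rule, with slope (Y - U x_0) / u_0. All the values of u agree with u_0 modulo p,
    hence are units. *)
Lemma paffine_div u y x : paffine u -> paffine y -> ~ dvp p 1 (u 0%N) ->
  (forall m, dvp p 2 (u m * x m - y m)) -> paffine x.
Proof.
move=> [u0 [U pU hU]] [y0 [Y pY hY]] nu xE.
have v0 := pint_unit u0 nu.
have un0 : u 0%N != 0 by apply: contra_notN nu => /eqP->; apply: dvp0.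
have xp m : pintegral p (x m).
  have um : dvp p 1 (u m - u 0%N).
    rewrite -[u m - _](subrK (p%:R * m%:R * U)); apply: dvpD => //.
      exact: dvp_leq (hU m).
    rewrite -mulrA; exists (m%:R * U); rewrite ?expr1 //.
    by apply: pintM pU => //; apply: pint_nat.
  have pum : pintegral p (u m).
    by rewrite -[u m](subrK (u 0%N)); apply: pintD u0 => //; apply: dvp_pint um.
  have num : ~ dvp p 1 (u m).
    move=> h; apply: nu; rewrite -[u 0%N](subKr (u m)).
    exact: dvpB h um.
  have um0 : u m != 0 by apply: contra_notN num => /eqP->; apply: dvp0.
  have -> : x m = (u m)^-1 * (u m * x m - y m + y m) by rewrite subrK mulKf.
  apply: pintM (pint_unit pum num) _ => //; apply: pintD => //.
    exact: dvp_pint (xE m).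
  rewrite -[y m](subrK (y 0%N)) -[y m - _](subrK (p%:R * m%:R * Y)).
  apply: pintD y0 => //; apply: pintD; first exact: dvp_pint (hY m).
  by apply/pintM/pY/pintM; rewrite //; apply: pint_nat.
split; first exact: xp.
exists ((u 0%N)^-1 * (Y - U * x 0%N)).
  by apply: pintM v0 _ => //; apply: pintB pY _ => //; apply: pintM.
move=> m.
pose V := p%:R * m%:R * U.
have V1 : dvp p 1 V.
  by rewrite /V -mulrA; exists (m%:R * U); rewrite ?expr1 //; apply: pintM pU => //; apply: pint_nat.
(* u_m (x_m - x_0) = (y_m - y_0) - (u_m - u_0) x_0, and x_m = x_0 mod p *)
have key : dvp p 2 (u 0%N * (x m - x 0%N) + V * (x m - x 0%N) - p%:R * m%:R * (Y - U * x 0%N)).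
  rewrite (_ : _ - _ = (u m * x m - y m) - (u 0%N * x 0%N - y 0%N)
     - (u m - u 0%N - p%:R * m%:R * U) * x m + (y m - y 0%N - p%:R * m%:R * Y)); last first.
    by rewrite /V; ring.
  apply: dvpD => //; apply: dvpB => //; first exact: dvpB.
  by apply: dvpMr (hU m) _.
have x1 : dvp p 1 (x m - x 0%N).
  have := dvp_leq (isT : 1 <= 2)%N key => h.
  rewrite (_ : x m - x 0%N = (u 0%N)^-1 * (u 0%N * (x m - x 0%N))); last by rewrite mulKf.
  apply: dvpMl => //.
  rewrite (_ : _ * _ = (u 0%N * (x m - x 0%N) + V * (x m - x 0%N) - p%:R * m%:R * (Y - U * x 0%N))
    - V * (x m - x 0%N) + p%:R * (m%:R * (Y - U * x 0%N))); last by ring.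
  apply: dvpD => //.
    by apply: dvpB h _ => //; apply: dvpMr V1 _ => //; apply: pintB.
  exists (m%:R * (Y - U * x 0%N)); rewrite ?expr1 //.
  apply: pintM (pint_nat _) _ => //; apply: pintB pY _ => //; exact: pintM.
rewrite (_ : _ - _ = (u 0%N)^-1 * ((u 0%N * (x m - x 0%N) + V * (x m - x 0%N) - p%:R * m%:R * (Y - U * x 0%N))
  - V * (x m - x 0%N))); last by field.
apply: dvpMl => //; apply: dvpB key _ => //.
exact: dvpM V1 x1.
Qed.

(** Otherwise X^k - 1 would have the p - 1 roots 1, ..., p - 1 in F_p, more than its degree. *)
Lemma exists_nonroot k : (0 < k)%N -> (k < p.-1)%N ->
  exists2 c, ~~ (p %| c)%N & ~ dvp p 1 (c%:R ^+ k - 1).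
Proof.
move=> k0 kp.
have [c /and3P[c0 cp ck]|H] := pickP (fun c : 'I_p => [&& 0 < c, c < p & c ^ k != 1 %[mod p]]%N).
  exists c; first by rewrite gtnNdvd.
  rewrite -natrX => h; case/eqP: ck; apply/eqP.
  rewrite eqn_mod_dvd ?expn_gt0 ?c0 // -[X in (X %| _)%N]expn1.
  by apply: dvp_natE => //; rewrite natrB ?expn_gt0 ?c0.
pose rs := [seq i.+1%:R : 'F_p | i <- iota 0 p.-1].
have pp := prime_gt0 p_pr.
have urs : uniq rs.
  rewrite map_inj_in_uniq ?iota_uniq // => i j; rewrite !mem_iota !add0n => /andP[_ ip] /andP[_ jp].
  by move=> /(congr1 val); rewrite /= !val_Fp_nat // !modn_small; lia.
have : all k.-unity_root rs.
  apply/allP => x /mapP[i]; rewrite mem_iota add0n => /andP[_ ip ->].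
  have ip' : (i.+1 < p)%N by lia.
  have := H (Ordinal ip'); rewrite /= ip' /= => /negbFE/eqP ik.
  by rewrite unity_rootE -natrX -Fp_nat_mod // ik Fp_nat_mod.
by move=> /(max_unity_roots k0)/(_ urs); rewrite size_map size_iota leqNgt kp.
Qed.

(** [kummer_regular] exhibits this function as a quotient of two functions built from powers of
    units, affine by [paffine_pow]; the choice of c makes the divisor c^k - 1 a unit. *)
Lemma kummer_affine k : (2 <= k)%N -> (k < p.-1)%N ->
  paffine (fun m => (1 - p%:R ^+ (k + m * p.-1).-1) * bern_quot (k + m * p.-1)).
Proof.
move=> k2 kp; have k0 : (0 < k)%N by apply: leq_trans k2.
have [c pc nc] := exists_nonroot k0 kp.
apply: (@paffine_div (fun m => c%:R ^+ (k + m * p.-1) - 1)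
  (fun m => \sum_(j < p ^ 5 | ~~ (p %| j)%N) ((c * j) %/ p ^ 5)%:R * ((c * j) %% p ^ 5)%:R ^+ (k + m * p.-1).-1)).
- have [h0 [B pB hB]] := paffineMl (pint_nat c) (paffine_pow k0 pc).
  have e m : c%:R ^+ (k + m * p.-1) = c%:R * c%:R ^+ (k + m * p.-1).-1 :> rat.
    by rewrite -exprS prednK // addn_gt0 k0.
  split; first by rewrite e; apply: pintB pint1.
  by exists B => // m; rewrite !e opprB addrA subrK.
- apply: paffine_sum => j pj; apply: paffineMl; first exact: pint_nat.
  apply: paffine_pow => //.
  by rewrite /dvdn modn_dvdm ?dvdn_exp // -/(dvdn p (c * j)) Euclid_dvdM // (negbTE pc).
- by rewrite mul0n addn0.
by move=> m; apply: kummer_regular => //; apply: leq_trans k2 (leq_addr _ _).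
Qed.

(** * The p-stabilization and the main congruence *)

Variable k : nat.
Hypotheses (k2 : (2 <= k)%N) (kp : (k < p.-1)%N).

(* Coefficients of the p-stabilization of the Eisenstein series of weight
   k + m (p - 1): the Euler factor at p is removed. *)
Definition stab_coef (i m : nat) : rat :=
  if i == 0%N then
    - 2%:R^-1 * ((1 - p%:R ^+ (k + m * p.-1).-1) * bern_quot (k + m * p.-1))
  else \sum_(d <- divisors i | ~~ (p %| d)%N) d%:R ^+ (k + m * p.-1).-1.

Lemma pint_half : pintegral p 2%:R^-1.
Proof. by apply: pintV; rewrite gtnNdvd //; lia. Qed.

Lemma stab_coef_affine i : paffine (stab_coef i).
Proof.
rewrite /stab_coef; case: eqP => _.
  by apply: paffineMl (kummer_affine k2 kp); apply/pintN/pint_half.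
by apply: paffine_sum => d pd; apply: paffine_pow => //; apply: leq_trans k2.
Qed.

Lemma stab_coef_pint i m : pintegral p (stab_coef i m).
Proof.
have [h0 [B pB hB]] := stab_coef_affine i.
rewrite -[stab_coef i m](subrK (stab_coef i 0%N)) -[_ - stab_coef i 0%N](subrK (p%:R * m%:R * B)).
apply: pintD h0; apply: pintD; first exact: dvp_pint (hB m).
by apply: pintM pB; apply: pintM; apply: pint_nat.
Qed.

Lemma one_sub_pX_unit n : (0 < n)%N -> ~ dvp p 1 (1 - p%:R ^+ n).
Proof.
move=> n0 h; have /dvp_natE : dvp p 1 1%:R.
  rewrite -[1%:R](subrK (p%:R ^+ n)); apply: dvpD h _.
  exact: dvp_leq n0 (dvp_p n).
by rewrite expn1 dvdn1 => /eqP p1; move: p5; rewrite p1.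
Qed.

Lemma bdivk_pint m : pintegral p (bern_quot (k + m * p.-1)).
Proof.
set w := (k + m * p.-1)%N.
have w0 : (0 < w.-1)%N by rewrite /w; move: k2; case: (k) => [|[|k']].
have nu := one_sub_pX_unit w0.
have pu : pintegral p (1 - p%:R ^+ w.-1) by apply: pintB pint1 _; apply/pintX/pint_nat.
have u0 : 1 - p%:R ^+ w.-1 != 0 :> rat by apply: contra_notN nu => /eqP->; apply: dvp0.
rewrite -[bern_quot w](mulKf u0); apply: pintM (pint_unit pu nu) _.
have := stab_coef_pint 0 m; rewrite /stab_coef /= -/w => /(pintM (pint_nat 2))/pintN.
by rewrite mulrA mulrN mulfV // mulN1r opprK.
Qed.

(** The stabilization discards the divisors d multiple of p and the part p^(w-1) of the constant
    term. All of this is divisible by p^(w-1), where w - 1 >= 2; weight 2 is thus excluded. *)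
Lemma eisG_stab_coef i m : (3 <= k + m * p.-1)%N ->
  dvp p 2 (eisG (k + m * p.-1) i - stab_coef i m).
Proof.
have bp := bdivk_pint m; move: bp.
set w := (k + m * p.-1)%N => bp w3.
have w0 : w%:R != 0 :> rat by rewrite pnatr_eq0; lia.
have pX n : (2 <= n)%N -> dvp p 2 (p%:R ^+ n).
  by move=> n2; apply: dvp_leq n2 (dvp_p n).
rewrite /eisG /stab_coef -/w; case: eqP => [_|/eqP i0].
  rewrite (_ : _ - _ = p%:R ^+ w.-1 * (- 2%:R^-1 * bern_quot w)); last first.
    by rewrite /bern_quot natrM; field.
  apply: dvpMr; first by apply: pX; lia.
  by apply: pintM bp; apply/pintN/pint_half.
rewrite /sigma natr_sum (bigID (fun d => ~~ (p %| d)%N)) /=.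
under eq_bigr do rewrite natrX.
rewrite addrAC subrr add0r; apply: dvp_sum => d /negPn pd.
by apply: dvp_nat; apply: (dvdn_trans (dvdn_exp2l p (_ : 2 <= w.-1)%N)); [lia|apply: dvdn_exp2r].
Qed.

Definition eis_stab (i : nat) : rat := stab_coef i 0.

Let E := eisE p.-1.
Let c := ecst p.-1.

(** The quantity is -1 / (p B_(p-1)), so this restates [bernoulli_pm1]. The factor 2 (p - 1) is kept
    because it reappears under q E' in [weight2_formE]. *)
Lemma ecst_pm1 : dvp p 1 ((p%:R * c)^-1 / (2 * p.-1)%:R - 1) /\ c != 0.
Proof.
have h := bernoulli_pm1; set b := p%:R * bernoulli p.-1 in h.
have pb : pintegral p b := pint_pB p.-1.
have nb : ~ dvp p 1 b.
  move=> /dvpN/(dvpD h); rewrite addrAC subrr add0r => /(@dvp_natE 1 1).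
  by rewrite expn1 dvdn1 => /eqP p1; move: p5; rewrite p1.
have b0 : b != 0 by apply: contra_notN nb => /eqP->; apply: dvp0.
have w0 : (2 * p.-1)%:R != 0 :> rat by rewrite pnatr_eq0; lia.
have B0 : bernoulli p.-1 != 0 by apply: contraNneq b0 => B0; rewrite /b B0 mulr0.
split; last by rewrite /c /ecst mulf_neq0 ?oppr_eq0 ?invr_eq0.
rewrite (_ : _ - _ = - b^-1 * (b + 1)).
  by apply: dvpMl h; apply/pintN/pint_unit.
have w1 : p.-1%:R != 0 :> rat by rewrite pnatr_eq0; lia.
rewrite /c /ecst /b natrM; field. by rewrite w1 B0 p0.
Qed.

Definition eps (i : nat) : rat := (E i - (i == 0%N)%:R) / p%:R.

Lemma eisE_eps i : E i = (i == 0%N)%:R + p%:R * eps i.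
Proof. by rewrite /eps mulrC divfK // addrC subrK. Qed.

Lemma eps0 : eps 0 = 0.
Proof.
have [_ c0] := ecst_pm1.
by rewrite /eps /E /eisE -/(ecst _) -/c eisGE /= mulr1 addr0 mulVf // subrr mul0r.
Qed.

Lemma epsE i : (0 < i)%N -> eps i = (p%:R * c)^-1 * (sigma p.-2 i)%:R.
Proof.
case: i => // i _.
have -> : eps i.+1 = c^-1 * (sigma p.-2 i.+1)%:R / p%:R by rewrite /eps subr0.
by rewrite [(p%:R * c)^-1]invfM [LHS]mulrC mulrA.
Qed.

Lemma eps_pint i : pintegral p (eps i).
Proof.
have [->|i0] := posnP i; first by rewrite eps0; apply: pint0.
rewrite epsE //; apply: pintM (pint_nat _).
have [h _] := ecst_pm1.
have w0 : (2 * p.-1)%:R != 0 :> rat by rewrite pnatr_eq0; lia.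
rewrite -[_^-1](divfK w0); apply: pintM (pint_nat _).
by rewrite -[_ / _](subrK 1); apply: pintD pint1; apply: dvp_pint h.
Qed.

Lemma pint_qmul a b : qpintegral p a -> qpintegral p b -> qpintegral p (qmul a b).
Proof. by move=> pa pb i; apply: pint_sum => j _; apply: pintM. Qed.

Lemma qmul_delta (x y : qseries) i :
  qmul (fun j => (j == 0%N)%:R + p%:R * x j) y i = y i + p%:R * qmul x y i.
Proof.
rewrite /qmul mulr_sumr big_ord_recl [\sum_(j < i.+1) p%:R * _]big_ord_recl /=.
rewrite mulrDl mul1r mulrA subn0 addrA; congr (_ + _).
by apply: eq_bigr => j _; rewrite add0r mulrA.
Qed.

Lemma qexp_eps n i : dvp p 2 (qexp E n i - ((i == 0%N)%:R + p%:R * (n%:R * eps i))).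
Proof.
have d0 j : pintegral p ((j == 0%N)%:R) by apply: pint_nat.
elim: n i => [|n IH] i.
  by rewrite mul0r mulr0 addr0 subrr; apply: dvp0.
have -> : qexp E n.+1 i = qexp E n i + p%:R * qmul eps (qexp E n) i.
  by rewrite -qmul_delta; apply: eq_bigr => j _; rewrite eisE_eps.
have h j : dvp p 1 (qexp E n j - (j == 0%N)%:R).
  rewrite (_ : _ - _ = qexp E n j - ((j == 0%N)%:R + p%:R * (n%:R * eps j)) + p%:R * (n%:R * eps j)); last by ring.
  apply: dvpD; first exact: dvp_leq (IH j).
  by apply: dvpMr (dvp_p 1) _; apply: pintM (pint_nat _) (eps_pint _).
have e : eps i = qmul eps (fun j => (j == 0%N)%:R) i.
  rewrite /qmul big_ord_recr /= subnn mulr1 big1 ?add0r // => j _.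
  by rewrite subn_eq0 leqNgt ltn_ord mulr0.
rewrite (_ : _ - _ = (qexp E n i - ((i == 0%N)%:R + p%:R * (n%:R * eps i))) +
   p%:R * (qmul eps (qexp E n) i - eps i)); last by rewrite -natr1; ring.
apply: dvpD (IH i) _; apply: (@dvpM 1 1); first exact: (dvp_p 1).
rewrite e /qmul -sumrB; apply: dvp_sum => j _; rewrite -mulrBr.
exact: dvpMl (eps_pint _) (h _).
Qed.

Lemma qmul_qexp n (F : qseries) i : qpintegral p F ->
  dvp p 2 (qmul (qexp E n) F i - (F i + n%:R * p%:R * qmul eps F i)).
Proof.
move=> pF; rewrite [n%:R * _]mulrC -mulrA.
have -> : n%:R * qmul eps F i = qmul (fun j => n%:R * eps j) F i.
  by rewrite /qmul mulr_sumr; apply: eq_bigr => j _; rewrite mulrA.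
rewrite -qmul_delta /qmul -sumrB; apply: dvp_sum => j _; rewrite -mulrBl.
exact: dvpMr (qexp_eps _ _) (pF _).
Qed.

(* With G_m = G_(k + m(p-1)), one has G_m = g_0 + p m B and E = 1 + p e modulo p^2 for m > 0,
   so that f = (n+1) G_1 - n E g_0 = g_0 + (n+1) p B - n p e g_0 and
   E^n f = f + n p e g_0 = G_(n+1). *)
Lemma eisG_congr (H : qseries) n :
  (forall i, dvp p 2 (H i - qmul E eis_stab i)) ->
  let f := fun i => n.+1%:R * eisG (k + p.-1) i - n%:R * H i in
  qpintegral p f /\
  forall i, dvp p 2 (eisG (k + n.+1 * p.-1) i - qmul (qexp E n) f i).
Proof.
move=> hH f; pose G m := eisG (k + m * p.-1).
have pg : qpintegral p eis_stab by move=> i; apply: stab_coef_pint.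
have Gh m i : (0 < m)%N -> dvp p 2 (G m i - stab_coef i m).
  by move=> m0; apply: eisG_stab_coef; nia.
have G1E : G 1%N = eisG (k + p.-1) by rewrite /G mul1n.
have G1 i : dvp p 1 (G 1%N i - eis_stab i).
  have [_ [B pB hB]] := stab_coef_affine i.
  rewrite (_ : _ - _ = (G 1%N i - stab_coef i 1) + (stab_coef i 1 - eis_stab i - p%:R * 1%:R * B) + p%:R * B); last by ring.
  apply: dvpD; last by apply: dvpMr (dvp_p 1) pB.
  by apply: dvpD; [apply: dvp_leq (Gh 1%N i _)|apply: dvp_leq (hB 1%N)].
have Hg i : dvp p 2 (H i - (eis_stab i + p%:R * qmul eps eis_stab i)).
  have <- : qmul E eis_stab i = eis_stab i + p%:R * qmul eps eis_stab i; last exact: hH.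
  by rewrite -qmul_delta; apply: eq_bigr => j _; rewrite eisE_eps.
have pe x : qpintegral p x -> qpintegral p (qmul eps x).
  exact/pint_qmul/eps_pint.
(* Agreement modulo p is enough, since f is only replaced by g inside n p e f. *)
have fg i : dvp p 1 (f i - eis_stab i).
  rewrite (_ : _ - _ = n.+1%:R * (G 1%N i - eis_stab i) - n%:R * (H i - (eis_stab i + p%:R * qmul eps eis_stab i))
    - n%:R * (p%:R * qmul eps eis_stab i)); last by rewrite /f -G1E -natr1; ring.
  apply: dvpB; last by apply: dvpMl (pint_nat _) _; apply: dvpMr (dvp_p 1) (pe _ pg _).
  apply: dvpB; first exact: dvpMl (pint_nat _) (G1 i).
  by apply: dvpMl (pint_nat _) _; apply: dvp_leq (Hg i).
have pf : qpintegral p f.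
  by move=> i; rewrite -[f i](subrK (eis_stab i)); apply: pintD (pg i); apply: dvp_pint (fg i).
split=> // i; have [_ [B pB hB]] := stab_coef_affine i.
rewrite -/(G n.+1).
rewrite (_ : _ - _ = (G n.+1 i - stab_coef i n.+1) + (stab_coef i n.+1 - eis_stab i - p%:R * n.+1%:R * B)
  - n.+1%:R * ((G 1%N i - stab_coef i 1%N) + (stab_coef i 1%N - eis_stab i - p%:R * 1%:R * B))
  + n%:R * (H i - (eis_stab i + p%:R * qmul eps eis_stab i))
  - (qmul (qexp E n) f i - (f i + n%:R * p%:R * qmul eps f i))
  - n%:R * (p%:R * (qmul eps f i - qmul eps eis_stab i))); last first.
  by rewrite /f -G1E -natr1; ring.
apply: dvpB.
  apply: dvpB; last exact: qmul_qexp.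
  apply: dvpD; last exact: dvpMl (pint_nat _) (Hg i).
  apply: dvpB; first exact: dvpD (Gh _ _ _) (hB _).
  by apply: dvpMl (pint_nat _) _; apply: dvpD (Gh _ _ _) (hB 1%N).
apply: dvpMl (pint_nat _) _; apply: (@dvpM 1 1); first exact: (dvp_p 1).
rewrite /qmul -sumrB; apply: dvp_sum => j _; rewrite -mulrBr.
exact: dvpMl (eps_pint _) (fg _).
Qed.

Lemma eisE_pint : qpintegral p E.
Proof.
move=> i; rewrite eisE_eps; apply: pintD; first exact: pint_nat.
exact: pintM (pint_nat _) (eps_pint _).
Qed.

Lemma eis_stab_high i : (3 <= k)%N -> dvp p 2 (qmul E (eisG k) i - qmul E eis_stab i).
Proof.
move=> k3; rewrite /qmul -sumrB; apply: dvp_sum => j _; rewrite -mulrBr.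
apply: dvpMl (eisE_pint _) _.
by have := @eisG_stab_coef (i - j) 0; rewrite mul0n addn0; apply.
Qed.

Lemma qmulC a b i : qmul a b i = qmul b a i.
Proof.
rewrite /qmul (reindex_inj rev_ord_inj) /=; apply: eq_bigr => j _.
by rewrite subSS subKn 1?mulrC // -ltnS.
Qed.

(** * The form H in the case k0 = 2 *)

(** Write i = p e q with d = p e; the involution exchanging e and q sends d to p q = p (i / d). *)
Lemma sum_divisors_pmul i : (0 < i)%N ->
  \sum_(d <- divisors i | (p %| d)%N) d%:R =
  \sum_(d <- divisors i | (p %| d)%N) (p * (i %/ d))%:R :> rat.
Proof.
move=> i0; rewrite -!(big_filter (divisors i)).
set s := [seq _ <- _ | _].
have ms d : (d \in s) = (p %| d)%N && (d %| i)%N.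
  by rewrite mem_filter -dvdn_divisors.
have pp := prime_gt0 p_pr.
have key d : d \in s -> exists e q, [/\ d = (p * e)%N, i = (p * e * q)%N, (0 < e)%N & (0 < q)%N].
  rewrite ms => /andP[/dvdnP[e ->] /dvdnP[q iE]]; exists e, q.
  split; rewrite ?(mulnC p) 1?[LHS]iE 1?mulnC //.
    by move: i0; rewrite iE !muln_gt0 => /and3P[].
  by move: i0; rewrite iE !muln_gt0 => /and3P[].
have inv d : d \in s -> (p * (i %/ d))%N \in s /\ (p * (i %/ (p * (i %/ d))) = d)%N.
  move=> /key[e [q [-> iE e0 q0]]].
  have -> : (i %/ (p * e) = q)%N by rewrite iE mulKn // muln_gt0 pp.
  have -> : (i %/ (p * q) = e)%N by rewrite iE mulnAC mulKn // muln_gt0 pp.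
  by rewrite ms dvdn_mulr // iE mulnAC dvdn_mulr.
rewrite -(big_map (fun d => p * (i %/ d))%N xpredT (fun d => d%:R)).
have us : uniq s by rewrite filter_uniq ?divisors_uniq.
apply/perm_big/uniq_perm => //.
  rewrite map_inj_in_uniq // => a b /inv[_ ea] /inv[_ eb] ab.
  by rewrite -ea -eb ab.
move=> d; apply/idP/mapP => [ds|[e es ->]]; last by have [] := inv e es.
by have [h1 h2] := inv d ds; exists (p * (i %/ d))%N.
Qed.

(* By Rankin's identity the products with j = 1 and j = w - 1, left out here,
   are the ones containing G_2: see weight2_formE. *)
Definition weight2_form : qseries := fun i =>
  let w := p.-1 in
  (w.+3%:R / w.+1%:R * eisG w.+2 i -
   2%:R * \sum_(j < w.+1 | [&& odd j, j != 1 :> nat & j != w.-1 :> nat]%N)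
     'C(w, j)%:R * qmul (eisG (w - j).+1) (eisG j.+1) i) / (4%:R * w%:R * c)
  - p%:R * eisG w.+2 i.

(** In Rankin's identity for w = p - 1 the terms j = 1 and j = w - 1 are both w G_w G_2, in total 4
    w c E G_2. Dividing by 4 w c leaves E G_2, and turns 2 i G_w into i E / (2 w). *)
Lemma weight2_formE i : weight2_form i =
  qmul E (eisG 2) i + i%:R * E i / (2%:R * p.-1%:R) - p%:R * eisG p.+1 i.
Proof.
have [_ c0] := ecst_pm1.
have op : odd p by case: (even_prime p_pr) => [p2|//]; move: p5; rewrite p2.
have ew : ~~ odd p.-1 by case: (p) p5 op.
have w0 : p.-1%:R != 0 :> rat by rewrite pnatr_eq0; lia.
have h := @eisG_rankin p.-1 i ew _.
rewrite /weight2_form {}h; last by lia.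
rewrite (_ : p.-1.+2 = p.+1); last by lia.
congr (_ - _).
have l1 : (1 < p.-1.+1)%N by lia.
have l2 : (p.-1.-1 < p.-1.+1)%N by lia.
rewrite (bigD1 (Ordinal l1)) //= (bigD1 (Ordinal l2)) /=; last first.
  by rewrite -val_eqE /=; lia.
set S := \sum_(j < _ | _) _; set S' := \sum_(j < _ | _) _.
have -> : S = S'.
  by apply: eq_bigl => j; rewrite -!val_eqE /= andbA.
rewrite (_ : (p.-1 - 1).+1 = p.-1); last by lia.
rewrite (_ : (p.-1 - p.-1.-1).+1 = 2); last by lia.
rewrite (_ : p.-1.-1.+1 = p.-1); last by lia.
rewrite bin1 (_ : 'C(p.-1, p.-1.-1) = p.-1); last by case: (p.-1) w0 => [|n _]; rewrite ?eqxx // binSn.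
have e1 : qmul E (eisG 2) i = c^-1 * qmul (eisG p.-1) (eisG 2) i.
  by rewrite /qmul mulr_sumr; apply: eq_bigr => j _; rewrite mulrA.
have e2 : E i = c^-1 * eisG p.-1 i by [].
rewrite (qmulC (eisG 2)) e1 e2.
by field; rewrite c0 w0.
Qed.

(** The difference v = G_2 - g is divisible by p, so E v = v modulo p^2, and v must cancel against
    the other two terms. For i > 0, after division by p, this is a congruence modulo p between sums
    over i = d e. The three terms contribute e for p | d, then e d^(p-1), that is e for d prime to
    p, and finally -e^p, that is -e for every d. *)
Lemma weight2_form_congr i : k = 2%N -> dvp p 2 (weight2_form i - qmul E eis_stab i).
Proof.
move=> k2E; rewrite weight2_formE.
pose v : qseries := fun j => eisG 2 j - eis_stab j.
have h2 : bern_quot (k + 0 * p.-1) = bern_quot 2 by rewrite k2E mul0n.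
have kk : (k + 0 * p.-1).-1 = 1%N by rewrite k2E mul0n.
have v0 : v 0%N = - 2%:R^-1 * (p%:R * bern_quot 2).
  rewrite /v /eis_stab /stab_coef [0%N == _]eqxx h2 kk. rewrite expr1 /eisG /= /bern_quot (_ : 2 * 2 = 4)%N //.
  by field.
have vS j : (0 < j)%N -> v j = \sum_(d <- divisors j | (p %| d)%N) d%:R.
  case: j => // j _; transitivity (\sum_(d <- divisors j.+1) d%:R - \sum_(d <- divisors j.+1 | ~~ (p %| d)%N) d%:R : rat).
    congr (_ - _); first by rewrite /eisG /sigma natr_sum; apply: eq_bigr => d _; rewrite expn1.
    by rewrite /eis_stab /stab_coef kk; apply: eq_bigr => d _; rewrite expr1.
  by rewrite (bigID (fun d => p %| d)%N) /= addrK.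
have v1 j : dvp p 1 (v j).
  have [->|j0] := posnP j.
    rewrite v0 mulrCA; apply: dvpMr (dvp_p 1) _; apply: pintM; first exact/pintN/pint_half.
    by rewrite -h2; apply: bdivk_pint.
  by rewrite vS //; apply: dvp_sum => d; rewrite -{1}(expn1 p) => /dvp_nat.
have Ev : dvp p 2 (qmul E v i - v i).
  rewrite (_ : qmul E v i = v i + p%:R * qmul eps v i); last first.
    by rewrite -qmul_delta; apply: eq_bigr => j _; rewrite eisE_eps.
  rewrite addrAC subrr add0r; apply: (@dvpM 1 1); first exact: (dvp_p 1).
  by apply: dvp_sum => j _; apply: dvpMl (eps_pint _) (v1 _).
have qB : qmul E (eisG 2) i - qmul E eis_stab i = qmul E v i.
  by rewrite /qmul -sumrB; apply: eq_bigr => j _; rewrite -mulrBr.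
suff: dvp p 2 (v i + i%:R * E i / (2%:R * p.-1%:R) - p%:R * eisG p.+1 i).
  move=> h; rewrite (_ : _ - _ = (qmul E v i - v i) +
    (v i + i%:R * E i / (2%:R * p.-1%:R) - p%:R * eisG p.+1 i)); last first.
    by rewrite -qB; ring.
  exact: dvpD Ev h.
have [->|i0] := posnP i.
  rewrite mul0r mul0r addr0 v0.
  (* In degree 0 the cancellation is Kummer's congruence modulo p between the weights 2 and p +
     1. *)
  have e : dvp p 1 (eisG p.+1 0 - eis_stab 0).
    have [_ [B pB hB]] := stab_coef_affine 0.
    have -> : eisG p.+1 0%N = eisG (k + 1 * p.-1) 0%N by rewrite k2E; congr eisG; lia.
    rewrite (_ : _ - _ = (eisG (k + 1 * p.-1) 0%N - stab_coef 0 1) + (stab_coef 0 1 - eis_stab 0 - p%:R * 1%:R * B) + p%:R * B); last by ring.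
    apply: dvpD; last by apply: dvpMr (dvp_p 1) pB.
    apply: dvpD; last exact: dvp_leq (hB 1%N).
    by apply: (@dvp_leq 2) => //; apply: eisG_stab_coef; lia.
  have g00 : eis_stab 0 = - 2%:R^-1 * ((1 - p%:R) * bern_quot 2).
    by rewrite /eis_stab /stab_coef [0%N == _]eqxx h2 kk expr1.
  rewrite (_ : _ - _ = - (p%:R * (eisG p.+1 0%N - eis_stab 0)) - p%:R ^+ 2 * (2%:R^-1 * bern_quot 2)); last first.
    by rewrite g00; ring.
  apply: dvpB; first by apply/dvpN/(@dvpM 1 1); [exact: (dvp_p 1)|].
  apply: dvpMr (dvp_p 2) _; apply: pintM pint_half _; rewrite -h2; exact: bdivk_pint.
have E0 : E i = p%:R * eps i by rewrite eisE_eps gtn_eqF // add0r.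
have w0 : p.-1%:R != 0 :> rat by rewrite pnatr_eq0; lia.
have Gi : eisG p.+1 i = (sigma p i)%:R by case: i i0 {Ev qB E0}.
pose t := (p%:R * c)^-1 / (2 * p.-1)%:R.
have [t1 _] := ecst_pm1; rewrite -/t in t1.
rewrite (_ : v i + _ - _ = p%:R * ((t - 1) * (i * sigma p.-2 i)%:R) +
   (v i + p%:R * ((i * sigma p.-2 i)%:R - (sigma p i)%:R))); last first.
  rewrite E0 Gi epsE // /t !natrM; field.
  by have [_ c0] := ecst_pm1; rewrite p0 c0 w0.
apply: dvpD; first by apply: (@dvpM 1 1); [exact: (dvp_p 1)|apply: dvpMr t1 (pint_nat _)].
rewrite vS // sum_divisors_pmul //.
rewrite (_ : _ + _ = p%:R * (\sum_(d <- divisors i | (p %| d)%N) (i %/ d)%:R +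
  ((i * sigma p.-2 i)%:R - (sigma p i)%:R))); last first.
  by rewrite [RHS]mulrDr mulr_sumr; congr (_ + _); apply: eq_bigr => d _; rewrite natrM.
apply: (@dvpM 1 1); first exact: (dvp_p 1).
rewrite natrM /sigma !natr_sum mulr_sumr -(sum_divisors_inv (fun d => (d ^ p)%:R)) //.
rewrite -sumrB big_mkcond -big_split /= big_seq; apply: dvp_sum => d.
rewrite -dvdn_divisors // => /dvdnP[e iE].
have d0 : (0 < d)%N by move: i0; rewrite iE muln_gt0 => /andP[].
have -> : (i %/ d = e)%N by rewrite iE mulnK.
have fe x : dvp p 1 ((x ^ p)%:R - x%:R).
  by apply: (@dvp_modn 1); rewrite expn1 fermat_little.
have dE : (i * d ^ p.-2)%:R = e%:R * d%:R ^+ p.-1 :> rat.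
  by rewrite iE -mulnA -expnS (_ : p.-2.+1 = p.-1) ?natrM ?natrX //; lia.
rewrite -natrM dE; set X := if _ then _ else _.
rewrite (_ : _ + _ = (X + e%:R * d%:R ^+ p.-1 - e%:R) - ((e ^ p)%:R - e%:R)); last first.
  by ring.
rewrite /X {X}.
apply: dvpB (fe e); case: ifPn => pd.
  rewrite addrAC subrr add0r; apply: dvpMl (pint_nat _) _; rewrite -natrX.
  by apply: dvp_nat; rewrite expn1 Euclid_dvdX // pd; lia.
rewrite add0r -[X in _ - X]mulr1 -mulrBr; apply: dvpMl (pint_nat _) _.
exact: dvp_fermat.
Qed.

End PIntegral.

From mathcomp Require Import all_classical all_reals all_analysis complex.
Import Order.TTheory GRing.Theory Num.Theory.
Import numFieldNormedType.Exports.
Local Open Scope complex_scope.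

(** * Elementary bounds for sine, cosine and the exponential *)

Section RealBounds.
Variable R : realType.
Implicit Types x y : R.

Lemma MVT0 (f df : R -> R) x : (forall t : R, is_derive t 1 f (df t)) ->
  exists2 c, (0 <= c <= x) || (x <= c <= 0) & f x - f 0 = df c * x.
Proof.
move=> fd.
have fc (a b : R) : {within `[a, b]%classic, continuous f}%classic.
  by apply: derivable_within_continuous => t _; have [] := fd t.
have [x0|x0|->] := ltgtP x 0.
- have [c /[!in_itv]/= /andP[h1 h2] e] := MVT x0 (fun t _ => fd t) (fc x 0).
  by exists c; rewrite ?(ltW h1) ?(ltW h2) ?orbT //; move: e; rewrite sub0r; lra.
- have [c /[!in_itv]/= /andP[h1 h2] e] := MVT x0 (fun t _ => fd t) (fc 0 x).
  by exists c; rewrite ?(ltW h1) ?(ltW h2) //; move: e; rewrite subr0.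
- by exists 0; rewrite ?lexx // subrr mulr0.
Qed.

Lemma MVT0_norm (f df : R -> R) x : (forall t : R, is_derive t 1 f (df t)) ->
  exists2 c, `|c| <= `|x| & f x - f 0 = df c * x.
Proof.
move=> fd; have [c h e] := MVT0 x fd; exists c => //.
by case/orP: h => /andP[h1 h2]; [rewrite !ger0_norm|rewrite !ler0_norm]; lra.
Qed.

Lemma norm_sin_le y : `|sin y| <= `|y|.
Proof.
have [c _] := MVT0_norm y (@is_derive_sin R); rewrite sin0 subr0 => ->.
by rewrite normrM ler_piMl // cos_max.
Qed.

Lemma cos_sub1 y : cos y - 1 = - 2 * sin (y / 2) ^+ 2.
Proof.
have {1}-> : y = (y / 2) *+ 2 by rewrite mulr2n; lra.
by rewrite cos_mulr2n cos2sin2 mulr2n; ring.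
Qed.

Lemma norm_cos_sub1 y : `|cos y - 1| <= `|y| ^+ 2.
Proof.
rewrite cos_sub1 normrM normrN normrX (ger0_norm (ler0n _ 2)).
have := norm_sin_le (y / 2); rewrite normrM (ger0_norm (_ : 0 <= 2^-1)) //.
have := normr_ge0 (sin (y / 2)); have := normr_ge0 y; nra.
Qed.

Lemma norm_cos_sub1' y : `|cos y - 1| <= `|y|.
Proof.
rewrite cos_sub1 normrM normrN normrX (ger0_norm (ler0n _ 2)).
have := norm_sin_le (y / 2); rewrite normrM (ger0_norm (_ : 0 <= 2^-1)) //.
have := sin_max (y / 2).
have := normr_ge0 (sin (y / 2)); have := normr_ge0 y; nra.
Qed.

Lemma norm_sin_sub y : `|sin y - y| <= `|y| ^+ 2.
Proof.
have d (t : R) : is_derive t 1 ((sin : R -> R) - id) (cos t - 1) by apply: is_deriveB.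
have [c cy] := MVT0_norm y d; rewrite !fctE /= sin0 !subr0 => ->.
rewrite normrM expr2 ler_wpM2r //; exact: le_trans (norm_cos_sub1' c) cy.
Qed.

Definition exp_taylor J : {poly R} := \poly_(j < J) (j`!%:R)^-1.

(** The derivative of the remainder is the previous remainder, so each use of the mean value theorem
    gains a factor |x|. The sign of x keeps the exponential at most 1. *)
Lemma exp_taylor_bound J x : x <= 0 -> `|expR x - (exp_taylor J).[x]| <= `|x| ^+ J.
Proof.
elim: J x => [|J IH] x x0.
  rewrite /exp_taylor poly_def big_ord0 horner0 subr0 expr0.
  by rewrite ger0_norm ?expR_ge0 // expR_le1.
have dP : (exp_taylor J.+1)^`() = exp_taylor J.
  apply/polyP => i; rewrite coef_deriv !coef_poly ltnS; case: ifP => _; last by rewrite mul0rn.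
  have i0 : i.+1%:R != 0 :> R by rewrite pnatr_eq0.
  by rewrite factS natrM invfM -mulrnAl -[_ *+ i.+1]mulr_natr mulVf // mul1r.
have d (t : R) : is_derive t 1 ((expR : R -> R) - horner (exp_taylor J.+1)) (expR t - (exp_taylor J).[t]).
  by rewrite -dP; apply: is_deriveB.
have [c h] := MVT0 x d; rewrite !fctE /= expR0 horner_coef0 coef_poly /= fact0 invr1 subrr subr0 => ->.
have [c0 xc] : c <= 0 /\ `|c| <= `|x|.
  by case/orP: h => /andP[h1 h2]; [have [-> ->] : c = 0 /\ x = 0 by lra|rewrite !ler0_norm]; lra.
rewrite normrM exprSr ler_wpM2r //; apply: le_trans (IH c c0) _.
by rewrite lerXn2r // nnegrE.
Qed.

Lemma expR_sub1 x : x <= 0 -> `|expR x - 1| <= `|x|.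
Proof.
move=> /(exp_taylor_bound 1); rewrite expr1 /exp_taylor poly_def big_ord1.
by rewrite fact0 invr1 scale1r expr0 hornerC.
Qed.

Lemma expR_sub2 x : x <= 0 -> `|expR x - 1 - x| <= `|x| ^+ 2.
Proof.
move=> /(exp_taylor_bound 2); rewrite /exp_taylor poly_def !big_ord_recl big_ord0 /=.
by rewrite fact0 (_ : (bump 0 0)`! = 1)%N // invr1 !scale1r expr0 expr1 addr0 !hornerE opprD addrA.
Qed.
End RealBounds.

(** * The distribution relation of u / (1 - u)^2 *)

Section RootsOfUnity.
Variables (F : fieldType) (N : nat) (zeta : F).
Hypothesis zP : N.-primitive_root zeta.

Lemma sum_prim_root m : \sum_(j < N) (zeta ^+ m) ^+ j = if (N %| m)%N then N%:R else 0.
Proof.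
rewrite (prim_order_dvd zP); case: eqP => [->|/eqP z1].
  under eq_bigr do rewrite expr1n.
  by rewrite sumr_const card_ord.
apply: (mulfI (_ : zeta ^+ m - 1 != 0)); first by rewrite subr_eq0.
by rewrite -subrX1 mulr0 -exprM mulnC exprM (prim_expr_order zP) expr1n subrr.
Qed.

(** As 1 - t^N = (1 - u) (1 + u + ... + u^(N-1)) for u = t zeta^j, each term is the sum of u^(r+s+1)
    over r, s < N divided by (1 - t^N)^2. Summation over j keeps the exponents divisible by N; since
    r + s + 1 < 2 N, only s = N - 1 - r remains. *)
Lemma sum_inv_sq_prim_root (t : F) : t ^+ N != 1 ->
  \sum_(j < N) (t * zeta ^+ j) / (1 - t * zeta ^+ j) ^+ 2 =
  N%:R ^+ 2 * (t ^+ N / (1 - t ^+ N) ^+ 2).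
Proof.
move=> tN; have N0 := prim_order_gt0 zP.
have Q0 : 1 - t ^+ N != 0 by rewrite subr_eq0 eq_sym.
transitivity (\sum_(j < N) (\sum_(r < N) \sum_(s < N) (t * zeta ^+ j) ^+ (r + s).+1) / (1 - t ^+ N) ^+ 2).
  apply: eq_bigr => j _; set u := t * _.
  have uN : u ^+ N = t ^+ N by rewrite exprMn -exprM mulnC exprM (prim_expr_order zP) expr1n mulr1.
  have e : (1 - u) * \sum_(r < N) u ^+ r = 1 - t ^+ N.
    by rewrite -uN -[LHS]opprK -mulNr opprB -subrX1 opprB.
  have u0 : 1 - u != 0 by apply: contraNneq Q0 => u0; rewrite -e u0 mul0r.
  have -> : \sum_(r < N) \sum_(s < N) u ^+ (r + s).+1 = u * (\sum_(r < N) u ^+ r) ^+ 2.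
    rewrite expr2 big_distrlr /= mulr_sumr; apply: eq_bigr => r _.
    by rewrite mulr_sumr; apply: eq_bigr => s _; rewrite exprS exprD.
  set S := \sum_(r < N) u ^+ r in e *.
  have S0 : S != 0 by apply: contraNneq Q0 => S0; rewrite -e S0 mulr0.
  by rewrite -e; field; rewrite u0 S0.
rewrite -mulr_suml mulrA; congr (_ / _).
rewrite exchange_big /=.
transitivity (\sum_(r < N) N%:R * t ^+ N); last first.
  by rewrite sumr_const card_ord -[LHS]mulr_natl expr2 mulrA.
apply: eq_bigr => r _; rewrite exchange_big /=.
have rN : (N - r.+1 < N)%N by have := ltn_ord r; lia.
rewrite (bigD1 (Ordinal rN)) //= [X in _ + X]big1 ?addr0.
  rewrite -addnS subnSK // subnKC 1?ltnW //.
  under eq_bigr => j _ do rewrite exprMn -exprM mulnC exprM (prim_expr_order zP) expr1n mulr1.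
  by rewrite sumr_const card_ord mulr_natl.
move=> s sr; under eq_bigr => j _ do rewrite exprMn -exprM mulnC exprM.
rewrite -mulr_sumr sum_prim_root ifF ?mulr0 //.
apply: contraNF sr => /dvdnP[q e]; rewrite -val_eqE /=.
have h1 := ltn_ord s; have h2 := ltn_ord r.
by case: q e => [|[|q]]; rewrite ?mulSn; lia.
Qed.
End RootsOfUnity.

Section ComplexAnalysis.
Variable R : realType.
Local Notation C := R[i].
Local Notation nc := (@Normc.normc R).

(** * The modulus and limits of complex sequences *)

Section Norm.
Implicit Types x y z : C.

Lemma norm_nc (z : C) : `|z| = (nc z)%:C.
Proof. by case: z. Qed.

Lemma nc_ge0 z : 0 <= nc z. Proof. by case: z => a b; apply: sqrtr_ge0. Qed.
Lemma nc0 : nc 0 = 0. Proof. exact: Normc.normc0. Qed.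
Lemma nc1 : nc 1 = 1. Proof. exact: Normc.normc1. Qed.
Lemma ncM x y : nc (x * y) = nc x * nc y. Proof. exact: Normc.normcM. Qed.
Lemma ncV x : nc x^-1 = (nc x)^-1. Proof. exact: Normc.normcV. Qed.
Lemma ncN x : nc (- x) = nc x. Proof. exact: normcN. Qed.
Lemma ncD x y : nc (x + y) <= nc x + nc y. Proof. exact: le_normcD. Qed.
Lemma ncB x y : nc (x - y) <= nc x + nc y. Proof. by rewrite -(ncN y) ncD. Qed.
Lemma ncX x n : nc (x ^+ n) = nc x ^+ n.
Proof. by elim: n => [|n IH]; rewrite ?expr0 ?nc1 // !exprS ncM IH. Qed.
Lemma nc_eq0 x : (nc x == 0) = (x == 0).
Proof. by apply/eqP/eqP => [/Normc.eq0_normc|->] //; rewrite nc0. Qed.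
Lemma nc_gt0 x : (0 < nc x) = (x != 0).
Proof. by rewrite lt_neqAle nc_ge0 eq_sym nc_eq0 andbT. Qed.
Lemma ncBC x y : nc (x - y) = nc (y - x). Proof. by rewrite -ncN opprB. Qed.
Lemma nc_sub x y : nc x - nc y <= nc (x - y).
Proof. by rewrite lerBlDr -{1}(subrK y x) ncD. Qed.

Lemma nc_sum I (s : seq I) (P : pred I) (F : I -> C) :
  nc (\sum_(i <- s | P i) F i) <= \sum_(i <- s | P i) nc (F i).
Proof.
elim/big_rec2: _ => [|i x y Pi xy]; first by rewrite nc0.
by apply: le_trans (ncD _ _) _; rewrite lerD2l.
Qed.

Lemma nc_real (x : R) : nc x%:C = `|x|.
Proof. by rewrite /= expr0n /= addr0 sqrtr_sqr. Qed.
Lemma nc_nat n : nc n%:R = n%:R.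
Proof. by rewrite -(rmorph_nat (real_complex R)) nc_real ger0_norm. Qed.
Lemma nc_i : nc 'i = 1. Proof. by rewrite /= expr0n add0r expr1n sqrtr1. Qed.

Lemma Re_nc z : `|complex.Re z| <= nc z.
Proof.
case: z => a b /=; rewrite -sqrtr_sqr ler_sqrt ?addr_ge0 ?sqr_ge0 //.
by rewrite lerDl sqr_ge0.
Qed.
Lemma Im_nc z : `|complex.Im z| <= nc z.
Proof.
case: z => a b /=; rewrite -sqrtr_sqr ler_sqrt ?addr_ge0 ?sqr_ge0 //.
by rewrite lerDr sqr_ge0.
Qed.
Lemma nc_ReIm z : nc z <= `|complex.Re z| + `|complex.Im z|.
Proof.
case: z => a b; have h : a +i* b = a%:C + 'i * b%:C := complexE (a +i* b).
by rewrite [X in nc X]h; apply: le_trans (ncD _ _) _; rewrite ncM nc_i mul1r !nc_real.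
Qed.

Lemma cReD (x y : C) : complex.Re (x + y) = complex.Re x + complex.Re y.
Proof. by case: x y => [a b] [c d]. Qed.
Lemma cImD (x y : C) : complex.Im (x + y) = complex.Im x + complex.Im y.
Proof. by case: x y => [a b] [c d]. Qed.
Lemma cReN (x : C) : complex.Re (- x) = - complex.Re x. Proof. by case: x. Qed.
Lemma cImN (x : C) : complex.Im (- x) = - complex.Im x. Proof. by case: x. Qed.
Lemma cReM (x y : C) : complex.Re (x * y) = complex.Re x * complex.Re y - complex.Im x * complex.Im y.
Proof. by case: x y => [a b] [c d]. Qed.
Lemma cImM (x y : C) : complex.Im (x * y) = complex.Re x * complex.Im y + complex.Im x * complex.Re y.
Proof. by case: x y => [a b] [c d]. Qed.
Lemma cRe_nat n : complex.Re (n%:R : C) = n%:R.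
Proof. by rewrite -(rmorph_nat (real_complex R)). Qed.
Lemma cIm_nat n : complex.Im (n%:R : C) = 0.
Proof. by rewrite -(rmorph_nat (real_complex R)). Qed.
Lemma cRe_sum I (s : seq I) (P : pred I) (F : I -> C) :
  complex.Re (\sum_(i <- s | P i) F i) = \sum_(i <- s | P i) complex.Re (F i).
Proof. by elim/big_rec2: _ => // i x y Pi <-; rewrite cReD. Qed.
Lemma cIm_sum I (s : seq I) (P : pred I) (F : I -> C) :
  complex.Im (\sum_(i <- s | P i) F i) = \sum_(i <- s | P i) complex.Im (F i).
Proof. by elim/big_rec2: _ => // i x y Pi <-; rewrite cImD. Qed.

(** The norm of [R[i]] takes its values in [R[i]]; with the real modulus [nc] all estimates are
    inequalities in [R]. *)
Definition ctends (u : nat -> C) (l : C) : Prop :=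
  forall e : R, 0 < e -> exists N, forall n, (N <= n)%N -> nc (u n - l) < e.

Lemma ctendsP (u : nat -> R[i]^o) (l : R[i]^o) : ctends u l <-> (u @ \oo --> l)%classic.
Proof.
split=> [ul|/cvgrPdist_lt ul].
  apply/cvgrPdist_lt => e; rewrite ltcE => /andP[/eqP e0 e1].
  have [N hN] := ul _ e1; exists N => // n /= /hN h.
  by rewrite norm_nc ltcE /= ncBC h e0 eqxx.
move=> e e0; have e0' : 0 < e%:C by rewrite ltcR.
have [N _ hN] := ul _ e0'; exists N => n /hN /=.
by rewrite norm_nc ltcR ncBC.
Qed.

Lemma ctends_le u l (b : nat -> R) : (b @ \oo --> (0 : R))%classic ->
  (forall n, nc (u n - l) <= b n) -> ctends u l.
Proof.
move=> /cvgrPdist_lt b0 ub e e0; have [N _ hN] := b0 _ e0; exists N => n /hN /=.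
by rewrite sub0r normrN; apply: le_lt_trans; apply: le_trans (ub n) (ler_norm _).
Qed.

Lemma ctendsD u v l m : ctends u l -> ctends v m -> ctends (fun n => u n + v n) (l + m).
Proof.
move=> ul vm e e0; have e2 : 0 < e / 2 by rewrite divr_gt0.
have [N hN] := ul _ e2; have [M hM] := vm _ e2.
exists (maxn N M) => n; rewrite geq_max => /andP[/hN h1 /hM h2].
rewrite opprD addrACA; apply: le_lt_trans (ncD _ _) _; lra.
Qed.

Lemma ctendsMl c u l : ctends u l -> ctends (fun n => c * u n) (c * l).
Proof.
move=> ul e e0; have c1 : 0 < nc c + 1 by have := nc_ge0 c; lra.
have [N hN] := ul _ (divr_gt0 e0 c1); exists N => n /hN h.
rewrite -mulrBr ncM; apply: le_lt_trans (_ : _ <= (nc c + 1) * nc (u n - l)) _.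
  by rewrite ler_wpM2r ?nc_ge0 // lerDl.
by rewrite mulrC -ltr_pdivlMr.
Qed.

Lemma ctendsN u l : ctends u l -> ctends (fun n => - u n) (- l).
Proof.
by move=> ul e /ul[N hN]; exists N => n /hN; rewrite -opprD ncN.
Qed.

Lemma ctends_cst l : ctends (fun _ => l) l.
Proof. by move=> e e0; exists 0%N => n _; rewrite subrr nc0. Qed.

Lemma eq_ctends u v l : (forall n, u n = v n) -> ctends u l -> ctends v l.
Proof. by move=> uv ul e /ul[N hN]; exists N => n /hN; rewrite uv. Qed.

Lemma ctends_lim_le u l a b : ctends u l -> (exists N, forall n, (N <= n)%N -> nc (u n - a) <= b) ->
  nc (l - a) <= b.
Proof.
move=> ul [M hM]; apply/ler_addgt0Pr => e e0; have [N hN] := ul _ e0.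
have := hN _ (leq_maxl N M); have := hM _ (leq_maxr N M) => h1 h2.
rewrite -(subrK (u (maxn N M)) l) -addrA; apply: le_trans (ncD _ _) _.
by rewrite [nc (l - _)]ncBC; move: h1 h2; lra.
Qed.

Lemma ctends_unique u l m : ctends u l -> ctends u m -> l = m.
Proof.
move=> ul um; apply/eqP; rewrite -subr_eq0 -nc_eq0 eq_le nc_ge0 andbT.
apply/ler_addgt0Pr => e e0; rewrite add0r; apply: (ctends_lim_le ul).
by have [N hN] := um _ e0; exists N => n /hN/ltW.
Qed.

Lemma ctends_shift u l k : ctends u l -> ctends (fun n => u (n + k)%N) l.
Proof. by move=> ul e /ul[N hN]; exists N => n h; apply: hN; apply: leq_trans h (leq_addr _ _). Qed.

Lemma dominated_series (u : nat -> C) (b : nat -> R) (S : R) :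
  (forall n, nc (u n) <= b n) -> (forall n, \sum_(0 <= i < n) b i <= S) ->
  exists l, ctends (fun n => \sum_(0 <= i < n) u i) l.
Proof.
move=> ub bS.
have b0 n : 0 <= b n := le_trans (nc_ge0 _) (ub n).
have cvgb : cvgn (series b).
  apply: nondecreasing_is_cvgn.
    by apply/nondecreasing_seqP => n; rewrite /series /= big_nat_recr //= lerDl.
  by exists S => _ [n _ <-]; apply: bS.
have dom (v : nat -> R) : (forall n, `|v n| <= b n) -> cvgn (series v).
  move=> vb; apply: normed_cvg; apply: series_le_cvg cvgb => // n; apply: normr_ge0.
have /dom cr : forall n, `|complex.Re (u n)| <= b n.
  by move=> n; apply: le_trans (Re_nc _) (ub n).
have /dom ci : forall n, `|complex.Im (u n)| <= b n.
  by move=> n; apply: le_trans (Im_nc _) (ub n).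
move: cr ci => /cvg_ex[lr /cvgrPdist_lt lrP] /cvg_ex[li /cvgrPdist_lt liP].
exists (lr +i* li) => e e0; have e2 : 0 < e / 2 by rewrite divr_gt0.
have [N _ hN] := lrP _ e2; have [M _ hM] := liP _ e2.
exists (maxn N M) => n; rewrite geq_max => /andP[/hN /= h1 /hM /= h2].
apply: le_lt_trans (nc_ReIm _) _; rewrite !cReD !cImD !cReN !cImN cRe_sum cIm_sum /=.
by rewrite distrC [X in _ + X]distrC; move: h1 h2; rewrite /series /=; lra.
Qed.
End Norm.

Section Exponential.
Implicit Types u w z : C.

Lemma cexpD u w : cexp (u + w) = cexp u * cexp w.
Proof.
case: u w => [a b] [c d]; rewrite /cexp /= expRD cosD sinD.
by congr (_ +i* _); rewrite ?(mul0r, mulr0, subr0, addr0, add0r) //=; ring.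
Qed.

Lemma cexp0 : cexp 0 = 1 :> C.
Proof. by rewrite /cexp /= expR0 cos0 sin0 mul1r. Qed.

Lemma nc_cexp w : nc (cexp w) = expR (complex.Re w).
Proof.
rewrite /cexp ncM nc_real ger0_norm ?expR_ge0 //=.
by rewrite cos2Dsin2 sqrtr1 mulr1.
Qed.

Lemma cexpX w n : cexp (n%:R * w) = cexp w ^+ n.
Proof.
elim: n => [|n IH]; first by rewrite mul0r cexp0.
by rewrite -natr1 mulrDl mul1r cexpD IH exprSr.
Qed.

Lemma cexp_real (x : R) : cexp x%:C = (expR x)%:C :> C.
Proof. by rewrite /cexp /= cos0 sin0 mulr1. Qed.

Lemma Re_cexp w : complex.Re (cexp w) = expR (complex.Re w) * cos (complex.Im w).
Proof. by case: w => a b /=; rewrite mul0r subr0. Qed.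

Lemma Im_cexp w : complex.Im (cexp w) = expR (complex.Re w) * sin (complex.Im w).
Proof. by case: w => a b /=; rewrite mul0r addr0. Qed.

Lemma cexp_sub1_neg w : complex.Re w <= 0 -> nc (cexp w - 1) <= 3 * nc w.
Proof.
set x := complex.Re w; set y := complex.Im w => x0.
have xr : `|x| <= nc w := Re_nc w.
have yr : `|y| <= nc w := Im_nc w.
apply: le_trans (nc_ReIm _) _; rewrite !cReD !cImD !cReN !cImN Re_cexp Im_cexp -/x -/y /=.
have e0 := expR_ge0 x; have e1 : expR x <= 1 by rewrite expR_le1.
have a := expR_sub1 x0; have b := norm_cos_sub1' y; have c := norm_sin_le y.
have h1 : `|expR x * cos y - 1| <= `|expR x - 1| + `|cos y - 1|.
  have -> : expR x * cos y - 1 = (expR x - 1) + expR x * (cos y - 1) by ring.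
  apply: le_trans (ler_normD _ _) _; rewrite lerD2l normrM (ger0_norm e0).
  by rewrite ler_piMl.
have h2 : `|expR x * sin y - 0| <= `|sin y|.
  by rewrite subr0 normrM (ger0_norm e0) ler_piMl.
lra.
Qed.

Lemma cexp_sub2_neg w : complex.Re w <= 0 -> nc (cexp w - 1 - w) <= 4 * nc w ^+ 2.
Proof.
set x := complex.Re w; set y := complex.Im w => x0.
have xr : `|x| <= nc w := Re_nc w.
have yr : `|y| <= nc w := Im_nc w.
apply: le_trans (nc_ReIm _) _; rewrite !cReD !cImD !cReN !cImN Re_cexp Im_cexp -/x -/y /=.
have e0 := expR_ge0 x; have e1 : expR x <= 1 by rewrite expR_le1.
have a1 := expR_sub2 x0; have a2 := expR_sub1 x0.
have b1 := norm_cos_sub1 y; have b2 := norm_sin_sub y.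
have h1 : `|expR x * cos y - 1 - x| <= `|expR x - 1 - x| + `|cos y - 1|.
  have -> : expR x * cos y - 1 - x = (expR x - 1 - x) + expR x * (cos y - 1) by ring.
  apply: le_trans (ler_normD _ _) _; rewrite lerD2l normrM (ger0_norm e0).
  by rewrite ler_piMl.
have h2 : `|expR x * sin y - 0 - y| <= `|sin y - y| + `|expR x - 1| * `|y|.
  have -> : expR x * sin y - 0 - y = expR x * (sin y - y) + (expR x - 1) * y by ring.
  apply: le_trans (ler_normD _ _) _; rewrite [X in _ + X]normrM lerD2r normrM (ger0_norm e0).
  by rewrite ler_piMl.
have := normr_ge0 x; have := normr_ge0 y; have := normr_ge0 (expR x - 1); nra.
Qed.

Lemma cexp_sub2 w : nc (cexp w - 1 - w) <= 9 * nc w ^+ 2 * expR `|complex.Re w|.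
Proof.
have r0 := nc_ge0 w; have [x0|x0] := leP (complex.Re w) 0.
  apply: le_trans (cexp_sub2_neg x0) _.
  have : 1 <= expR `|complex.Re w| by have := expR_ge1Dx `|complex.Re w|; have := normr_ge0 (complex.Re w); lra.
  have := sqr_ge0 (nc w); nra.
(* For a positive real part, factor out [cexp w] and use the bounds at -w. *)
pose v := - w; have v0 : complex.Re v <= 0 by rewrite cReN oppr_le0 ltW.
have h1 := cexp_sub1_neg v0; have h2 := cexp_sub2_neg v0.
have -> : cexp w - 1 - w = cexp w * (v ^+ 2 + v * (cexp v - 1 - v) - (cexp v - 1 - v)).
  have e : cexp w * cexp v = 1 by rewrite -cexpD /v subrr cexp0.
  transitivity (cexp w - cexp w * cexp v + v * (cexp w * cexp v)); last by ring.
  by rewrite e /v; ring.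
rewrite ncM nc_cexp (gtr0_norm x0) mulrC ler_wpM2r ?expR_ge0 //.
have -> : nc w = nc v by rewrite ncN.
apply: le_trans (ncB _ _) _; apply: le_trans (lerD (ncD _ _) h2) _; rewrite ncX ncM.
have h3 : nc (cexp v - 1 - v) <= 4 * nc v by apply: le_trans (ncB _ _) _; lra.
have := nc_ge0 v; nra.
Qed.
End Exponential.

(** * The nome q and the function pi^2 / sin^2 *)

Section Nome.
Implicit Types u w z : C.

Definition tpi : C := (2 * pi)%:C * 'i.
Definition qz z : C := cexp (tpi * z).

Lemma nc_tpi : nc tpi = 2 * pi.
Proof. by rewrite /tpi ncM nc_real nc_i mulr1 ger0_norm // mulr_ge0 // pi_ge0. Qed.

Lemma tpi_neq0 : tpi != 0.
Proof. by rewrite -nc_gt0 nc_tpi mulr_gt0 // pi_gt0. Qed.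

Lemma Re_tpi z : complex.Re (tpi * z) = - (2 * pi * complex.Im z).
Proof. by case: z => a b; rewrite /tpi /=; ring. Qed.
Lemma Im_tpi z : complex.Im (tpi * z) = 2 * pi * complex.Re z.
Proof. by case: z => a b; rewrite /tpi /=; ring. Qed.

Lemma nc_qz z : nc (qz z) = expR (- (2 * pi * complex.Im z)).
Proof. by rewrite nc_cexp Re_tpi. Qed.

Lemma qzD z w : qz (z + w) = qz z * qz w.
Proof. by rewrite /qz mulrDr cexpD. Qed.

Lemma qzX z n : qz (n%:R * z) = qz z ^+ n.
Proof. by rewrite /qz mulrCA cexpX. Qed.

Lemma qz1 : qz 1 = 1.
Proof.
apply/eqP; rewrite /qz eq_complex Re_cexp Im_cexp Re_tpi Im_tpi /= mulr0 oppr0 expR0 mulr1.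
have -> : 2 * pi = pi *+ 2 :> R by rewrite mulr_natl.
by rewrite cos2pi sin2pi mul1r mulr0 !eqxx.
Qed.

Lemma qz_nat n : qz n%:R = 1.
Proof. by rewrite -[n%:R]mulr1 qzX qz1 expr1n. Qed.

Lemma qzDnat z n : qz (z + n%:R) = qz z.
Proof. by rewrite qzD qz_nat mulr1. Qed.

Lemma qzBnat z n : qz (z - n%:R) = qz z.
Proof. by rewrite -[LHS](qzDnat _ n) subrK. Qed.

Lemma qz_lt1 z : 0 < complex.Im z -> nc (qz z) < 1.
Proof. by move=> z0; rewrite nc_qz expR_lt1 oppr_lt0 !mulr_gt0 // pi_gt0. Qed.

Lemma qz_neq1 z : 0 < complex.Im z -> qz z != 1.
Proof. by move=> /qz_lt1 h; apply: contraTneq h => ->; rewrite nc1 ltxx. Qed.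

Lemma qz_real_neq1 (x : R) : 0 < x < 1 -> qz x%:C != 1.
Proof.
move=> /andP[x0 x1]; apply/negP => /eqP/(congr1 (@complex.Re R)).
rewrite /qz Re_cexp Re_tpi Im_tpi /= mulr0 oppr0 expR0 mul1r => e.
have := cos_sub1 (2 * pi * x); rewrite e subrr => /esym/eqP.
rewrite mulf_eq0 oppr_eq0 pnatr_eq0 /= sqrf_eq0 => /eqP s0.
have := @sin_gt0_pi R (pi * x); rewrite (_ : 2 * pi * x / 2 = pi * x) in s0; last by field.
rewrite s0 ltxx => H; suff: false by []; apply: H.
have := pi_gt0 R => p0; rewrite mulr_gt0 //= gtr_pMr //.
Qed.

Lemma qz_prim N : (0 < N)%N -> N.-primitive_root (qz (N%:R^-1)).
Proof.
move=> N0; have N0' : N%:R != 0 :> C by rewrite pnatr_eq0 -lt0n.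
rewrite /primitive_root_of_unity N0 /=; apply/forallP => i; rewrite unity_rootE -qzX.
apply/eqP; case: (ltngtP i.+1 N) => [iN| |->].
- apply/negbTE.
  have -> : i.+1%:R / N%:R = (i.+1%:R / N%:R)%:C :> C.
    by rewrite rmorphM /= fmorphV !rmorph_nat.
  apply: qz_real_neq1; rewrite divr_gt0 ?ltr0n //= ltr_pdivrMr ?ltr0n //.
  by rewrite mul1r ltr_nat.
- by rewrite ltnNge ltn_ord.
- by rewrite divff // qz1 eqxx.
Qed.

(* (pi / sin (pi z))^2, written in terms of the nome *)
Definition csc_sq z : C := tpi ^+ 2 * (qz z / (1 - qz z) ^+ 2).

(** The points (z + j - M) / N have nomes t zeta^j with t^N = q. The shift M only serves to centre
    the N consecutive integers at 0. *)
Lemma csc_sq_mul N M z : (0 < N)%N -> 0 < complex.Im z ->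
  \sum_(j < N) csc_sq ((z + (j%:R - M%:R)) / N%:R) = N%:R ^+ 2 * csc_sq z.
Proof.
move=> N0 z0; have N0' : N%:R != 0 :> C by rewrite pnatr_eq0 -lt0n.
pose t := qz ((z - M%:R) / N%:R).
have tN : t ^+ N = qz z by rewrite -qzX mulrC divfK // qzBnat.
rewrite /csc_sq -mulr_sumr mulrCA; congr (_ * _).
rewrite -tN -(sum_inv_sq_prim_root (qz_prim N0)); last by rewrite tN qz_neq1.
apply: eq_bigr => j _.
have -> : qz ((z + (j%:R - M%:R)) / N%:R) = t * qz N%:R^-1 ^+ j; last by [].
by rewrite -qzX -qzD -mulrDl addrAC addrA.
Qed.

(** Two duplications: sin x = 2 cos(x/2) sin(x/2), where cos(x/2) >= cos(3 pi / 8) and sin(x/2) >=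
    x/8. The range stays away from the zeros at -pi and pi. *)
Lemma sin_lower : exists2 c : R, 0 < c & forall x, `|x| <= 3 / 4 * pi -> c * `|x| <= `|sin x|.
Proof.
have p0 := pi_gt0 R.
have [/andP[_ p4] _] := @pihalf_02_cos_pihalf R.
pose c := cos (3 / 8 * pi : R); have c0 : 0 < c by apply: cos_gt0_pihalf; lra.
exists (c / 4); first by rewrite divr_gt0.
move=> x; wlog x0 : x / 0 <= x.
  move=> H h; have [/H|/ltW x0] := leP 0 x; first by apply.
  by rewrite -normrN -[in leRHS]normrN -sinN; apply: H; rewrite ?oppr_ge0 ?normrN.
rewrite ger0_norm // => xp.
have d (t : R) : sin t = 2 * cos (t / 2) * sin (t / 2).
  by have {1}-> : t = (t / 2) *+ 2 by [rewrite mulr2n; lra]; rewrite sin_mulr2n -mulr_natl mulrA.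
have cb (t : R) : 0 <= t <= 1 -> 0 <= t / 2 -> 1 / 2 <= cos t.
  move=> /andP[t0 t1] _; have := norm_cos_sub1 t; have := norm_cos_sub1' (t / 2).
  have := cos_sub1 t; have := norm_sin_le (t / 2); rewrite (ger0_norm (_ : 0 <= t / 2)) ?divr_ge0 //.
  move=> h1 h2 _ _; have := sqr_ge0 (sin (t / 2)).
  have : sin (t / 2) ^+ 2 <= (t / 2) ^+ 2.
    by rewrite -[sin _ ^+ 2]real_normK ?num_real // lerXn2r ?nnegrE ?normr_ge0 ?divr_ge0.
  nra.
have [xi xi1 e] := MVT0 (x / 4) (@is_derive_sin R).
have x4 : 0 <= x / 4 <= 1 by lra.
have xi2 : 0 <= xi <= 1 by move: xi1; have /andP[x40 x41] := x4; case/orP => /andP[]; lra.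
have s4 : x / 8 <= sin (x / 4).
  move: e; rewrite sin0 subr0 => ->.
  have := cb xi xi2 _; have /andP[h1 h2] := xi2; rewrite divr_ge0 // => /(_ isT) => h.
  by have /andP[x40 x41] := x4; nra.
have s2 : x / 8 <= sin (x / 2).
  rewrite d (_ : x / 2 / 2 = x / 4); last by field.
  have := cb (x / 4) x4 _; have /andP[x40 x41] := x4; rewrite divr_ge0 // => /(_ isT) => h.
  nra.
have cx : c <= cos (x / 2).
  rewrite /c; have [->|ne] := eqVneq (x / 2) (3 / 8 * pi) => //.
  by apply: ltW; rewrite ltr_cos ?in_itv /=; lra.
apply: le_trans (ler_norm _); rewrite d; have /andP[x40 x41] := x4; nra.
Qed.

(** With r = |q|, |1 - q|^2 = (1 - r)^2 + 4 r sin(pi x)^2: the first term controls y, the second x.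
    The bound Y keeps r away from 0. *)
Lemma one_sub_qz_lower (Y : R) : exists2 c : R, 0 < c &
  forall w, `|complex.Re w| <= 3 / 4 -> 0 < complex.Im w <= Y -> c * nc w <= nc (1 - qz w).
Proof.
have p0 := pi_gt0 R; have [c c0 hc] := sin_lower.
pose r0 := expR (- (2 * pi * Y)); have r00 : 0 < r0 := expR_gt0 _.
have b1 : 0 < r0 * c * pi by rewrite !mulr_gt0.
have b2 : 0 < r0 * pi by rewrite mulr_gt0.
exists (Num.min (r0 * c * pi) (r0 * pi)); first by rewrite lt_min b1.
move=> w; set x := complex.Re w; set y := complex.Im w => xh /andP[y0 yY].
set r := expR (- (2 * pi * y)); set th := 2 * pi * x.
have rr0 : r0 <= r by rewrite ler_expR lerN2 ler_wpM2l // mulr_ge0 // ltW.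
have r1 : r <= 1 by rewrite expR_le1 oppr_le0 !mulr_ge0 // ltW.
have yr : 2 * pi * y * r <= 1 - r.
  have := expR_ge1Dx (2 * pi * y); rewrite -[expR _]invrK -expRN -/r => h.
  have rp : 0 < r := expR_gt0 _.
  have : (1 + 2 * pi * y) * r <= 1 by rewrite -ler_pdivlMr // div1r.
  by rewrite mulrDl mul1r; lra.
have ncE : nc (1 - qz w) ^+ 2 = (1 - r) ^+ 2 + 4 * r * sin (pi * x) ^+ 2.
  have -> : nc (1 - qz w) ^+ 2 = complex.Re (1 - qz w) ^+ 2 + complex.Im (1 - qz w) ^+ 2.
    by case: (1 - qz w) => a b /=; rewrite sqr_sqrtr // addr_ge0 ?sqr_ge0.
  rewrite cReD cImD cReN cImN /qz Re_cexp Im_cexp Re_tpi Im_tpi -/r -/th /=.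
  have := cos_sub1 th; rewrite /th (_ : 2 * pi * x / 2 = pi * x); last by field.
  have := cos2Dsin2 (2 * pi * x); set a := cos _; set b := sin _; set s := sin _ => h1 h2.
  have -> : (1 - r * a) ^+ 2 + (0 - r * b) ^+ 2 = 1 - 2 * r * a + r ^+ 2 * (a ^+ 2 + b ^+ 2) by ring.
  by rewrite h1 (_ : a = 1 - 2 * s ^+ 2); [ring|lra].
set n := nc (1 - qz w) in ncE *; have n0 : 0 <= n := nc_ge0 _.
have sx : c * (pi * `|x|) <= `|sin (pi * x)|.
  by have := hc (pi * x); rewrite normrM (ger0_norm (ltW p0)); apply; rewrite mulrC; nra.
have s2 : sin (pi * x) ^+ 2 = `|sin (pi * x)| ^+ 2 by rewrite real_normK ?num_real.
set s := `|sin _| in sx s2; have s0 : 0 <= s := normr_ge0 _.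
have n1 : 1 - r <= n by have := sqr_ge0 (sin (pi * x)); nra.
have n2 : 2 * r * s <= n.
  have rs0 : 0 <= 2 * r * s by rewrite !mulr_ge0 // expR_ge0.
  rewrite -(@ler_pXn2r _ 2) ?nnegrE //.
  rewrite ncE s2; have := sqr_ge0 s; have := sqr_ge0 (1 - r); nra.
have w1 : nc w <= `|x| + y by rewrite -[in leRHS](gtr0_norm y0); apply: nc_ReIm.
have n3 : 2 * (r0 * c * pi * `|x|) <= n.
  apply: le_trans n2; have := normr_ge0 x => x0.
  have : r0 * (c * (pi * `|x|)) <= r * s by apply: ler_pM => //; rewrite ?mulr_ge0 // ltW.
  by lra.
have n4 : 2 * (r0 * pi * y) <= n.
  apply: le_trans (le_trans yr n1).
  have : r0 * (pi * y) <= r * (pi * y) by rewrite ler_wpM2r // mulr_ge0 // ltW.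
  by lra.
set m := Num.min _ _.
have m1 : m <= r0 * c * pi by rewrite ge_min lexx.
have m2 : m <= r0 * pi by rewrite ge_min lexx orbT.
have m0 : 0 <= m by rewrite le_min !ltW.
have : m * nc w <= m * (`|x| + y) by rewrite ler_wpM2l.
have : m * `|x| <= r0 * c * pi * `|x| by rewrite ler_wpM2r.
have : m * y <= r0 * pi * y by rewrite ler_wpM2r // ltW.
by lra.
Qed.

(** Put W = 2 pi i w and e^W = 1 + W + r. The numerator of the difference is W^2 (e^W - 1) - 2 W r -
    r^2, at most (3 + 8 + 16) |W|^3, whence 27. A bound in 1/|w| is all that [csc_sq_zsum]
    requires. *)
Lemma csc_sq_near0 (Y : R) : exists2 c : R, 0 < c &
  forall w, `|complex.Re w| <= 3 / 4 -> 0 < complex.Im w <= Y -> nc (csc_sq w - (w ^+ 2)^-1) <= c / nc w.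
Proof.
have p0 := pi_gt0 R; have [c c0 hc] := one_sub_qz_lower Y.
exists (27 * (2 * pi) ^+ 3 / c ^+ 2); first by rewrite divr_gt0 ?exprn_gt0 // ?mulr_gt0 ?exprn_gt0 ?mulr_gt0.
move=> w xh yh; have y0 : 0 < complex.Im w by case/andP: yh.
have w0 : w != 0 by apply: contraTneq y0 => ->; rewrite ltxx.
have n0 : 0 < nc w by rewrite nc_gt0.
pose W : C := tpi * w; pose e : C := qz w.
have W0 : complex.Re W <= 0 by rewrite Re_tpi oppr_le0 !mulr_ge0 // ltW.
have h0 : c * nc w <= nc (1 - e) := hc w xh yh.
have h1 : nc (e - 1) <= 3 * nc W := cexp_sub1_neg W0.
have h2 : nc (e - 1 - W) <= 4 * nc W ^+ 2 := cexp_sub2_neg W0.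
rewrite /csc_sq -/e.
have e1 : 1 - e != 0 by rewrite -nc_gt0; apply: lt_le_trans h0; rewrite mulr_gt0.
have ncW : nc W = 2 * pi * nc w by rewrite ncM nc_tpi.
have -> : tpi ^+ 2 * (e / (1 - e) ^+ 2) - (w ^+ 2)^-1 =
   (W ^+ 2 * (e - 1) - 2 * W * (e - 1 - W) - (e - 1 - W) ^+ 2) / (w ^+ 2 * (1 - e) ^+ 2).
  by rewrite /W; field; rewrite w0 e1.
rewrite ncM ncV; have k0 : 0 < (c * nc w) ^+ 2 by rewrite exprn_gt0 // mulr_gt0.
have den : nc w ^+ 2 * (c * nc w) ^+ 2 <= nc (w ^+ 2 * (1 - e) ^+ 2).
  rewrite ncM !ncX ler_wpM2l ?exprn_ge0 ?nc_ge0 // lerXn2r ?nnegrE ?nc_ge0 //.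
  by rewrite mulr_ge0 // ltW.
have num : nc (W ^+ 2 * (e - 1) - 2 * W * (e - 1 - W) - (e - 1 - W) ^+ 2) <= 27 * nc W ^+ 3.
  set r := e - 1 - W in h2 *.
  have h3 : nc r <= 4 * nc W by apply: le_trans (ncB _ _) _; lra.
  have eis_stab := nc_ge0 W; have g1 := nc_ge0 r; have g2 := nc_ge0 (e - 1).
  apply: le_trans (ncB _ _) _; apply: le_trans (lerD (ncB _ _) (lexx _)) _.
  rewrite [nc (r ^+ 2)]ncX [nc (W ^+ 2 * _)]ncM [nc (W ^+ 2)]ncX [nc (2 * W * _)]ncM [nc (2 * W)]ncM nc_nat.
  have a1 : nc W ^+ 2 * nc (e - 1) <= nc W ^+ 2 * (3 * nc W) by rewrite ler_wpM2l ?exprn_ge0.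
  have a2 : nc W * nc r <= nc W * (4 * nc W ^+ 2) by rewrite ler_wpM2l.
  have a3 : nc r * nc r <= 4 * nc W ^+ 2 * (4 * nc W) by apply: ler_pM.
  by rewrite !exprS expr0 in a1 a2 a3 *; lra.
apply: le_trans (ler_pM (nc_ge0 _) _ num (_ : _ <= (nc w ^+ 2 * (c * nc w) ^+ 2)^-1)) _.
- by rewrite invr_ge0 nc_ge0.
- by rewrite lef_pV2 ?posrE ?(lt_le_trans _ den) // mulr_gt0 // exprn_gt0.
rewrite ncW le_eqVlt; apply/orP; left; apply/eqP; field.
by rewrite !gt_eqF.
Qed.
End Nome.

(** * Sums over the integers and the partial fractions of pi^2 / sin^2 *)

Section LatticeSums.
Implicit Types (u w z x h : C) (M N n k : nat).

(** The non-zero integers up to M in absolute value. The integer 0 is kept apart because it is the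
    pole when the expansion is made at z = 0. *)
Definition zsum (F : C -> C) M : C :=
  \sum_(0 <= n < M) (F n.+1%:R + F (- n.+1%:R)).

Lemma zsumE (F : C -> C) M :
  \sum_(j < M.*2.+1) F (j%:R - M%:R) = F 0 + zsum F M.
Proof.
elim: M => [|M IH]; first by rewrite big_ord1 /zsum big_nil addr0 subrr.
rewrite doubleS big_ord_recl big_ord_recr /= /zsum big_nat_recr //= -/(zsum F M).
rewrite sub0r /bump /= add1n [F 0 + (_ + _)]addrA -IH.
have -> : (M.*2.+2%:R - M.+1%:R : C) = M.+1%:R.
  by rewrite -natrB; [congr _%:R; lia|lia].
rewrite addrCA [F M.+1%:R + _]addrC; congr (_ + _).
apply: eq_bigr => j _; congr F.
by rewrite -[in M.+1%:R]natr1 add1n -natr1; ring.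
Qed.

Lemma nc_zsum (F : C -> C) M :
  nc (zsum F M) <= \sum_(0 <= n < M) (nc (F n.+1%:R) + nc (F (- n.+1%:R))).
Proof.
apply: le_trans (nc_sum _ _ _) _; apply: ler_sum => n _; exact: ncD.
Qed.

Lemma sum_inv_sqr_le M : \sum_(0 <= n < M) (n.+1%:R ^+ 2)^-1 <= 2 :> R.
Proof.
case: M => [|M]; first by rewrite big_nil.
suff h : \sum_(0 <= n < M.+1) (n.+1%:R ^+ 2)^-1 <= 2 - M.+1%:R^-1 :> R.
  by apply: le_trans h _; rewrite lerBlDr lerDl invr_ge0.
elim: M => [|M IH]; first by rewrite big_nat1 expr1n !invr1; lra.
rewrite big_nat_recr //=; apply: le_trans (lerD IH (lexx _)) _.
have a : 0 < M.+1%:R :> R by rewrite ltr0n.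
have b : M.+2%:R = M.+1%:R + 1 :> R by rewrite natr1.
rewrite b; set t : R := M.+1%:R in a *.
have t1 : 0 < t + 1 by lra.
rewrite -subr_ge0 (_ : _ - _ = (t * (t + 1) ^+ 2)^-1); last by field; rewrite !gt_eqF.
by rewrite invr_ge0 mulr_ge0 ?exprn_ge0 ?(ltW a) ?(ltW t1).
Qed.

(** |z + n| >= |n| / K for integers n other than 0. This holds in the half plane and at z = 0 alike,
    so one Taylor estimate serves both Lipschitz's formula and the zeta values. *)
Definition zbound (K : R) z : Prop := 0 < K /\ forall n x,
  x = z + n.+1%:R \/ x = z - n.+1%:R -> x != 0 /\ nc x^-1 <= K / n.+1%:R.

Lemma zbound0 : zbound 1 0.
Proof.
by split=> // n x; rewrite add0r sub0r => -[] ->; rewrite ?oppr_eq0 pnatr_eq0 ncV ?ncN nc_nat div1r.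
Qed.

(** Im(conj(z) (m z + t)) = -t Im z. That the bound does not depend on m is essential for the double
    sums. *)
Lemma lattice_lower z (m t : R) : complex.Im z * `|t| <= nc z * nc (m%:C * z + t%:C).
Proof.
have conjE : nc z = nc (z^*%C) by case: z => a b /=; rewrite sqrrN.
rewrite conjE -ncM; apply: le_trans (Im_nc _).
case: z {conjE} => a b /=.
have -> : a * (m * b + 0 * a + 0) + - b * (m * a - 0 * b + t) = - (b * t) by ring.
rewrite normrN normrM ler_wpM2r //; exact: ler_norm.
Qed.

Lemma natC n : (n%:R : R)%:C = n%:R :> C.
Proof. exact: rmorph_nat. Qed.

Lemma lattice_inv z m n : 0 < complex.Im z ->
  nc (m%:R * z + n.+1%:R)^-1 <= nc z / complex.Im z / n.+1%:R /\
  nc (m%:R * z - n.+1%:R)^-1 <= nc z / complex.Im z / n.+1%:R.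
Proof.
move=> y0; have n0 : 0 < n.+1%:R :> R by rewrite ltr0n.
have z0 : 0 < nc z by rewrite nc_gt0; apply: contraTneq y0 => ->; rewrite ltxx.
have H (t : R) : `|t| = n.+1%:R -> nc (m%:R * z + t%:C)^-1 <= nc z / complex.Im z / n.+1%:R.
  move=> tn; have := lattice_lower z m%:R t; rewrite tn natC => h.
  have k0 : 0 < nc (m%:R * z + t%:C).
    by rewrite -(pmulr_rgt0 _ z0); apply: lt_le_trans h; rewrite mulr_gt0.
  rewrite ncV -mulrA -invfM ler_pdivlMr ?mulr_gt0 // mulrC.
  by rewrite ler_pdivrMr.
split; first by rewrite -(natC n.+1); apply: H; rewrite ger0_norm // ltW.
by rewrite -(natC n.+1) -rmorphN; apply: H; rewrite normrN ger0_norm // ltW.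
Qed.

Lemma zbound_H z : 0 < complex.Im z -> zbound (nc z / complex.Im z) z.
Proof.
move=> y0; have z0 : 0 < nc z by rewrite nc_gt0; apply: contraTneq y0 => ->; rewrite ltxx.
split=> [|n x xE]; first by rewrite divr_gt0.
have [h1 h2] := lattice_inv 1 n y0; rewrite mul1r in h1 h2; split; last by case: xE => ->.
apply: contraTneq y0 => x0; suff -> : complex.Im z = complex.Im x by rewrite x0 ltxx.
by case: xE => ->; rewrite cImD ?cImN cIm_nat ?oppr0 addr0.
Qed.

Definition pw k z x : C := ((z + x) ^+ k)^-1.

Lemma pw_bound K z k n : zbound K z -> (2 <= k)%N ->
  nc (pw k z n.+1%:R) <= K ^+ k * (n.+1%:R ^+ 2)^-1 /\
  nc (pw k z (- n.+1%:R)) <= K ^+ k * (n.+1%:R ^+ 2)^-1.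
Proof.
move=> [K0 /(_ n) hK] k2; have [_ h1] := hK _ (or_introl erefl).
have [_ h2] := hK _ (or_intror erefl); have n0 : 0 < n.+1%:R :> R by rewrite ltr0n.
have H x : nc (x^-1) <= K / n.+1%:R -> nc (x ^+ k)^-1 <= K ^+ k * (n.+1%:R ^+ 2)^-1.
  move=> h; have -> : nc (x ^+ k)^-1 = nc x^-1 ^+ k by rewrite !ncV ncX exprVn.
  apply: le_trans (_ : (K / n.+1%:R) ^+ k <= _).
    by rewrite lerXn2r // nnegrE ?nc_ge0 // divr_ge0 // ltW.
  rewrite exprMn ler_wpM2l ?exprn_ge0 ?(ltW K0) // exprVn lef_pV2 ?posrE ?exprn_gt0 //.
  by rewrite ler_weXn2l // ler1n.
by split; apply: H.
Qed.

Lemma pw_sum_bound K z k M : zbound K z -> (2 <= k)%N ->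
  \sum_(0 <= n < M) (nc (pw k z n.+1%:R) + nc (pw k z (- n.+1%:R))) <= 4 * K ^+ k.
Proof.
move=> zK k2; have K0 : 0 <= K ^+ k by case: zK => /ltW K0 _; rewrite exprn_ge0.
apply: le_trans (_ : \sum_(0 <= n < M) 2 * K ^+ k * (n.+1%:R ^+ 2)^-1 <= _).
  apply: ler_sum => n _; have [h1 h2] := pw_bound n zK k2.
  by apply: le_trans (lerD h1 h2) _; rewrite -mulrA [2 * _]mulr_natl mulr2n.
rewrite -mulr_sumr; have := sum_inv_sqr_le M; have := mulr_ge0 (ler0n R 2) K0; nra.
Qed.

Lemma zsum_cvg K z k : zbound K z -> (2 <= k)%N -> exists l, ctends (zsum (pw k z)) l.
Proof.
move=> zK k2.
apply: (@dominated_series _ (fun n => nc (pw k z n.+1%:R) + nc (pw k z (- n.+1%:R))) (4 * K ^+ k)).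
  by move=> n; apply: ncD.
by move=> M; apply: pw_sum_bound.
Qed.

(** Trades a divergent sum of 1/|x_j| for e times the number of terms plus a multiple of the bounded
    sum of 1/|x_j|^2. *)
Lemma inv_amgm (e a : R) : 0 < e -> 0 < a -> a^-1 <= e + (4 * e)^-1 * (a ^+ 2)^-1.
Proof.
move=> e0 a0; rewrite -subr_ge0.
rewrite (_ : _ - _ = (2 * e * a - 1) ^+ 2 / (4 * e * a ^+ 2)); last by field; rewrite !gt_eqF.
by apply: divr_ge0; rewrite ?sqr_ge0 // mulr_ge0 ?exprn_ge0 ?(ltW a0) // mulr_ge0 // ltW.
Qed.

Lemma center_dist j M : (j < M.*2.+1)%N -> `|j%:R - M%:R| <= M%:R :> R.
Proof.
rewrite ltnS -addnn -(ler_nat R) natrD => h.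
by rewrite ler_norml; have := ler0n R j; lra.
Qed.

(** By the distribution relation with N = 2 M + 1, [csc_sq z] is the sum of N^(-2)
    [csc_sq (x j / N)] for x j = z + j - M. Near 0 each term is 1/(x j)^2 up to c / (N |x j|), and
    (c / N) times the sum of the 1/|x j| tends to 0. *)
Lemma csc_sq_zsum z : 0 < complex.Im z -> ctends (fun M => pw 2 z 0 + zsum (pw 2 z) M) (csc_sq z).
Proof.
move=> y0 e e0; have zK := zbound_H y0; set K := nc z / _ in zK.
have [c c0 hc] := csc_sq_near0 (complex.Im z).
pose A : R := nc (pw 2 z 0) + 4 * K ^+ 2.
have K0 : 0 <= K by case: zK => /ltW.
have A0 : 0 <= A by apply: addr_ge0; [exact: nc_ge0|apply: mulr_ge0 => //; apply: exprn_ge0].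
pose eps : R := e / (2 * c).
have eps0 : 0 < eps by rewrite divr_gt0 // mulr_gt0.
pose B : R := c * (4 * eps)^-1 * A.
have B0 : 0 <= B.
  by apply: mulr_ge0 => //; apply: mulr_ge0; [exact: ltW|rewrite invr_ge0 mulr_ge0 // ltW].
(* N > 4 |Re z|, together with |j - M| <= N/2, gives |Re (w j)| <= 3/4; N > 2 B / e makes the
   remainder B / N smaller than e / 2, the other half being c times [eps]. *)
pose bnd : R := 4 * `|complex.Re z| + 2 * B / e.
have bnd0 : 0 <= bnd.
  by apply: addr_ge0; [exact: mulr_ge0|apply: divr_ge0; [exact: mulr_ge0|exact: ltW]].
exists (Num.bound bnd) => M hM; set N := M.*2.+1.
have MN : M%:R <= N%:R / 2 :> R.
  by rewrite ler_pdivlMr // -natrM ler_nat /N; lia.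
have bN : bnd < N%:R.
  apply: lt_le_trans (archi_boundP bnd0) _; rewrite ler_nat; apply: leq_trans hM _.
  by rewrite /N; lia.
have N0 : 0 < N%:R :> R by rewrite ltr0n.
have N0' : N%:R != 0 :> C by rewrite pnatr_eq0.
pose x j : C := z + (j%:R - M%:R); pose w j : C := x j / N%:R.
have xE j : complex.Re (x j) = complex.Re z + (j%:R - M%:R) /\ complex.Im (x j) = complex.Im z.
  by rewrite /x !cReD !cImD cReN cImN cRe_nat cRe_nat !cIm_nat; split=> //; ring.
have wE j : w j = x j * (N%:R^-1)%:C by rewrite /w fmorphV rmorph_nat.
have Rew j : complex.Re (w j) = complex.Re (x j) / N%:R by rewrite wE cReM /= mulr0 subr0.
have Imw j : complex.Im (w j) = complex.Im z / N%:R by rewrite wE cImM /= mulr0 add0r (xE j).2.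
have xn0 j : 0 < nc (x j).
  by rewrite nc_gt0; apply: contraTneq y0 => xj; rewrite -(xE j).2 xj ltxx.
have est j : (j < N)%N -> nc (csc_sq (w j) - (w j ^+ 2)^-1) <= c * N%:R / nc (x j).
  move=> jN; have := hc (w j); rewrite Rew Imw (xE j).1 => h.
  apply: le_trans (h _ _) _.
  - rewrite normrM normfV (ger0_norm (ltW N0)) ler_pdivrMr //.
    apply: le_trans (ler_normD _ _) _.
    have h1 := center_dist jN.
    have h2 : 4 * `|complex.Re z| <= N%:R.
      by apply: le_trans (ltW bN); rewrite lerDl; apply: divr_ge0; [exact: mulr_ge0|exact: ltW].
    by lra.
  - by rewrite divr_gt0 //= ler_pdivrMr // ler_peMr ?ler1n // ltW.
  - have -> : nc (w j) = nc (x j) / N%:R by rewrite ncM ncV nc_nat.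
    rewrite (_ : c / (nc (x j) / N%:R) = c * N%:R / nc (x j)) //.
    by field; rewrite !gt_eqF.
have key : nc (pw 2 z 0 + zsum (pw 2 z) M - csc_sq z) <= (N%:R ^+ 2)^-1 * \sum_(j < N) c * N%:R / nc (x j).
  have -> : pw 2 z 0 + zsum (pw 2 z) M - csc_sq z =
      - ((N%:R ^+ 2)^-1 * \sum_(j < N) (csc_sq (w j) - (w j ^+ 2)^-1)).
    rewrite sumrB (csc_sq_mul _ _ y0) // -zsumE mulrBr mulKf ?expf_neq0 // opprB; congr (_ - _).
    rewrite mulr_sumr; apply: eq_bigr => j _; rewrite /pw /w -/(x j).
    have xj : x j != 0 by rewrite -nc_gt0.
    by field; rewrite N0' xj.
  rewrite ncN ncM ncV ncX nc_nat ler_wpM2l ?invr_ge0 ?exprn_ge0 //.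
  by apply: le_trans (nc_sum _ _ _) _; apply: ler_sum => j _; apply: est.
apply: le_lt_trans key _.
have S2 : \sum_(j < N) (nc (x j) ^+ 2)^-1 <= A.
  have -> : \sum_(j < N) (nc (x j) ^+ 2)^-1 = complex.Re (\sum_(j < N) ((nc (pw 2 z (j%:R - M%:R)))%:C : C)).
    by rewrite cRe_sum; apply: eq_bigr => j _; rewrite /pw ncV ncX.
  rewrite (zsumE (fun t => (nc (pw 2 z t))%:C)) cReD /= lerD2l cRe_sum.
  apply: le_trans (pw_sum_bound M zK (leqnn 2)).
  by apply: ler_sum => n _; rewrite cReD.
have S1 : \sum_(j < N) (nc (x j))^-1 <= N%:R * eps + (4 * eps)^-1 * A.
  apply: le_trans (_ : \sum_(j < N) (eps + (4 * eps)^-1 * (nc (x j) ^+ 2)^-1) <= _).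
    by apply: ler_sum => j _; apply: inv_amgm.
  rewrite big_split /= sumr_const card_ord -mulr_sumr -[eps *+ N]mulr_natl lerD2l.
  by rewrite ler_wpM2l // invr_ge0; apply: mulr_ge0 => //; exact: ltW.
rewrite -mulr_sumr.
have -> : (N%:R ^+ 2)^-1 * (c * N%:R * \sum_(i < N) (nc (x i))^-1) = c / N%:R * \sum_(i < N) (nc (x i))^-1.
  by field; rewrite gt_eqF.
apply: le_lt_trans (_ : c / N%:R * (N%:R * eps + (4 * eps)^-1 * A) < _).
  by rewrite ler_wpM2l //; apply: divr_ge0; exact: ltW.
have -> : c / N%:R * (N%:R * eps + (4 * eps)^-1 * A) = e / 2 + B / N%:R.
  by rewrite /B /eps; field; rewrite !gt_eqF.
suff : B / N%:R < e / 2 by lra.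
have h : 2 * B / e < N%:R by apply: le_lt_trans bN; rewrite lerDr; exact: mulr_ge0.
rewrite ltr_pdivrMr //; move: h; rewrite ltr_pdivrMr // mulrC [N%:R * e]mulrC => h.
by rewrite -(@ltr_pM2l _ 2) // (_ : 2 * (e / 2 * N%:R) = e * N%:R) 1?[2 * B]mulrC //; field.
Qed.
End LatticeSums.

(** * Taylor expansions in the imaginary direction *)

Section TaylorBounds.
Implicit Types (u w z x h : C) (M N n k J j : nat) (t : R).

Definition pw_taylor J h x : C :=
  \sum_(0 <= j < J) (-1) ^+ j * j.+1%:R * h ^+ j * (x ^+ j.+2)^-1.

Lemma pw_taylorE J h x : x != 0 ->
  (x + h) ^+ 2 * pw_taylor J h x =
  1 - (-1) ^+ J * (J.+1%:R * (h / x) ^+ J + J%:R * (h / x) ^+ J.+1).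
Proof.
move=> x0; elim: J => [|J IH].
  by rewrite /pw_taylor big_nil mulr0 !expr0 mul0r addr0 !mulr1 subrr.
rewrite /pw_taylor big_nat_recr //= -/(pw_taylor J h x) mulrDr IH.
have -> : (x + h) ^+ 2 * ((-1) ^+ J * J.+1%:R * h ^+ J * (x ^+ J.+2)^-1) =
   (-1) ^+ J * J.+1%:R * (h / x) ^+ J * (1 + h / x) ^+ 2.
  rewrite expr_div_n !exprS; field; rewrite x0 expf_neq0 //.
rewrite !exprS -[J.+2%:R]natr1 -[J.+1%:R]natr1.
by ring.
Qed.

Lemma pw_taylor_bound J h x : x != 0 -> 2 * nc h <= nc x ->
  nc (((x + h) ^+ 2)^-1 - pw_taylor J h x) <= 4 * (2 * J%:R + 1) * nc h ^+ J * nc x^-1 ^+ J.+2.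
Proof.
move=> x0 hx; have nx : 0 < nc x by rewrite nc_gt0.
have nh := nc_ge0 h.
have xh : nc x / 2 <= nc (x + h) by have := nc_sub x (- h); rewrite opprK ncN; lra.
have xh0 : x + h != 0 by rewrite -nc_gt0; lra.
have -> : ((x + h) ^+ 2)^-1 - pw_taylor J h x =
   ((x + h) ^+ 2)^-1 * ((-1) ^+ J * (J.+1%:R * (h / x) ^+ J + J%:R * (h / x) ^+ J.+1)).
  apply: (mulfI (expf_neq0 2 xh0)); rewrite mulrBr pw_taylorE // mulVKf ?expf_neq0 //.
  by rewrite mulfV ?expf_neq0 // opprB addrC subrK.
have u1 : nc (h / x) <= 1 by rewrite ncM ncV ler_pdivrMr // mul1r; lra.
have u0 := nc_ge0 (h / x).
have [u uE] : {u | u = h / x} by exists (h / x).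
rewrite -uE in u0 u1 *.
rewrite !ncM ncV !ncX ncN nc1 expr1n mul1r.
apply: le_trans (_ : 4 / nc x ^+ 2 * ((2 * J%:R + 1) * nc u ^+ J) <= _).
  apply: ler_pM; rewrite ?invr_ge0 ?exprn_ge0 ?nc_ge0 //.
    rewrite -invf_div lef_pV2 ?posrE ?divr_gt0 ?exprn_gt0 //; last lra.
    have : (nc x / 2) ^+ 2 <= nc (x + h) ^+ 2 by rewrite lerXn2r // nnegrE ?nc_ge0 // divr_ge0 // ltW.
    by rewrite expr_div_n; lra.
  apply: le_trans (ncD _ _) _; rewrite !ncM !ncX !nc_nat exprS -[J.+1%:R]natr1.
  have p0 : 0 <= nc u ^+ J by rewrite exprn_ge0.
  have j0 : 0 <= J%:R :> R by [].
  have : nc u * nc u ^+ J <= nc u ^+ J by rewrite ler_piMl.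
  move=> h1; have : J%:R * (nc u * nc u ^+ J) <= J%:R * nc u ^+ J by rewrite ler_wpM2l.
  by lra.
rewrite uE ncM ncV !exprMn !exprS le_eqVlt; apply/orP; left; apply/eqP.
by field; rewrite gt_eqF // expf_neq0 // gt_eqF.
Qed.

Lemma zsum_taylor K z J h M : zbound K z -> 2 * K * nc h <= 1 ->
  nc (zsum (pw 2 (z + h)) M - \sum_(0 <= j < J) (-1) ^+ j * j.+1%:R * h ^+ j * zsum (pw j.+2 z) M)
  <= 16 * (2 * J%:R + 1) * K ^+ J.+2 * nc h ^+ J.
Proof.
move=> [K0 zK] Kh; have nh := nc_ge0 h.
have -> : \sum_(0 <= j < J) (-1) ^+ j * j.+1%:R * h ^+ j * zsum (pw j.+2 z) M =
   zsum (fun x => pw_taylor J h (z + x)) M.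
  rewrite /zsum; under eq_bigr do rewrite mulr_sumr.
  rewrite exchange_big /=; apply: eq_bigr => n _.
  rewrite /pw_taylor -big_split /=; apply: eq_bigr => j _.
  by rewrite mulrDr.
have -> : zsum (pw 2 (z + h)) M - zsum (fun x => pw_taylor J h (z + x)) M =
   zsum (fun x => ((z + x + h) ^+ 2)^-1 - pw_taylor J h (z + x)) M.
  rewrite /zsum -sumrB; apply: eq_bigr => n _.
  by rewrite /pw [z + h + _]addrAC [z + h - _]addrAC; ring.
apply: le_trans (nc_zsum _ _) _.
(* 16 = 4 * 2 * 2: the constant of [pw_taylor_bound], the two signs of n, and the bound 2 for the
   sum of 1/n^2. *)
pose D : R := 4 * (2 * J%:R + 1) * nc h ^+ J * K ^+ J.+2.
have D0 : 0 <= D.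
  by rewrite /D; apply: mulr_ge0; [apply: mulr_ge0; [have := ler0n R J; lra|exact: exprn_ge0]|apply: exprn_ge0; exact: ltW].
have step n x : x = z + n.+1%:R \/ x = z - n.+1%:R ->
   nc (((x + h) ^+ 2)^-1 - pw_taylor J h x) <= D * (n.+1%:R ^+ 2)^-1.
  move=> xE; have n0 : 0 < n.+1%:R :> R by rewrite ltr0n.
  have n1 : 1 <= n.+1%:R :> R by rewrite ler1n.
  have [x0 xi] := zK n x xE; have nx : 0 < nc x by rewrite nc_gt0.
  have xl : 1 <= K * nc x.
    by move: xi; rewrite ncV ler_pdivlMr // ler_pdivrMl // mulrC; apply: le_trans.
  have hx : 2 * nc h <= nc x.
    by rewrite -(ler_pM2l K0) mulrA [K * 2]mulrC; apply: le_trans Kh xl.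
  apply: le_trans (pw_taylor_bound J x0 hx) _.
  rewrite /D -[leRHS]mulrA; apply: ler_wpM2l.
    by apply: mulr_ge0; [have := ler0n R J; lra|exact: exprn_ge0].
  apply: le_trans (_ : (K / n.+1%:R) ^+ J.+2 <= _).
    by rewrite lerXn2r // nnegrE ?nc_ge0 // divr_ge0 // ltW.
  rewrite exprMn ler_wpM2l ?exprn_ge0 ?(ltW K0) // exprVn lef_pV2 ?posrE ?exprn_gt0 //.
  by rewrite ler_weXn2l.
apply: le_trans (_ : \sum_(0 <= n < M) 2 * D * (n.+1%:R ^+ 2)^-1 <= _).
  apply: ler_sum => n _.
  have h1 := step n (z + n.+1%:R) (or_introl erefl).
  have h2 := step n (z - n.+1%:R) (or_intror erefl).
  by apply: le_trans (lerD h1 h2) _; rewrite -mulrA [2 * _]mulr_natl mulr2n.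
rewrite -mulr_sumr; apply: le_trans (_ : 2 * D * 2 <= _).
  by rewrite ler_wpM2l ?sum_inv_sqr_le // mulr_ge0.
by rewrite /D le_eqVlt; apply/orP; left; apply/eqP; ring.
Qed.

(** Letting t tend to 0 kills the constant term; then divide by t and repeat. This is what
    identifies Taylor coefficients without differentiating a series. *)
Lemma poly_small_zero J (c : nat -> C) (t0 B : R) : 0 < t0 ->
  (forall t, 0 < t <= t0 -> nc (\sum_(0 <= j < J) c j * (t%:C) ^+ j) <= B * t ^+ J) ->
  forall j, (j < J)%N -> c j = 0.
Proof.
move=> t00; elim: J c => [//|J IH] c H.
have B0 : 0 <= B.
  have := H t0; rewrite t00 lexx => /(_ isT) /(le_trans (nc_ge0 _)).
  by rewrite pmulr_lge0 // exprn_gt0.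
pose S : R := \sum_(0 <= j < J) nc (c j.+1) * t0 ^+ j.
have S0 : 0 <= S.
  by apply: sumr_ge0 => j _; apply: mulr_ge0; [exact: nc_ge0|apply: exprn_ge0; exact: ltW].
have tail t : 0 < t <= t0 -> nc (\sum_(0 <= j < J) c j.+1 * (t%:C) ^+ j) <= S.
  move=> /andP[t1 t2]; apply: le_trans (nc_sum _ _ _) _; apply: ler_sum => j _.
  rewrite ncM ncX nc_real gtr0_norm // ler_wpM2l ?nc_ge0 // lerXn2r // nnegrE ltW //.
have split t : \sum_(0 <= j < J.+1) c j * (t%:C) ^+ j =
   c 0%N + t%:C * \sum_(0 <= j < J) c j.+1 * (t%:C) ^+ j.
  rewrite big_nat_recl //= expr0 mulr1 mulr_sumr; congr (_ + _).
  by apply: eq_bigr => j _; rewrite exprS mulrCA.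
have c0 : c 0%N = 0.
  apply/eqP; rewrite -nc_eq0 eq_le nc_ge0 andbT.
  apply/ler_addgt0Pr => e e0; rewrite add0r.
  pose Q : R := S + B * t0 ^+ J + 1.
  have Q0 : 0 < Q by rewrite ltr_pwDr // addr_ge0 // mulr_ge0 // exprn_ge0 // ltW.
  pose t : R := Num.min t0 (e / Q).
  have t1 : 0 < t by rewrite lt_min t00 divr_gt0.
  have t2 : t <= t0 by rewrite ge_min lexx.
  have t3 : t * Q <= e by rewrite -ler_pdivlMr // ge_min lexx orbT.
  have tt : 0 < t <= t0 by rewrite t1.
  have h1 := H t tt; have h2 := tail t tt; rewrite split in h1.
  set T := \sum_(0 <= j < J) _ in h1 h2.
  have h3 : nc (c 0%N) <= nc (c 0%N + t%:C * T) + t * nc T.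
    have := nc_sub (c 0%N) (- (t%:C * T)); rewrite opprK ncN ncM nc_real gtr0_norm //; lra.
  have h4 : t * nc T <= t * S by rewrite ler_pM2l.
  have h5 : B * t ^+ J.+1 <= t * (B * t0 ^+ J).
    rewrite exprS mulrCA ler_pM2l // ler_wpM2l // lerXn2r // nnegrE ltW //.
  by move: t3; rewrite /Q !mulrDr; lra.
case=> [_|j jJ] //; apply: (IH (fun j => c j.+1)) => // t tt.
have t1 : 0 < t by case/andP: tt.
have := H t tt; rewrite split c0 add0r ncM nc_real gtr0_norm // exprS mulrCA.
by rewrite ler_pM2l.
Qed.

Lemma poly_exp_bound (a : nat) (s : R) : 0 < s ->
  exists B : R, forall n, n.+1%:R ^+ a * expR (- s) ^+ n <= B.
Proof.
move=> s0; exists (a.+1`!%:R / s ^+ a.+1 * expR s) => n.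
have n0 : 0 < n.+1%:R :> R by rewrite ltr0n.
have n1 : 1 <= n.+1%:R :> R by rewrite ler1n.
have := expR_ge1Dxn a (ltW (mulr_gt0 s0 n0)) => h.
have f0 : 0 < a.+1`!%:R :> R by rewrite ltr0n fact_gt0.
have h1 : n.+1%:R ^+ a <= a.+1`!%:R / s ^+ a.+1 * expR (s * n.+1%:R).
  apply: le_trans (_ : n.+1%:R ^+ a.+1 <= _); first by rewrite exprS ler_peMl // exprn_ge0 // ltW.
  have -> : n.+1%:R ^+ a.+1 = (s * n.+1%:R) ^+ a.+1 / s ^+ a.+1 :> R.
    by rewrite exprMn mulrAC mulfV ?mul1r // expf_neq0 // gt_eqF.
  rewrite [leRHS]mulrAC ler_wpM2r ?invr_ge0 ?exprn_ge0 ?(ltW s0) //.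
  rewrite [leRHS]mulrC -ler_pdivrMr //; apply: le_trans h; rewrite lerDr //.
have -> : expR (- s) ^+ n = expR s * expR (- (s * n.+1%:R)).
  by rewrite -expRM_natl -expRD; congr expR; rewrite -natr1; ring.
have e0 := expR_gt0 (- (s * n.+1%:R)); have e1 := expR_gt0 s.
apply: le_trans (ler_wpM2r (_ : 0 <= expR s * expR (- (s * n.+1%:R))) h1) _; first by rewrite mulr_ge0 // ltW.
rewrite expRN le_eqVlt; apply/orP; left; apply/eqP.
have v0 : expR (s * n.+1%:R) != 0 by rewrite gt_eqF ?expR_gt0.
have w0 : s ^+ a.+1 != 0 by rewrite expf_neq0 // gt_eqF.
rewrite exprS in w0 *; move: (expR (s * _)) v0 => v v0.
rewrite mulf_eq0 negb_or in w0; have /andP[s1 s2] := w0.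
by field; rewrite v0 s1 s2.
Qed.

Definition qlim (f : nat -> R) z (l : C) : Prop :=
  ctends (fun n => \sum_(0 <= r < n) (f r)%:C * qz z ^+ r) l.

Lemma qterm_bound (a : nat) z : 0 < complex.Im z -> exists2 B : R, 0 <= B &
  forall r, r.+1%:R ^+ a * nc (qz z) ^+ r <= B * (r.+1%:R ^+ 2)^-1.
Proof.
move=> y0; have s0 : 0 < 2 * pi * complex.Im z by rewrite !mulr_gt0 // pi_gt0.
have [B hB] := poly_exp_bound a.+2 s0; exists B.
  by apply: le_trans (hB 0%N); rewrite mulr_ge0 // exprn_ge0 // expR_ge0.
move=> r; have n0 : 0 < r.+1%:R :> R by rewrite ltr0n.
rewrite nc_qz ler_pdivlMr ?exprn_gt0 //; apply: le_trans (hB r).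
by rewrite mulrAC -exprD addn2.
Qed.

Lemma qlim_ex (f : nat -> R) a (B : R) z : 0 < complex.Im z ->
  (forall r, `|f r| <= B * r.+1%:R ^+ a) -> exists l, qlim f z l.
Proof.
move=> y0 fB; have [D D0 hD] := qterm_bound a y0.
have B0 : 0 <= B by have := fB 0%N; rewrite expr1n mulr1; apply: le_trans.
apply: (@dominated_series _ (fun r => B * D * (r.+1%:R ^+ 2)^-1) (B * D * 2)).
  move=> r; rewrite ncM nc_real ncX.
  apply: le_trans (ler_wpM2r _ (fB r)) _; first by rewrite exprn_ge0 // nc_ge0.
  by rewrite -!mulrA ler_wpM2l.
by move=> n; rewrite -mulr_sumr ler_wpM2l ?sum_inv_sqr_le // mulr_ge0.
Qed.
End TaylorBounds.

Section Cosecant.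
Implicit Types (u w z x h : C) (M N n k J j : nat) (t : R).

Lemma ctends_harmonic (u : nat -> C) (l : C) (B : R) :
  (forall n, nc (u n - l) <= B * n.+1%:R^-1) -> ctends u l.
Proof.
move=> uB; apply: (ctends_le _ uB); rewrite -(mulr0 B).
by apply: cvgM; [exact: cvg_cst|exact: cvg_harmonic].
Qed.

Lemma ctends_sum (u : nat -> nat -> C) (l : nat -> C) J :
  (forall j, (j < J)%N -> ctends (u j) (l j)) ->
  ctends (fun n => \sum_(0 <= j < J) u j n) (\sum_(0 <= j < J) l j).
Proof.
elim: J => [|J IH] H.
  by rewrite big_nil; apply: eq_ctends (ctends_cst 0) => n; rewrite big_nil.
rewrite big_nat_recr //=; apply: (@eq_ctends (fun n => \sum_(0 <= j < J) u j n + u J n)).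
  by move=> n; rewrite big_nat_recr.
by apply: ctendsD; [apply: IH => j jJ; apply: H; apply: ltnW|apply: H].
Qed.

Lemma sum_geo_sqr (q : C) n : (1 - q) ^+ 2 * \sum_(0 <= r < n) r%:R * q ^+ r =
  q * (1 - q ^+ n) - n%:R * (1 - q) * q ^+ n.
Proof.
elim: n => [|n IH]; first by rewrite big_nil expr0; ring.
rewrite big_nat_recr //= mulrDr IH -[n.+1%:R]natr1 [q ^+ n.+1]exprS. by ring.
Qed.

Lemma qlim_csc_sq z : 0 < complex.Im z -> qlim (fun r => r%:R) z (qz z / (1 - qz z) ^+ 2).
Proof.
move=> y0; have q1 : (1 - qz z) != 0 by rewrite subr_eq0 eq_sym qz_neq1.
have [B B0 hB] := qterm_bound 1 y0.
rewrite /qlim; move: (qz z) q1 hB => q q1 hB.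
pose D : R := (nc q + nc (1 - q)) / nc (1 - q) ^+ 2 * B.
apply: (@ctends_harmonic _ _ D) => n.
have -> : \sum_(0 <= r < n) (r%:R)%:C * q ^+ r = \sum_(0 <= r < n) r%:R * q ^+ r.
  by apply: eq_bigr => r _; rewrite natC.
have -> : \sum_(0 <= r < n) r%:R * q ^+ r - q / (1 - q) ^+ 2 =
   - ((q * q ^+ n + n%:R * (1 - q) * q ^+ n) / (1 - q) ^+ 2).
  apply: (mulfI (expf_neq0 2 q1)); rewrite mulrBr sum_geo_sqr; field.
  by rewrite q1.
have n1 : 1 <= n.+1%:R :> R by rewrite ler1n.
have n0 : 0 < n.+1%:R :> R by rewrite ltr0n.
have qn : n.+1%:R * nc q ^+ n <= B * n.+1%:R^-1.
  apply: le_trans (hB n) _; rewrite ler_wpM2l // lef_pV2 ?posrE ?exprn_gt0 //.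
  by rewrite expr2 ler_peMl // ltW.
have p0 : 0 <= nc q ^+ n by rewrite exprn_ge0 // nc_ge0.
have d0 : 0 < nc (1 - q) by rewrite nc_gt0.
rewrite ncN ncM ncV ncX /D.
apply: le_trans (_ : (nc q + nc (1 - q)) * (n.+1%:R * nc q ^+ n) / nc (1 - q) ^+ 2 <= _).
  rewrite ler_wpM2r ?invr_ge0 ?exprn_ge0 ?nc_ge0 //.
  apply: le_trans (ncD _ _) _; rewrite !ncM !ncX nc_nat mulrDl; apply: lerD.
    by rewrite ler_wpM2l ?nc_ge0 // ler_peMl.
  by rewrite [n%:R * nc _]mulrC -mulrA ler_wpM2l ?nc_ge0 // ler_wpM2r // ler_nat.
rewrite mulrAC -[leRHS]mulrA ler_wpM2l // divr_ge0 ?exprn_ge0 ?addr_ge0 ?nc_ge0 //.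
Qed.

Lemma horner_exp_taylor J (x : R) : (exp_taylor R J).[x] = \sum_(0 <= j < J) x ^+ j / j`!%:R.
Proof. by rewrite /exp_taylor horner_poly big_mkord; apply: eq_bigr => j _; rewrite mulrC. Qed.

(** Moving z to z + i t multiplies q^r by exp(-2 pi r t), a real exponential with exponent <= 0, so
    [exp_taylor_bound] applies inside the q-series. *)
Lemma qlim_taylor z J t (lam : nat -> C) : 0 < complex.Im z -> 0 <= t ->
  (forall j, (j < J)%N -> qlim (fun r => r%:R ^+ j.+1) z (lam j)) ->
  forall B : R, (forall r, r.+1%:R ^+ J.+1 * nc (qz z) ^+ r <= B * (r.+1%:R ^+ 2)^-1) -> 0 <= B ->
  nc (csc_sq (z + t%:C * 'i) - tpi ^+ 2 * \sum_(0 <= j < J) ((- (2 * pi * t)) ^+ j / j`!%:R)%:C * lam j)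
  <= nc tpi ^+ 2 * ((2 * pi * t) ^+ J * B * 2).
Proof.
move=> y0 t0 hl B hB B0.
have yh : 0 < complex.Im (z + t%:C * 'i).
  by rewrite cImD cImM /= !(mul0r, mulr1, addr0, add0r, mulr0) ltr_wpDr.
rewrite /csc_sq -mulrBr ncM ncX ler_wpM2l ?exprn_ge0 ?nc_ge0 //.
have s0 : 0 <= 2 * pi * t by rewrite !mulr_ge0 // pi_ge0.
have qh : qz (z + t%:C * 'i) = qz z * (expR (- (2 * pi * t)))%:C.
  rewrite qzD; congr (_ * _); rewrite /qz -cexp_real; congr cexp.
  by apply/eqP; rewrite eq_complex Re_tpi Im_tpi /=; apply/andP; split; apply/eqP; ring.
pose v n : C := \sum_(0 <= r < n) (r%:R)%:C * qz (z + t%:C * 'i) ^+ r -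
   \sum_(0 <= j < J) ((- (2 * pi * t)) ^+ j / j`!%:R)%:C * \sum_(0 <= r < n) (r%:R ^+ j.+1)%:C * qz z ^+ r.
have vl : ctends v (qz (z + t%:C * 'i) / (1 - qz (z + t%:C * 'i)) ^+ 2
    - \sum_(0 <= j < J) ((- (2 * pi * t)) ^+ j / j`!%:R)%:C * lam j).
  apply: ctendsD; first exact: qlim_csc_sq yh.
  apply: ctendsN; apply: (@ctends_sum (fun j n => ((- (2 * pi * t)) ^+ j / j`!%:R)%:C * \sum_(0 <= r < n) (r%:R ^+ j.+1)%:C * qz z ^+ r)).
  by move=> j jJ; apply: ctendsMl; apply: hl.
rewrite -[X in nc X]subr0; apply: (ctends_lim_le vl); exists 0%N => n _; rewrite subr0.
have -> : v n = \sum_(0 <= r < n) (r%:R * (expR (- (2 * pi * t * r%:R)) - (exp_taylor R J).[- (2 * pi * t * r%:R)]))%:C * qz z ^+ r.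
  rewrite /v; under [X in _ - X]eq_bigr do rewrite mulr_sumr.
  rewrite exchange_big /= -sumrB; apply: eq_bigr => r _.
  rewrite qh exprMn -rmorphXn /= -expRM_natl horner_exp_taylor.
  have -> : r%:R * - (2 * pi * t) = - (2 * pi * t * r%:R) :> R by ring.
  rewrite mulrBr rmorphB /= mulrBl !rmorphM /=; congr (_ - _); first by ring.
  rewrite rmorph_sum mulr_sumr mulr_suml; apply: eq_bigr => j _.
  rewrite mulrA -!rmorphM; congr (_%:C * _).
  by rewrite exprS -[in RHS]mulNr exprMn; ring.
apply: le_trans (nc_sum _ _ _) _.
apply: le_trans (_ : \sum_(0 <= r < n) (2 * pi * t) ^+ J * B * (r.+1%:R ^+ 2)^-1 <= _).
  apply: ler_sum => r _; rewrite ncM nc_real ncX normrM (ger0_norm (ler0n _ r)).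
  have sr : 0 <= 2 * pi * t * r%:R by rewrite mulr_ge0.
  have := @exp_taylor_bound R J (- (2 * pi * t * r%:R)); rewrite oppr_le0 => /(_ sr).
  rewrite normrN (ger0_norm sr) exprMn => h.
  apply: le_trans (_ : (r%:R * ((2 * pi * t) ^+ J * r%:R ^+ J)) * nc (qz z) ^+ r <= _).
    by rewrite ler_wpM2r ?exprn_ge0 ?nc_ge0 // ler_wpM2l.
  have -> : r%:R * ((2 * pi * t) ^+ J * r%:R ^+ J) * nc (qz z) ^+ r =
    (2 * pi * t) ^+ J * (r%:R ^+ J.+1 * nc (qz z) ^+ r) by rewrite [r%:R ^+ J.+1]exprS; ring.
  rewrite -[leRHS]mulrA ler_wpM2l ?exprn_ge0 //.
  apply: le_trans (hB r); rewrite ler_wpM2r ?exprn_ge0 ?nc_ge0 //.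
  by rewrite lerXn2r ?nnegrE // ler_nat.
by rewrite -mulr_sumr ler_wpM2l ?sum_inv_sqr_le // mulr_ge0 // exprn_ge0.
Qed.

(** The second expansion, from the sum of (z + n)^(-2). Only z + i t has to lie in the half plane; z
    = 0 is allowed. *)
Lemma csc_sq_taylor K z J t (sig : nat -> C) : 0 < complex.Im (z + t%:C * 'i) -> zbound K z -> 0 <= t ->
  2 * K * t <= 1 ->
  (forall j, (j < J)%N -> ctends (zsum (pw j.+2 z)) (sig j)) ->
  nc (csc_sq (z + t%:C * 'i) - pw 2 (z + t%:C * 'i) 0
     - \sum_(0 <= j < J) (-1) ^+ j * j.+1%:R * (t%:C * 'i) ^+ j * sig j)
  <= 16 * (2 * J%:R + 1) * K ^+ J.+2 * t ^+ J.
Proof.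
move=> y0 zK t0 Kt hs; set h := t%:C * 'i.
have nh : nc h = t by rewrite /h ncM nc_real nc_i mulr1 ger0_norm.
pose v M : C := (pw 2 (z + h) 0 + zsum (pw 2 (z + h)) M - pw 2 (z + h) 0)
   - \sum_(0 <= j < J) (-1) ^+ j * j.+1%:R * h ^+ j * zsum (pw j.+2 z) M.
rewrite -[X in nc X]subr0.
apply: (@ctends_lim_le v); last first.
  exists 0%N => M _; rewrite subr0 /v [X in nc (X - _)](_ : _ = zsum (pw 2 (z + h)) M); last by ring.
  by rewrite -nh; apply: zsum_taylor; rewrite ?nh.
apply: ctendsD.
  by apply: ctendsD (ctends_cst _); apply: csc_sq_zsum.
apply: ctendsN; apply: (@ctends_sum (fun j M => (-1) ^+ j * j.+1%:R * h ^+ j * zsum (pw j.+2 z) M)).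
by move=> j jJ; apply: ctendsMl; apply: hs.
Qed.
End Cosecant.

(** * Lipschitz's formula *)

Section Lipschitz.
Implicit Types (u w z x h : C) (M N n k J j : nat) (t : R).

(** [csc_sq (z + i t)] has two expansions in t with errors O(t^J), so their coefficients agree below
    J = k - 1; the last one, that of t^(k-2), is the formula. *)
Lemma lipschitz_sum z k (l : C) : 0 < complex.Im z -> (2 <= k)%N ->
  qlim (fun r => r%:R ^+ k.-1) z l ->
  ctends (fun M => pw k z 0 + zsum (pw k z) M) ((- tpi) ^+ k / (k.-1)`!%:R * l).
Proof.
move=> y0 k2 hl; have zK := zbound_H y0; set K := nc z / _ in zK.
have z0 : z != 0 by apply: contraTneq y0 => ->; rewrite ltxx.
have nz : 0 < nc z by rewrite nc_gt0.
have K0 : 0 < K by case: zK.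
set J := k.-1; have J1 : (J.-1 < J)%N by rewrite /J; lia.
have /choice[sig sigP] : forall j, exists s, ctends (zsum (pw j.+2 z)) s.
  by move=> j; apply: zsum_cvg zK _.
have /choice[lam lamP] : forall j, exists s, qlim (fun r => r%:R ^+ j.+1) z s.
  move=> j; apply: (@qlim_ex _ j.+1 1) => // r.
  by rewrite mul1r ger0_norm ?exprn_ge0 // lerXn2r ?nnegrE // ler_nat.
have [B B0 hB] := qterm_bound J.+1 y0.
(* The difference of the two j-th coefficients. The term of the integer 0, absent from [zsum], is
   expanded separately and enters as [pw j.+2 z 0]. *)
pose c j : C := (-1) ^+ j * j.+1%:R * 'i ^+ j * (pw j.+2 z 0 + sig j)
   - tpi ^+ 2 * ((- (2 * pi)) ^+ j / j`!%:R)%:C * lam j.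
pose t0 : R := Num.min (2 * K)^-1 (nc z / 2).
have t00 : 0 < t0 by rewrite lt_min invr_gt0 mulr_gt0 //= divr_gt0.
pose D1 : R := 4 * (2 * J%:R + 1) * nc z^-1 ^+ J.+2.
pose D2 : R := 16 * (2 * J%:R + 1) * K ^+ J.+2.
pose D3 : R := nc tpi ^+ 2 * ((2 * pi) ^+ J * B * 2).
have cz : forall j, (j < J)%N -> c j = 0.
  apply: (poly_small_zero (t0 := t0) (B := D1 + D2 + D3)) => // t /andP[t1 t2].
  have Kt : 2 * K * t <= 1.
    have tK : t <= (2 * K)^-1 by apply: le_trans t2 _; rewrite ge_min lexx.
    have K2 : 0 < 2 * K by rewrite mulr_gt0.
    by apply: le_trans (ler_wpM2l (ltW K2) tK) _; rewrite mulfV // gt_eqF.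
  have tz : 2 * t <= nc z.
    have : t <= nc z / 2 by apply: le_trans t2 _; rewrite ge_min lexx orbT.
    lra.
  set h : C := t%:C * 'i; have nh : nc h = t by rewrite ncM nc_real nc_i mulr1 gtr0_norm.
  have yh : 0 < complex.Im (z + h).
    by rewrite cImD cImM /= !(mul0r, mulr1, addr0, add0r, mulr0) ltr_wpDr // ltW.
  have b1 := @pw_taylor_bound J h z z0; rewrite nh in b1; have {}b1 := b1 tz.
  have b2 := csc_sq_taylor yh zK (ltW t1) Kt (fun j _ => sigP j) (J := J); rewrite -/h in b2.
  have b3 := qlim_taylor y0 (ltW t1) (fun j _ => lamP j) hB B0; rewrite -/h in b3.
  have -> : \sum_(0 <= j < J) c j * t%:C ^+ j =
    - (((z + h) ^+ 2)^-1 - pw_taylor J h z)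
    - (csc_sq (z + h) - pw 2 (z + h) 0 - \sum_(0 <= j < J) (-1) ^+ j * j.+1%:R * h ^+ j * sig j)
    + (csc_sq (z + h) - tpi ^+ 2 * \sum_(0 <= j < J) ((- (2 * pi * t)) ^+ j / j`!%:R)%:C * lam j).
    have -> : \sum_(0 <= j < J) c j * t%:C ^+ j = pw_taylor J h z
      + \sum_(0 <= j < J) (-1) ^+ j * j.+1%:R * h ^+ j * sig j
      - tpi ^+ 2 * \sum_(0 <= j < J) ((- (2 * pi * t)) ^+ j / j`!%:R)%:C * lam j.
      rewrite /pw_taylor mulr_sumr -big_split -sumrB /=; apply: eq_bigr => j _.
      rewrite /c /pw addr0 (_ : h ^+ j = t%:C ^+ j * 'i ^+ j); last by rewrite exprMn.
      have -> : ((- (2 * pi * t)) ^+ j / j`!%:R)%:C = ((- (2 * pi)) ^+ j / j`!%:R)%:C * t%:C ^+ j :> C.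
        by rewrite -rmorphXn -rmorphM /= -mulNr exprMn mulrAC.
      by ring.
    rewrite (_ : pw 2 (z + h) 0 = ((z + h) ^+ 2)^-1); last by rewrite /pw addr0.
    move: (pw_taylor J h z) (\sum_(0 <= j < J) (-1) ^+ j * j.+1%:R * h ^+ j * sig j) => a1 a2.
    move: (\sum_(0 <= j < J) _ * lam j) (csc_sq (z + h)) => a3 a4.
    by ring.
  rewrite [leRHS]mulrDl [(D1 + D2) * _]mulrDl.
  apply: le_trans (ncD _ _) _; apply: lerD.
    rewrite -opprD ncN; apply: le_trans (ncD _ _) _; apply: lerD => //.
    by apply: le_trans b1 _; rewrite mulrAC.
  apply: le_trans b3 _; rewrite exprMn /D3 le_eqVlt; apply/orP; left; apply/eqP; ring.
have := cz _ J1; rewrite /c; have J2 : J.-1.+1 = J by lia.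
have J3 : J.+1 = k by rewrite /J; lia.
rewrite J2 J3 => /eqP; rewrite subr_eq0 => /eqP e.
have ll : lam J.-1 = l by have := lamP J.-1; rewrite J2 => h; apply: ctends_unique h hl.
have : ctends (fun M => pw k z 0 + zsum (pw k z) M) (pw k z 0 + sig J.-1).
  by apply: ctendsD; [exact: ctends_cst|have := sigP J.-1; rewrite J2 J3].
suff -> : pw k z 0 + sig J.-1 = (- tpi) ^+ k / J`!%:R * l by [].
have i0 : 'i != 0 :> C by rewrite -nc_gt0 nc_i.
have c0 : (-1) ^+ J.-1 * J%:R * 'i ^+ J.-1 != 0 :> C.
  by rewrite !mulf_neq0 ?signr_eq0 ?expf_neq0 // pnatr_eq0; rewrite /J; lia.
have J0 : J%:R != 0 :> C by rewrite pnatr_eq0 /J; lia.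
have f0 : (J.-1)`!%:R != 0 :> C by rewrite pnatr_eq0 -lt0n fact_gt0.
have Jf : J`!%:R = J%:R * (J.-1)`!%:R :> C by rewrite -natrM -{1}J2 factS J2.
have kE : (- tpi) ^+ k = tpi ^+ 2 * (- tpi) ^+ J.-1 by rewrite -J3 -{1}J2 !exprS; ring.
apply: (mulfI c0); rewrite e ll Jf kE rmorphM rmorphXn fmorphV rmorph_nat /=.
(* The powers of i coming from h = i t on the other side then cancel. *)
have -> : (- (2 * pi))%:C = tpi * 'i :> C.
  by apply/eqP; rewrite eq_complex /tpi /=; apply/andP; split; apply/eqP; ring.
rewrite [(tpi * 'i) ^+ _]exprMn [(- tpi) ^+ J.-1]exprNn.
have s2 : (-1) ^+ J.-1 * (-1) ^+ J.-1 = 1 :> C by rewrite -signr_odd; case: odd; rewrite ?mulrNN mulr1.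
rewrite [RHS](_ : _ = ((-1) ^+ J.-1 * (-1) ^+ J.-1) * (tpi ^+ 2 * (tpi ^+ J.-1 * 'i ^+ J.-1 / (J.-1)`!%:R) * l)).
  by rewrite s2 mul1r !mulrA.
by field; rewrite J0 f0.
Qed.

Lemma nc_horner_le (P : {poly C}) w : nc w <= 1 ->
  nc P.[w] <= \sum_(i < size P) nc P`_i.
Proof.
move=> w1; rewrite horner_coef; apply: le_trans (nc_sum _ _ _) _; apply: ler_sum => i _.
by rewrite ncM ncX ler_piMr ?nc_ge0 // exprn_ile1 ?nc_ge0.
Qed.

Lemma poly_small (Q : {poly C}) n (s t0 B : R) : 0 < s -> 0 < t0 -> s * t0 <= 1 ->
  (forall t, 0 < t <= t0 -> nc Q.[(- (s * t))%:C] <= B * t ^+ n) -> ('X^n %| Q)%R.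
Proof.
move=> s0 t00 st H; apply/dvdXnP => i iN.
pose A : R := \sum_(i < size (drop_poly n Q)) nc (drop_poly n Q)`_i.
have := @poly_small_zero n (fun j => Q`_j * ((- s)%:C) ^+ j) t0 (B + A * s ^+ n) t00 _ i iN.
move=> h; apply/eqP; have {}h : Q`_i * (- s)%:C ^+ i = 0.
  apply: h => t tt; have /andP[t1 t2] := tt.
  have -> : \sum_(0 <= j < n) Q`_j * (- s)%:C ^+ j * t%:C ^+ j = (take_poly n Q).[(- (s * t))%:C].
    rewrite horner_poly big_mkord; apply: eq_bigr => j _.
    by rewrite -mulrA -exprMn -rmorphM mulNr.
  have w1 : nc (- (s * t))%:C <= 1.
    rewrite nc_real normrN ger0_norm; last by rewrite mulr_ge0 // ltW.
    by apply: le_trans st; rewrite ler_pM2l.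
  have -> : (take_poly n Q).[(- (s * t))%:C] = Q.[(- (s * t))%:C] - (drop_poly n Q).[(- (s * t))%:C] * (- (s * t))%:C ^+ n.
    by rewrite -{2}(poly_take_drop n Q) hornerD hornerM hornerXn addrK.
  apply: le_trans (ncB _ _) _; rewrite mulrDl; apply: lerD; first exact: H.
  rewrite ncM ncX nc_real normrN ger0_norm; last by rewrite mulr_ge0 // ltW.
  rewrite exprMn mulrA; apply: ler_wpM2r; first by rewrite exprn_ge0 // ltW.
  by apply: ler_wpM2r; [rewrite exprn_ge0 // ltW|exact: nc_horner_le].
move/eqP: h; rewrite mulf_eq0 expf_eq0 => /orP[//|/andP[_]].
by rewrite eq_complex /= eqxx andbT oppr_eq0 gt_eqF.
Qed.
End Lipschitz.

(** * The values of zeta at integers *)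

Section ZetaValues.
Implicit Types (u w z x h : C) (M N n k J j : nat) (t : R).

Lemma exp_map_horner K (x : R) :
  (map_poly (ratr : rat -> C) (exp_poly K)).[x%:C] = ((exp_taylor R K).[x])%:C.
Proof.
rewrite -horner_map /=; congr (_.[_]); apply/polyP => i.
rewrite !coef_map /= !coef_poly; case: ifP => _; last by rewrite !rmorph0.
by rewrite !fmorphV !rmorph_nat.
Qed.

(** The hypothesis says that P agrees with X^2 e^X / (e^X - 1)^2, with two orders lost to the factor
    X^2. That series is b - X b' for b = X / (e^X - 1), whence the factor 1 - i. *)
Lemma zeta_poly J (P : {poly C}) K : (J.+4 = K)%N ->
  'X^K %| 'X^2 * map_poly (ratr : rat -> C) (exp_poly K)
          - P * (map_poly (ratr : rat -> C) (exp_poly K) - 1) ^+ 2 ->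
  forall i, (i < J.+2)%N -> P`_i = ratr ((1 - i%:R) * bernoulli i / i`!%:R).
Proof.
move=> JK hQ i iJ.
pose m := map_poly (ratr : rat -> C).
set E := map_poly _ _ in hQ; pose b := m (bern_poly K); pose e := m (eps_poly K).
have dm (q : {poly rat}) n : 'X^n %| q -> 'X^n %| m q.
  by move=> h; rewrite -(map_polyXn (ratr : {rmorphism rat -> C})) dvdp_map.
have d0 : 'X^K %| b * e - 1.
  by have := dm _ _ (bern_eps K); rewrite /m rmorphB rmorphM rmorph1.
have d1 : 'X^K %| E - (1 + 'X * e).
  by have := dm _ _ (exp_eps K); rewrite /m rmorphB rmorphD rmorphM rmorph1 /= map_polyX.
have d2 : 'X^(J.+2) %| b ^+ 2 - (b - 'X * b - 'X * b^`()).
  have := dm _ _ (bern_poly_sqr K); rewrite /m !rmorphB rmorphXn !rmorphM /= map_polyX -deriv_map.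
  by apply: dvdp_trans; rewrite dvdp_exp2l // -JK.
have K2 : ('X^(J.+2) : {poly C}) %| 'X^K by rewrite dvdp_exp2l // -JK; lia.
have d3 : 'X^(J.+2) %| E - P * e ^+ 2.
  have X20 : ('X^2 : {poly C}) != 0 by rewrite expf_neq0 // polyX_eq0.
  rewrite -(dvdp_mul2l _ _ X20) -exprD (_ : 2 + J.+2 = K)%N //.
  rewrite (_ : 'X^2 * _ = ('X^2 * E - P * (E - 1) ^+ 2)
     + P * (E - (1 + 'X * e)) * (E - 1 + 'X * e)); last by ring.
  by apply: dvdp_add => //; apply: dvdp_mulr; apply: dvdp_mull.
have : 'X^(J.+2) %| P - (b - 'X * b^`()).
  rewrite (_ : P - _ = (b ^+ 2 - (b - 'X * b - 'X * b^`())) + 'X * b * (b * e - 1)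
    + b ^+ 2 * (E - (1 + 'X * e)) - b ^+ 2 * (E - P * e ^+ 2) - P * (b * e + 1) * (b * e - 1)); last by ring.
  apply: dvdp_sub; last by apply: dvdp_mull; apply: dvdp_trans d0.
  apply: dvdp_sub; last exact: dvdp_mull.
  apply: dvdp_add; last by apply: dvdp_mull; apply: dvdp_trans d1.
  by apply: dvdp_add => //; apply: dvdp_mull; apply: dvdp_trans d0.
move=> /dvdXnP/(_ i iJ)/eqP; rewrite !coefB subr_eq0 => /eqP ->.
have iK : (i < K)%N by rewrite -JK; lia.
rewrite coefXM; have bi : b`_i = ratr (bernoulli i / i`!%:R) by rewrite coef_map /= coef_poly iK.
case: i {iJ} iK bi => [|i] iK bi /=; first by rewrite subr0 subr0 mul1r bi.
rewrite coef_deriv bi -mulrA [RHS]rmorphM rmorphB rmorph1 rmorph_nat -[_ *+ i.+1]mulr_natl /=.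
by ring.
Qed.

(** With h = i t and w = 2 pi i h = -2 pi t, h^2 [csc_sq h] equals w^2 e^w / (1 - e^w)^2, while its
    partial fractions expand at 0 with the zeta sums as coefficients. *)
Lemma zeta_value k (l : C) : (2 <= k)%N -> ctends (zsum (pw k 0)) l ->
  l = - ((- tpi) ^+ k * ratr (bernoulli k) / k`!%:R).
Proof.
move=> k2 hl; have p0 := pi_gt0 R.
have ex j : exists s : C, ctends (zsum (pw j.+2 (0 : C))) s by apply: zsum_cvg zbound0 _.
have [sig sigP] := choice ex.
pose J := k.-1; pose K := J.+4.
pose s : R := 2 * pi; have s0 : 0 < s by rewrite mulr_gt0.
have s1 : s * (2 * s)^-1 = 2^-1 by field; rewrite gt_eqF.
pose t0 : R := Num.min 2^-1 (2 * s)^-1.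
have t00 : 0 < t0 by rewrite lt_min !invr_gt0 mulr_gt0 // ltr0n.
have st0 : s * t0 <= 1.
  apply: le_trans (_ : s * (2 * s)^-1 <= 1); last by rewrite s1; lra.
  by rewrite ler_pM2l // ge_min lexx orbT.
(* The expansion of h^2 [csc_sq h] as a polynomial in w; the 1 is the contribution of the pole. *)
pose P : {poly C} := 1 + \poly_(i < J.+2) (if (2 <= i)%N then (-1) ^+ i * i.-1%:R * sig i.-2 / tpi ^+ i else 0).
have PE t : P.[(- (s * t))%:C] =
    1 + \sum_(0 <= j < J) (-1) ^+ j * j.+1%:R * (t%:C * 'i) ^+ j.+2 * sig j.
  rewrite /P hornerD hornerC horner_poly; congr (_ + _).
  rewrite big_ord_recl big_ord_recl /= !mul0r !add0r big_mkord; apply: eq_bigr => j _.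
  rewrite /bump /= add1n.
  have -> : (- (s * t))%:C = tpi * (t%:C * 'i) :> C.
    by apply/eqP; rewrite eq_complex Re_tpi Im_tpi /= /s; apply/andP; split; apply/eqP; ring.
  rewrite [(tpi * _) ^+ _]exprMn !exprS; field.
  by rewrite tpi_neq0 expf_neq0 // tpi_neq0.
pose B1 : R := 16 * (2 * J%:R + 1).
have B10 : 0 <= B1 by have := ler0n R J; rewrite /B1; lra.
have T2b t : 0 < t <= t0 -> nc ((t%:C * 'i) ^+ 2 * csc_sq (t%:C * 'i) - P.[(- (s * t))%:C]) <= B1 * t ^+ J.+2.
  move=> /andP[t1 t2]; set h : C := t%:C * 'i.
  have h0 : h != 0 by rewrite -nc_gt0 ncM nc_real nc_i mulr1 gtr0_norm.
  have nh : nc h = t by rewrite ncM nc_real nc_i mulr1 gtr0_norm.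
  have yh : 0 < complex.Im (0 + h).
    by rewrite add0r cImM /= mulr1 mul0r addr0.
  have t12 : 2 * 1 * t <= 1 by rewrite mulr1; have : t <= 2^-1 by [apply: le_trans t2 _; rewrite ge_min lexx]; lra.
  have := csc_sq_taylor yh zbound0 (ltW t1) t12 (fun j _ => sigP j) (J := J).
  rewrite -/h expr1n mulr1 add0r PE -/h => b.
  rewrite (_ : _ - _ = h ^+ 2 * (csc_sq h - pw 2 h 0 - \sum_(0 <= j < J) (-1) ^+ j * j.+1%:R * h ^+ j * sig j)).
    rewrite ncM ncX nh (_ : B1 * t ^+ J.+2 = t ^+ 2 * (B1 * t ^+ J)); last by rewrite !exprS; ring.
    by rewrite ler_wpM2l ?exprn_ge0 ?(ltW t1).
  rewrite mulrBr mulrBr mulr_sumr opprD addrA; congr (_ - _ - _).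
    by rewrite /pw addr0 mulfV // expf_neq0.
  by apply: eq_bigr => j _; rewrite !exprS; ring.
pose PM : R := \sum_(i < size P) nc P`_i.
(* Three errors: truncating e^w in w^2 e^w, replacing h^2 [csc_sq h] by P, and truncating e^w in
   (e^w - 1)^2. *)
pose B : R := s ^+ 2 * s ^+ K + B1 * s ^+ 2 + PM * (s ^+ K * 3).
have key : 'X^K %| 'X^2 * map_poly (ratr : rat -> C) (exp_poly K)
          - P * (map_poly (ratr : rat -> C) (exp_poly K) - 1) ^+ 2.
  apply: (@poly_small _ K s t0 B s0 t00 st0) => t tt; have /andP[t1 t2] := tt.
  have sn n : 0 <= s ^+ n := exprn_ge0 n (ltW s0); have tn n : 0 <= t ^+ n := exprn_ge0 n (ltW t1).
  have b := T2b t tt; have st : 0 < s * t by rewrite mulr_gt0.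
  have st1 : s * t <= 1 by apply: le_trans st0; rewrite ler_pM2l.
  set w : C := (- (s * t))%:C in b *.
  have nw : nc w = s * t by rewrite nc_real normrN gtr0_norm.
  have hE (P' E' : {poly C}) : ('X^2 * E' - P' * (E' - 1) ^+ 2).[w] = w ^+ 2 * E'.[w] - P'.[w] * (E'.[w] - 1) ^+ 2.
    by rewrite !hornerE.
  rewrite hE exp_map_horner; set Em : C := (_)%:C.
  pose e : C := (expR (- (s * t)))%:C.
  have h0 : - (s * t) <= 0 by rewrite oppr_le0 ltW.
  have eE : nc (e - Em) <= (s * t) ^+ K.
    rewrite /e /Em -rmorphB nc_real; apply: le_trans (exp_taylor_bound K h0) _.
    by rewrite normrN gtr0_norm.
  have e1 : nc (e - 1) <= s * t.
    rewrite /e -(rmorph1 (real_complex R)) -rmorphB nc_real.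
    by apply: le_trans (expR_sub1 h0) _; rewrite normrN gtr0_norm.
  have eE1 : nc (e - Em) <= 1 by apply: le_trans eE _; rewrite exprn_ile1 // ltW.
  have e3 : nc (e + Em - 2) <= 3.
    rewrite (_ : _ - 2 = (e - 1) + (e - 1) - (e - Em)); last by ring.
    apply: le_trans (ncB _ _) _; apply: le_trans (lerD (ncD _ _) (lexx _)) _; lra.
  have ene : 1 - e != 0.
    have : expR (- (s * t)) < 1 by rewrite expR_lt1 oppr_lt0.
    by rewrite /e -(rmorph1 (real_complex R)) -rmorphB eq_complex /= eqxx andbT; lra.
  have hT : (t%:C * 'i) ^+ 2 * csc_sq (t%:C * 'i) * (1 - e) ^+ 2 = w ^+ 2 * e.
    have wE : w = tpi * (t%:C * 'i).
      by apply/eqP; rewrite eq_complex Re_tpi Im_tpi /= /s; apply/andP; split; apply/eqP; ring.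
    have qE : qz (t%:C * 'i) = e by rewrite /qz -wE cexp_real.
    by rewrite /csc_sq qE wE; field.
  have -> : w ^+ 2 * Em - P.[w] * (Em - 1) ^+ 2 =
    - (w ^+ 2 * (e - Em)) + ((t%:C * 'i) ^+ 2 * csc_sq (t%:C * 'i) - P.[w]) * (1 - e) ^+ 2
      + P.[w] * ((e - Em) * (e + Em - 2)).
    by rewrite mulrBl hT; ring.
  rewrite /B [leRHS]mulrDl [(s ^+ 2 * s ^+ K + _) * _]mulrDl.
  apply: le_trans (ncD _ _) _; apply: lerD; first (apply: le_trans (ncD _ _) _; apply: lerD).
  - rewrite ncN ncM ncX nw exprMn.
    apply: le_trans (_ : s ^+ 2 * t ^+ 2 * (s ^+ K * t ^+ K) <= _).
      rewrite -[s ^+ K * _]exprMn; apply: ler_wpM2l => //.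
      by apply: mulr_ge0; apply: exprn_ge0; exact: ltW.
    rewrite [leLHS](_ : _ = t ^+ 2 * (s ^+ 2 * s ^+ K * t ^+ K)); last by ring.
    apply: ler_piMl; first exact: mulr_ge0 (mulr_ge0 (sn _) (sn _)) (tn _).
    have t_1 : t <= 1 by apply: le_trans t2 _; rewrite /t0 ge_min; apply/orP; left; lra.
    by rewrite exprn_ile1 // ltW.
  - rewrite ncM; apply: le_trans (_ : B1 * t ^+ J.+2 * (s * t) ^+ 2 <= _).
      apply: ler_pM => //; rewrite ?nc_ge0 // ncX lerXn2r ?nnegrE ?nc_ge0 ?(ltW st) //.
      by rewrite ncBC.
    by rewrite exprMn le_eqVlt; apply/orP; left; apply/eqP; rewrite /K !exprS; ring.
  rewrite [nc (P.[w] * _)]ncM [nc ((e - Em) * _)]ncM; apply: le_trans (_ : PM * ((s * t) ^+ K * 3) <= _).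
    apply: ler_pM; rewrite ?nc_ge0 ?mulr_ge0 ?nc_ge0 //.
      by apply: nc_horner_le; rewrite nw.
    by apply: ler_pM; rewrite ?nc_ge0.
  rewrite [(s * t) ^+ K]exprMn le_eqVlt; apply/orP; left; apply/eqP; ring.
have kJ : (k < J.+2)%N by rewrite /J; lia.
have := zeta_poly (erefl K) key kJ.
rewrite /P coefD coef1 coef_poly kJ k2 gtn_eqF ?add0r; last by lia.
have -> : sig k.-2 = l.
  by have := sigP k.-2; rewrite (_ : k.-2.+2 = k); [move=> h; apply: ctends_unique h hl|lia].
have k10 : k.-1%:R != 0 :> C by rewrite pnatr_eq0; lia.
have f0 : k`!%:R != 0 :> C by rewrite pnatr_eq0 -lt0n fact_gt0.
have tk : tpi ^+ k != 0 by rewrite expf_neq0 // tpi_neq0.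
have -> : (1 - k%:R : rat) = - k.-1%:R.
  by rewrite -{1}(prednK (ltnW k2)) -natr1; ring.
rewrite !rmorphM rmorphN fmorphV !rmorph_nat => h.
have s2 : (-1) ^+ k * (-1) ^+ k = 1 :> C by rewrite -signr_odd; case: odd; rewrite ?mulrNN mulr1.
have {}h : (-1) ^+ k * l = - (tpi ^+ k * ratr (bernoulli k) / k`!%:R).
  apply: (mulfI k10); rewrite [LHS](_ : _ = (-1) ^+ k * k.-1%:R * l / tpi ^+ k * tpi ^+ k).
    by rewrite h; ring.
  by field.
have -> : l = (-1) ^+ k * ((-1) ^+ k * l) by rewrite mulrA s2 mul1r.
by rewrite h [(- tpi) ^+ k]exprNn; ring.
Qed.
End ZetaValues.

(** * Eisenstein series as limits of sums over squares *)

Section EisensteinSums.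
Implicit Types (u w z x h : C) (M N n k J j a m r : nat) (t : R).

(** The index i stands for m = i - N and j for n = j - N. For k > 0 the term m = n = 0 vanishes, as
    the inverse of 0 is 0. *)
Definition square_sum k N z : C := \sum_(i < N.*2.+1) \sum_(j < N.*2.+1)
  (((i%:R - N%:R) * z + (j%:R - N%:R)) ^+ k)^-1.

(** The square is stable under (m, n) -> (n, -m), so the identity holds for each N, before any
    limit. *)
Lemma square_sum_inv k N z : z != 0 -> square_sum k N (- z^-1) = z ^+ k * square_sum k N z.
Proof.
move=> z0; rewrite /square_sum exchange_big mulr_sumr; apply: eq_bigr => i _.
rewrite mulr_sumr (reindex_inj rev_ord_inj); apply: eq_bigr => j _ /=.
have -> : (N.*2.+1 - j.+1)%:R - N%:R = - (j%:R - N%:R) :> C.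
  have : (j <= N.*2)%N by rewrite -ltnS.
  by move: (nat_of_ord j) => {}j jN; rewrite subSS natrB // -mul2n natrM; ring.
have -> : - (j%:R - N%:R) * - z^-1 + (i%:R - N%:R) = z^-1 * ((i%:R - N%:R) * z + (j%:R - N%:R)) :> C.
  by field.
by rewrite exprMn invfM exprVn invrK.
Qed.

Lemma square_sum_zsum k N z : ~~ odd k -> (0 < k)%N ->
  square_sum k N z = zsum (pw k 0) N
    + 2 * \sum_(1 <= m < N.+1) (pw k (m%:R * z) 0 + zsum (pw k (m%:R * z)) N).
Proof.
move=> ek k0; pose G x : C := pw k (x * z) 0 + zsum (pw k (x * z)) N.
have -> : square_sum k N z = \sum_(i < N.*2.+1) G (i%:R - N%:R).
  by apply: eq_bigr => i _; rewrite /G -zsumE.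
rewrite zsumE; congr (_ + _).
  by rewrite /G mul0r /pw addr0 expr0n gtn_eqF // invr0 add0r.
have GN x : G (- x) = G x.
  have pN w y : pw k (- w) y = pw k w (- y).
    by rewrite /pw -[- w + y]opprK exprNn -signr_odd (negbTE ek) mul1r opprD opprK.
  rewrite /G mulNr pN oppr0; congr (_ + _); apply: eq_bigr => n _.
  by rewrite !pN opprK addrC.
rewrite /zsum big_add1 /= mulr_sumr; apply: eq_bigr => m _.
by rewrite GN [RHS]mulr_natl mulr2n.
Qed.

(** For n > N, 1/n^k <= 1/((N + 1)^2 n^2) as k >= 4. The factor 1/(N + 1)^2 is needed because N rows
    are truncated at once. *)
Lemma zsum_tail K z k N (s : C) : zbound K z -> (4 <= k)%N -> ctends (zsum (pw k z)) s ->
  nc (s - zsum (pw k z) N) <= 4 * K ^+ k / N.+1%:R ^+ 2.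
Proof.
move=> [K0 zK] k4 hs; apply: (ctends_lim_le hs); exists N => M NM.
have N0 : 0 < N.+1%:R :> R by rewrite ltr0n.
rewrite /zsum (big_cat_nat (leq0n N) NM) //= addrAC subrr add0r.
apply: le_trans (nc_sum _ _ _) _.
have step n : (N <= n)%N -> nc (pw k z n.+1%:R + pw k z (- n.+1%:R)) <= 2 * (K ^+ k / N.+1%:R ^+ 2) * (n.+1%:R ^+ 2)^-1.
  move=> Nn; have n0 : 0 < n.+1%:R :> R by rewrite ltr0n.
  have H x : nc x^-1 <= K / n.+1%:R -> nc (x ^+ k)^-1 <= K ^+ k / N.+1%:R ^+ 2 * (n.+1%:R ^+ 2)^-1.
    move=> h; have -> : nc (x ^+ k)^-1 = nc x^-1 ^+ k by rewrite !ncV ncX exprVn.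
    apply: le_trans (_ : (K / n.+1%:R) ^+ k <= _).
      by rewrite lerXn2r // nnegrE ?nc_ge0 // divr_ge0 // ltW.
    rewrite exprMn -mulrA; apply: ler_wpM2l; first by rewrite exprn_ge0 // ltW.
    rewrite exprVn -invfM lef_pV2 ?posrE ?exprn_gt0 ?mulr_gt0 ?exprn_gt0 //.
    apply: le_trans (_ : n.+1%:R ^+ 4 <= _); last by rewrite ler_weXn2l // ler1n.
    rewrite -[4%N]/(2 + 2)%N exprD; apply: ler_wpM2r; first by rewrite exprn_ge0 // ltW.
    by rewrite lerXn2r ?nnegrE ?(ltW N0) ?(ltW n0) // ler_nat ltnS.
  have [_ h1] := zK n _ (or_introl erefl); have [_ h2] := zK n _ (or_intror erefl).
  by apply: le_trans (ncD _ _) _; apply: le_trans (lerD (H _ h1) (H _ h2)) _;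
    rewrite -[2 * _ * _]mulrA [leRHS]mulr_natl mulr2n.
apply: le_trans (_ : \sum_(N <= n < M) 2 * (K ^+ k / N.+1%:R ^+ 2) * (n.+1%:R ^+ 2)^-1 <= _).
  by rewrite big_nat_cond [leRHS]big_nat_cond; apply: ler_sum => n /andP[/andP[Nn _] _]; apply: step.
have A0 : 0 <= 2 * (K ^+ k / N.+1%:R ^+ 2).
  by rewrite mulr_ge0 // divr_ge0 // exprn_ge0 // ltW.
rewrite -mulr_sumr; apply: le_trans (_ : 2 * (K ^+ k / N.+1%:R ^+ 2) * 2 <= _).
  apply: ler_wpM2l => //; apply: le_trans (sum_inv_sqr_le M).
  rewrite [leRHS](big_cat_nat (leq0n N) NM) //= lerDr; apply: sumr_ge0 => n _.
  by rewrite invr_ge0 exprn_ge0.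
by rewrite le_eqVlt; apply/orP; left; apply/eqP; ring.
Qed.

Lemma sigma_lambert a n N M : (0 < a)%N -> (n <= N)%N -> (N < M)%N ->
  ratr (dsig a n) = \sum_(1 <= m < N.+1) \sum_(0 <= r < M | (m * r == n)%N) r%:R ^+ a :> R.
Proof.
move=> a0 nN NM; rewrite /dsig; case: eqP => [->|/eqP n0].
  rewrite rmorph0 big_nat_cond big1 // => m /andP[/andP[m0 _] _].
  rewrite big_nat_cond big1 // => r /andP[_]; rewrite muln_eq0 gtn_eqF //= => /eqP ->.
  by rewrite expr0n gtn_eqF.
rewrite -lt0n in n0.
rewrite rmorph_nat /sigma -(sum_divisors_inv (fun d => (d ^ a)%N)) // natr_sum big_divisors //.
rewrite -(big_mkord (fun d => d %| n)%N (fun d => ((n %/ d) ^ a)%:R)).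
rewrite big_mkcond big_ltn // dvd0n (gtn_eqF n0) /= add0r.
have n1 : (1 <= n.+1)%N by [].
have nN1 : (n.+1 <= N.+1)%N by [].
rewrite [RHS](big_cat_nat n1 nN1) /= [X in _ = _ + X]big_nat_cond [X in _ = _ + X]big1 ?addr0; last first.
  move=> m /andP[/andP[nm _] _]; rewrite big1 // => r /eqP mr.
  have r0 : r = 0%N by case: r mr => // r; rewrite mulnS => mr; move: nm; rewrite -mr ltnNge leq_addr.
  by move: n0; rewrite -mr r0 muln0.
rewrite big_nat_cond [RHS]big_nat_cond; apply: eq_bigr => m /andP[/andP[m0 mn] _].
case: ifPn => [/dvdnP[q nq]|nd]; last first.
  by rewrite big1 // => r /eqP mr; move: nd; rewrite -mr dvdn_mulr.
rewrite nq mulnK // (eq_bigl (fun r => r == q)) => [|r]; last by rewrite mulnC eqn_pmul2r.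
rewrite big_nat1_eq /= natrX (leq_ltn_trans _ NM) //.
by apply: leq_trans nN; rewrite nq leq_pmulr.
Qed.

(** The error consists of the pairs with m r > N. There 2 m r >= N + m + r, so with tau = |q|^(1/2)
    the modulus |q|^(m r) is at most tau^N tau^m tau^r. *)
Lemma lambert_bound a z (L : nat -> C) : (0 < a)%N -> 0 < complex.Im z ->
  (forall m, (0 < m)%N -> qlim (fun r => r%:R ^+ a) (m%:R * z) (L m)) ->
  exists B : R, forall N,
    nc (\sum_(1 <= m < N.+1) L m - \sum_(0 <= n < N.+1) (ratr (dsig a n))%:C * qz z ^+ n)
    <= B * N.+1%:R^-1.
Proof.
move=> a0 y0 hL; have y2 : 0 < complex.Im (z / 2).
  have -> : z / 2 = (2^-1)%:C * z by rewrite mulrC rmorphV ?unitfE ?pnatr_eq0 // rmorph_nat.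
  by case: z y0 {hL} => x y /= y0; rewrite mul0r addr0 mulr_gt0 // invr_gt0.
have [B B0 hB] := qterm_bound a y2; have [D D0 hD] := qterm_bound 0 y2.
set tau := nc (qz (z / 2)) in hB hD.
have t0 : 0 <= tau by apply: nc_ge0.
have t1 : tau <= 1 by apply/ltW/qz_lt1.
have qE : nc (qz z) = tau ^+ 2 by rewrite -ncX -qzX; congr (nc (qz _)); field.
have hD' r : tau ^+ r <= D * (r.+1%:R ^+ 2)^-1 by have := hD r; rewrite expr0 mul1r.
exists (D * (D * 2) * (B * 2)) => N.
have hs : ctends (fun M => \sum_(1 <= m < N.+1) \sum_(0 <= r < M) (r%:R ^+ a)%:C * qz (m%:R * z) ^+ r)
    (\sum_(1 <= m < N.+1) L m).
  rewrite big_add1 /=; apply: eq_ctends (_ : ctends _ (\sum_(0 <= m < N) L m.+1)).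
    by move=> M; rewrite big_add1 /=; reflexivity.
  by apply: ctends_sum => m _; apply: hL.
apply: (ctends_lim_le hs); exists N.+1 => M NM.
have sE : \sum_(0 <= n < N.+1) (ratr (dsig a n))%:C * qz z ^+ n =
    \sum_(1 <= m < N.+1) \sum_(0 <= r < M | (m * r <= N)%N) (r%:R ^+ a)%:C * qz (m%:R * z) ^+ r.
  transitivity (\sum_(0 <= n < N.+1) \sum_(1 <= m < N.+1) \sum_(0 <= r < M | (m * r == n)%N) (r%:R ^+ a)%:C * qz (m%:R * z) ^+ r).
    apply: eq_big_nat => n /andP[_ nN]; rewrite (sigma_lambert a0 _ NM) // rmorph_sum mulr_suml.
    apply: eq_bigr => m _; rewrite rmorph_sum mulr_suml; apply: eq_bigr => r /eqP <-.
    by rewrite exprM qzX.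
  rewrite exchange_big /=; apply: eq_bigr => m _.
  rewrite [RHS]big_mkcond; under eq_bigr do rewrite big_mkcond.
  rewrite exchange_big /=; apply: eq_bigr => r _.
  rewrite -big_mkcond /=; under eq_bigl do rewrite eq_sym.
  by rewrite big_nat1_eq /= ltnS.
rewrite sE -sumrB; apply: le_trans (nc_sum _ _ _) _.
have N0 : 0 < N.+1%:R :> R by rewrite ltr0n.
apply: le_trans (_ : \sum_(1 <= m < N.+1) (tau ^+ N * tau ^+ m * (B * 2)) <= _).
  rewrite big_nat_cond [leRHS]big_nat_cond; apply: ler_sum => m /andP[/andP[m0 mN] _].
  rewrite [X in _ - X]big_mkcond -sumrB; apply: le_trans (nc_sum _ _ _) _.
  apply: le_trans (_ : \sum_(0 <= r < M) tau ^+ N * tau ^+ m * (B * (r.+1%:R ^+ 2)^-1) <= _).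
    apply: ler_sum => r _; case: leqP => mr.
      rewrite subrr nc0 !mulr_ge0 ?exprn_ge0 // invr_ge0 exprn_ge0 //.
    rewrite subr0 ncM nc_real ger0_norm ?exprn_ge0 // qzX -exprM ncX qE -exprM.
    apply: le_trans (_ : r.+1%:R ^+ a * (tau ^+ N * tau ^+ m * tau ^+ r) <= _).
      apply: ler_pM; rewrite ?exprn_ge0 // ?lerXn2r ?nnegrE // ?ler_nat //.
      rewrite -!exprD; apply: ler_wiXn2l => //.
      have r0 : (0 < r)%N by case: r mr => //; rewrite muln0.
      have : (m + r <= (m * r).+1)%N.
        by case: m m0 {mN mr} => // m _; case: r r0 => // r _; rewrite mulSn mulnS; lia.
      by lia.
    by rewrite mulrCA; apply: ler_wpM2l; rewrite ?mulr_ge0 ?exprn_ge0.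
  rewrite -mulr_sumr; apply: ler_wpM2l; first by rewrite mulr_ge0 ?exprn_ge0.
  by rewrite -mulr_sumr; apply: ler_wpM2l => //; apply: sum_inv_sqr_le.
rewrite -mulr_suml -mulr_sumr [leRHS]mulrAC; apply: ler_wpM2r; first by rewrite mulr_ge0.
rewrite [leRHS]mulrAC; apply: ler_pM; first exact: exprn_ge0.
- by apply: sumr_ge0 => i _; apply: exprn_ge0.
- apply: le_trans (hD' N) _; apply: ler_wpM2l => //.
  by rewrite lef_pV2 ?posrE ?exprn_gt0 // expr2 ler_peMr ?(ltW N0) // ler1n.
rewrite big_add1 /=; apply: le_trans (_ : \sum_(0 <= m < N) D * (m.+1%:R ^+ 2)^-1 <= _).
  apply: ler_sum => m _; apply: le_trans (hD' m); rewrite exprS ler_piMl ?exprn_ge0 //.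
by rewrite -mulr_sumr; apply: ler_wpM2l => //; apply: sum_inv_sqr_le.
Qed.

Lemma zbound_mul z m : 0 < complex.Im z -> (0 < m)%N -> zbound (nc z / complex.Im z) (m%:R * z).
Proof.
move=> y0 m0; have z0 : 0 < nc z by rewrite nc_gt0; apply: contraTneq y0 => ->; rewrite ltxx.
split=> [|n x xE]; first by rewrite divr_gt0.
have [h1 h2] := lattice_inv m n y0; split; last by case: xE => ->.
have : complex.Im x = m%:R * complex.Im z.
  by case: xE => ->; rewrite cImD ?cImN cImM cRe_nat !cIm_nat mul0r !(oppr0, addr0).
move=> xI; apply: contraTneq y0 => x0; move: xI; rewrite x0 /= => /esym/eqP.
by rewrite mulf_eq0 pnatr_eq0 gtn_eqF //= => /eqP ->; rewrite ltxx.
Qed.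

(** Row m = 0 gives the constant term, by [zeta_value] and the definition of [ecst]; the rows m and
    -m are equal and given by Lipschitz's formula; their sum is a Lambert series. *)
Lemma square_sum_cvg k z (l : C) : 0 < complex.Im z -> (4 <= k)%N -> ~~ odd k ->
  qlim (fun n => ratr (eisG k n)) z l ->
  ctends (fun N => square_sum k N z) (2 * ((- tpi) ^+ k / (k.-1)`!%:R) * l).
Proof.
move=> y0 k4 ek hl; set ck : C := _ / _; set K := nc z / complex.Im z.
have k2 : (2 <= k)%N by apply: leq_trans k4.
have [Z hZ] := zsum_cvg zbound0 k2.
have ZE : Z = 2 * ck * (ratr (ecst k) : R)%:C.
  rewrite (zeta_value k2 hZ) /ecst (fmorph_rat (real_complex R)) /ck rmorphM rmorphN fmorphV /= rmorph_nat.
  case: (k) k2 => // j _ /=; rewrite factS !natrM; field.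
  by rewrite nat1r !pnatr_eq0 /= -lt0n fact_gt0.
have a0 : (0 < k.-1)%N by rewrite -subn1 subn_gt0.
have /choice[L hL] m : exists l, (0 < m)%N -> qlim (fun r => r%:R ^+ k.-1) (m%:R * z) l.
  case: m => [|m]; first by exists 0.
  have [|r|l' hl'] := @qlim_ex (fun r => r%:R ^+ k.-1) k.-1 1 (m.+1%:R * z).
  - by rewrite cImM cRe_nat cIm_nat mul0r addr0 mulr_gt0.
  - by rewrite mul1r ger0_norm ?exprn_ge0 // lerXn2r ?nnegrE // ler_nat.
  by exists l'.
have [B hB] := lambert_bound a0 y0 hL.
have z0 : 0 < nc z by rewrite nc_gt0; apply: contraTneq y0 => ->; rewrite ltxx.
have K0 : 0 <= K by rewrite divr_ge0 // ltW.
have h0 : ctends (fun N => square_sum k N z - 2 * ck * \sum_(0 <= r < N.+1) (ratr (eisG k r) : R)%:C * qz z ^+ r) 0.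
  (* The three constants bound the tail of row 0, the tails of the N rows and their opposites, and
     the error of the Lambert series. *)
  apply: (@ctends_harmonic _ _ (4 + 2 * (4 * K ^+ k) + nc (2 * ck) * B)) => N; rewrite subr0.
  have N0 : 0 < N.+1%:R :> R by rewrite ltr0n.
  have N1 : (N.+1%:R ^+ 2)^-1 <= N.+1%:R^-1 :> R.
    by rewrite lef_pV2 ?posrE ?exprn_gt0 // expr2 ler_peMr ?(ltW N0) // ler1n.
  pose D := \sum_(0 <= n < N.+1) (ratr (dsig k.-1 n) : R)%:C * qz z ^+ n.
  have -> : \sum_(0 <= r < N.+1) (ratr (eisG k r) : R)%:C * qz z ^+ r = (ratr (ecst k) : R)%:C + D.
    rewrite /D big_ltn // [in RHS]big_ltn // !eisGE expr0 !mulr1 {2}/dsig /= rmorph0 addr0 rmorph0 add0r.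
    congr (_ + _); rewrite big_nat_cond [RHS]big_nat_cond; apply: eq_bigr => n /andP[/andP[n0 _] _].
    by rewrite eisGE gtn_eqF // mulr0 add0r.
  rewrite square_sum_zsum // ?(ltn_trans _ k2) //.
  rewrite (_ : _ - _ = - (Z - zsum (pw k 0) N)
     + 2 * (\sum_(1 <= m < N.+1) (pw k (m%:R * z) 0 + zsum (pw k (m%:R * z)) N - ck * L m))
     + 2 * ck * (\sum_(1 <= m < N.+1) L m - D)); last first.
    by rewrite ZE sumrB -mulr_sumr; ring.
  apply: le_trans (ncD _ _) _; rewrite [leRHS]mulrDl; apply: lerD; last first.
    by rewrite ncM -mulrA; apply: ler_wpM2l; rewrite ?nc_ge0.
  apply: le_trans (ncD _ _) _; rewrite [leRHS]mulrDl; apply: lerD.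
    rewrite ncN; apply: le_trans (zsum_tail N zbound0 k4 hZ) _.
    by rewrite expr1n mulr1 ler_wpM2l.
  rewrite ncM nc_nat -mulrA; apply: ler_wpM2l => //; apply: le_trans (nc_sum _ _ _) _.
  apply: le_trans (_ : \sum_(1 <= m < N.+1) 4 * K ^+ k / N.+1%:R ^+ 2 <= _).
    rewrite big_nat_cond [leRHS]big_nat_cond; apply: ler_sum => m /andP[/andP[m0 mN] _].
    have ym : 0 < complex.Im (m%:R * z) by rewrite cImM cRe_nat cIm_nat mul0r addr0 mulr_gt0 ?ltr0n.
    have hm := lipschitz_sum ym k2 (hL m m0).
    have hm' := ctendsD hm (ctends_cst (- pw k (m%:R * z) 0)).
    have {hm}hm' : ctends (zsum (pw k (m%:R * z))) (ck * L m - pw k (m%:R * z) 0).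
      by apply: eq_ctends hm' => M; rewrite addrAC subrr add0r.
    have := zsum_tail N (zbound_mul y0 m0) k4 hm'.
    by rewrite -ncN opprB opprB addrA [_ + pw _ _ _]addrC.
  rewrite sumr_const_nat subn1 /= -[leLHS]mulr_natr -[leLHS]mulrA; apply: ler_wpM2l; first by rewrite mulr_ge0 ?exprn_ge0.
  by rewrite mulrC ler_pdivrMr ?exprn_gt0 // expr2 mulrA mulVf ?gt_eqF // mul1r ler_nat.
have h1 := ctendsMl (2 * ck) (ctends_shift 1 hl); have := ctendsD h0 h1.
by rewrite add0r; apply: eq_ctends => N; rewrite addn1 subrK.
Qed.
End EisensteinSums.

(** * Holomorphy of q-series *)

Section Holomorphy.
Implicit Types (u w z x h : C) (M N n k J j a m r : nat) (t : R).

Lemma qz_half z : qz (z / 2) ^+ 2 = qz z.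
Proof. by rewrite -qzX; congr qz; field. Qed.

Lemma Im_half z : complex.Im (z / 2) = complex.Im z / 2.
Proof.
have -> : z / 2 = (2^-1)%:C * z by rewrite mulrC fmorphV rmorph_nat.
by case: z => x y /=; rewrite mul0r addr0 mulrC.
Qed.

(** |q(z)|^n is the square of |q(z/2)|^n. One factor absorbs the growth exp(2 pi n |Im h|), as |Im
    h| <= Im z / 2; the other remains for summing over n. *)
Lemma qz_taylor_bound n z h : 0 < complex.Im z -> nc h <= complex.Im z / 2 ->
  nc (qz (z + h) ^+ n - qz z ^+ n - tpi * n%:R * h * qz z ^+ n)
  <= 9 * (2 * pi) ^+ 2 * nc h ^+ 2 * (n%:R ^+ 2 * nc (qz (z / 2)) ^+ n).
Proof.
move=> y0 hy; have p0 := pi_gt0 R.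
have -> : qz (z + h) ^+ n - qz z ^+ n - tpi * n%:R * h * qz z ^+ n =
    qz z ^+ n * (cexp (tpi * (n%:R * h)) - 1 - tpi * (n%:R * h)).
  by rewrite qzD exprMn -[qz h ^+ n]qzX /qz; ring.
have -> : 9 * (2 * pi) ^+ 2 * nc h ^+ 2 * (n%:R ^+ 2 * nc (qz (z / 2)) ^+ n) =
    nc (qz (z / 2)) ^+ n * (9 * (2 * pi * n%:R * nc h) ^+ 2).
  by rewrite !exprMn; ring.
rewrite ncM ncX -qz_half ncX -exprM mulnC exprM expr2 -mulrA.
apply: ler_wpM2l; first by rewrite exprn_ge0 ?nc_ge0.
apply: le_trans (ler_wpM2l _ (cexp_sub2 _)) _; first by rewrite exprn_ge0 ?nc_ge0.
rewrite [nc (tpi * _)]ncM nc_tpi [nc (n%:R * h)]ncM nc_nat mulrCA -[leRHS]mulr1; apply: ler_pM.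
- by rewrite mulr_ge0 ?exprn_ge0 ?nc_ge0 // mulr_ge0 ?mulr_ge0 ?nc_ge0 // ltW.
- by rewrite mulr_ge0 ?exprn_ge0 ?nc_ge0 ?expR_ge0.
- by rewrite !mulrA.
rewrite nc_qz Im_half -expRM_natl -expRD -[leRHS]expR0 ler_expR.
rewrite Re_tpi cImM cRe_nat cIm_nat mul0r addr0 normrN !normrM (ger0_norm (ltW p0)) !normr_nat.
have h1 : `|complex.Im h| <= complex.Im z / 2 by apply: le_trans (Im_nc _) hy.
have := ler_wpM2l (mulr_ge0 (mulr_ge0 (ler0n R 2) (ltW p0)) (ler0n R n)) h1; lra.
Qed.

(** The termwise second-order estimates sum to K |h|^2, so the derivative is the termwise one. *)
Lemma qlim_derivable (f : nat -> R) (B : R) (d : nat) (F : R[i]^o -> R[i]^o) z :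
  (forall r, `|f r| <= B * r.+1%:R ^+ d) ->
  (forall z, 0 < complex.Im z -> qlim f z (F z)) -> 0 < complex.Im z -> derivable F (z : R[i]^o) 1.
Proof.
move=> fB hF y0.
have B0 : 0 <= B by have := fB 0%N; rewrite expr1n mulr1; apply: le_trans.
have [D hD] : exists D, qlim (fun r => f r * r%:R) z D.
  apply: (@qlim_ex _ d.+1 B) => // r; rewrite normrM normr_nat exprSr mulrA.
  by apply: ler_pM => //; rewrite ler_nat.
have y2 : 0 < complex.Im (z / 2) by rewrite Im_half divr_gt0.
have [A A0 hA] := qterm_bound d.+2 y2.
pose K := B * (9 * (2 * pi) ^+ 2) * A * 2.
have p0 := pi_gt0 R.
have C0 : 0 <= B * (9 * (2 * pi) ^+ 2).
  by apply/mulr_ge0/mulr_ge0/exprn_ge0/mulr_ge0/ltW.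
have C1 h : 0 <= B * (9 * (2 * pi) ^+ 2) * nc h ^+ 2 by rewrite mulr_ge0 ?exprn_ge0 ?nc_ge0.
have K0 : 0 <= K by rewrite /K mulr_ge0 // mulr_ge0.
have key h : nc h <= complex.Im z / 2 -> nc (F (z + h) - F z - h * (tpi * D)) <= K * nc h ^+ 2.
  move=> hy; have yh : 0 < complex.Im (z + h).
    by rewrite cImD; have := Im_nc h; rewrite ler_norml => /andP[]; lra.
  have := ctendsD (ctendsD (hF _ yh) (ctendsN (hF _ y0))) (ctendsN (ctendsMl (h * tpi) hD)).
  rewrite -[h * tpi * D]mulrA => H; rewrite -[X in nc X]subr0; apply: (ctends_lim_le H); exists 0%N => n _.
  rewrite subr0 -sumrB mulr_sumr -sumrB; apply: le_trans (nc_sum _ _ _) _.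
  apply: le_trans (_ : \sum_(0 <= r < n) B * (9 * (2 * pi) ^+ 2) * nc h ^+ 2 * (A * (r.+1%:R ^+ 2)^-1) <= _).
    apply: ler_sum => r _.
    rewrite (_ : _ - _ - _ = (f r)%:C * (qz (z + h) ^+ r - qz z ^+ r - tpi * r%:R * h * qz z ^+ r)); last first.
      by rewrite rmorphM rmorph_nat; ring.
    rewrite ncM nc_real; apply: le_trans (ler_pM _ _ (fB r) (qz_taylor_bound r y0 hy)) _ => //; first exact: nc_ge0.
    apply: le_trans (_ : B * (9 * (2 * pi) ^+ 2) * nc h ^+ 2 * (r.+1%:R ^+ d.+2 * nc (qz (z / 2)) ^+ r) <= _).
      rewrite [leLHS](_ : _ = B * (9 * (2 * pi) ^+ 2) * nc h ^+ 2 * (r.+1%:R ^+ d * (r%:R ^+ 2 * nc (qz (z / 2)) ^+ r))); last by ring.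
      apply: ler_wpM2l; first exact: C1.
      rewrite -[d.+2]addn2 exprD -mulrA; apply: ler_wpM2l; first by rewrite exprn_ge0.
      by apply: ler_wpM2r; rewrite ?exprn_ge0 ?nc_ge0 // lerXn2r ?nnegrE // ler_nat.
    by apply: ler_wpM2l; [exact: C1|exact: hA].
  rewrite -mulr_sumr -mulr_sumr /K.
  rewrite [leRHS](_ : _ = B * (9 * (2 * pi) ^+ 2) * nc h ^+ 2 * (A * 2)); last by ring.
  apply: ler_wpM2l; first exact: C1.
  by apply: ler_wpM2l => //; apply: sum_inv_sqr_le.
apply/cvg_ex; exists (tpi * D : R[i]^o); apply/cvgrPdist_lt => e e0.
have e1 : 0 < complex.Re e /\ e = (complex.Re e)%:C.
  by move: e0; rewrite ltcE /= => /andP[/eqP h1 h2]; split => //; case: e h1 {h2} => ? ? /= ->.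
have [e1' eE] := e1; pose s := Num.min (complex.Im z / 2) (complex.Re e / (K + 1)).
have s0 : 0 < s by rewrite lt_min !divr_gt0 //; have := K0; lra.
have s1 : (0 : R[i]^o) < s%:C by rewrite ltcR.
near=> h.
have h0 : h != 0 :> R[i] by near: h; apply: nbhs_dnbhs_neq.
have hs : `|h : R[i]^o| < s%:C by near: h; apply: dnbhs0_lt.
have {hs}hs : nc h < s by move: hs; rewrite norm_nc ltcR.
have nh : 0 < nc h by rewrite nc_gt0.
rewrite norm_nc eE ltcR ncBC.
rewrite (_ : _ - _ = h^-1 * (F (z + h) - F z - h * (tpi * D))); last first.
  rewrite mulrBr mulKf //; congr (h^-1 * (F _ - F _) - _).
  by rewrite addrC; congr (_ + _); apply: mulr1.
rewrite ncM ncV; apply: le_lt_trans (_ : (nc h)^-1 * (K * nc h ^+ 2) < _).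
  apply: ler_wpM2l; first by rewrite invr_ge0 nc_ge0.
  by apply: key; apply: ltW (lt_le_trans hs _); rewrite ge_min lexx.
rewrite [ltLHS](_ : _ = K * nc h); last first.
  by rewrite mulrCA expr2 [_^-1 * _]mulrA mulVf ?mul1r // gt_eqF.
apply: le_lt_trans (_ : (K + 1) * nc h < _); first by rewrite ler_wpM2r ?nc_ge0 // lerDl.
rewrite mulrC -ltr_pdivlMr; last by have := K0; lra.
by apply: lt_le_trans hs _; rewrite ge_min lexx orbT.
Unshelve. all: by end_near.
Qed.

Lemma eisG_growth k : exists B : R, forall r, `|ratr (eisG k r) : R| <= B * r.+1%:R ^+ k.+1.
Proof.
exists (`|ratr (ecst k)| + 1) => r; rewrite eisGE rmorphD rmorphM rmorph_nat.
have p1 : 1 <= r.+1%:R ^+ k.+1 :> R by rewrite exprn_ege1 // ler1n.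
rewrite mulrDl mul1r; apply: le_trans (ler_normD _ _) _; apply: lerD.
  rewrite normrM normr_nat; apply: ler_pM => //.
  by apply: le_trans p1; case: eqP => _; rewrite ?ler01.
rewrite /dsig; case: eqP => [_|/eqP r0]; first by rewrite rmorph0 normr0 exprn_ge0.
rewrite rmorph_nat normr_nat -natrX ler_nat /sigma big_divisors ?lt0n //.
apply: leq_trans (_ : \sum_(d < r.+1) r.+1 ^ k <= _)%N; last by rewrite sum_nat_const card_ord expnS.
rewrite big_mkcond; apply: leq_sum => d _; case: ifP => // _.
apply: leq_trans (_ : r.+1 ^ k.-1 <= _)%N; last by rewrite leq_pexp2l // leq_pred.
by case: (k.-1) => // j; rewrite leq_exp2r // ltnW.
Qed.
End Holomorphy.

(** * Transformation under SL_2(Z) *)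

Section Modularity.
Implicit Types (u w z x h : C) (M N n k J j m r : nat) (t : R) (a b c d : int).

Lemma cRe_int a : complex.Re (a%:~R : C) = a%:~R.
Proof. by rewrite -(rmorph_int (real_complex R)). Qed.

Lemma cIm_int a : complex.Im (a%:~R : C) = 0.
Proof. by rewrite -(rmorph_int (real_complex R)). Qed.

Lemma qz_int z b : qz (z + b%:~R) = qz z.
Proof. by case: b => n; [apply: qzDnat|rewrite NegzE mulrNz; apply: qzBnat]. Qed.

Lemma denom_neq0 a b c d z : 0 < complex.Im z -> (a * d - b * c = 1) -> c%:~R * z + d%:~R != 0.
Proof.
move=> y0 det; apply/eqP => e0.
have := congr1 (@complex.Im R) e0; rewrite cImD cImM cRe_int !cIm_int mul0r !addr0 /= => /eqP.
rewrite mulf_eq0 (gt_eqF y0) orbF intr_eq0 => /eqP c0.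
move: e0; rewrite c0 mul0r add0r => /eqP; rewrite intr_eq0 => /eqP d0.
by move: det; rewrite c0 d0 !mulr0 subrr.
Qed.

Lemma Im_moebius a b c d z : 0 < complex.Im z -> (a * d - b * c = 1) ->
  0 < complex.Im ((a%:~R * z + b%:~R) / (c%:~R * z + d%:~R)).
Proof.
move=> y0 det; have V0 := denom_neq0 y0 det.
set U := _ + b%:~R; set V := _ + d%:~R in V0 *.
have nV : 0 < nc V by rewrite nc_gt0.
suff h : complex.Im (U / V) * nc V ^+ 2 = complex.Im z.
  by rewrite -(pmulr_lgt0 _ (exprn_gt0 2 nV)) h.
have -> : complex.Im (U / V) * nc V ^+ 2 = complex.Im (U * V^*%C).
  have -> : U * V^*%C = U / V * (nc V ^+ 2)%:C.
    have -> : (nc V ^+ 2)%:C = V * V^*%C.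
      case: (V) => x y; rewrite /= sqr_sqrtr ?addr_ge0 ?sqr_ge0 //; simpc.
      by congr (_ +i* _); ring.
    by rewrite mulrA divfK.
  by case: (U / V) => u v /=; rewrite mulr0 add0r.
have d1 : a%:~R * d%:~R - b%:~R * c%:~R = 1 :> R by rewrite -!intrM -intrB det.
have E (m n : int) : m%:~R * z + n%:~R = (m%:~R * complex.Re z + n%:~R) +i* (m%:~R * complex.Im z).
  by apply/eqP; rewrite eq_complex /= !(cReD, cImD, cReM, cImM, cRe_int, cIm_int) !mul0r subr0 !addr0 !eqxx.
rewrite /U /V !E /= -[RHS]mul1r -[X in _ = X * _]d1; ring.
Qed.

(** Induction on |c|. With a = q c + a', a translation by q and the inversion lead to the matrix
    with rows (-c, -d) and (a', b'), where |a'| < |c|. For c = 0 the diagonal entries are both 1 or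
    both -1, harmless as k is even. *)
Lemma modular_SL2 k (f : C -> C) : ~~ odd k ->
  (forall z (b : int), 0 < complex.Im z -> f (z + b%:~R) = f z) ->
  (forall z, 0 < complex.Im z -> f (- z^-1) = z ^+ k * f z) ->
  forall a b c d z, a * d - b * c = 1 -> 0 < complex.Im z ->
  f ((a%:~R * z + b%:~R) / (c%:~R * z + d%:~R)) = (c%:~R * z + d%:~R) ^+ k * f z.
Proof.
move=> ek fT fS a b c; move: {2}`|c|%N (leqnn `|c|) => n; elim: n a b c => [|n IH] a b c cn d z det y0.
  have c0 : c = 0 by apply/eqP; rewrite -absz_eq0 -leqn0.
  rewrite c0 mul0r add0r; move: det; rewrite c0 mulr0 subr0 => det.
  have dd : d * d = 1.
    have : (d %| 1)%Z by apply/dvdzP; exists a.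
    by rewrite dvdz1; case: (d) => [[|[|?]]|[|?]].
  have ad : a = d by rewrite -[a]mulr1 -dd mulrA det mul1r.
  have dd' : d%:~R * d%:~R = 1 :> C by rewrite -intrM dd.
  have d0 : d%:~R != 0 :> C by apply: contra_eq_neq dd' => ->; rewrite mul0r eq_sym oner_eq0.
  have -> : (a%:~R * z + b%:~R) / d%:~R = z + (b * d)%:~R.
    by apply: (mulIf d0); rewrite divfK // ad intrM mulrDl -mulrA dd' mulr1 mulrC.
  rewrite fT // (_ : d%:~R ^+ k = 1) ?mul1r //.
  by rewrite -(odd_double_half k) (negbTE ek) add0n -mul2n exprM expr2 dd' expr1n.
have [c0|c0] := eqVneq c 0; first by apply: IH => //; rewrite c0.
pose q := (a %/ c)%Z; pose a' := (a %% c)%Z; pose b' := b - q * d.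
have aE : a = q * c + a' by apply: divz_eq.
have a'n : (`|- a'| <= n)%N.
  rewrite abszN -ltnS; apply: leq_trans cn.
  by rewrite -ltz_nat abszE ger0_norm ?modz_ge0 // ltz_mod.
have det' : a' * d - b' * c = 1 by rewrite -det aE /b'; ring.
have det'' : - c * b' - - d * a' = 1 by rewrite -det'; ring.
rewrite abszN in a'n; have := IH _ _ _ a'n _ _ det'' y0.
have V0 := denom_neq0 y0 det'; have U0 := denom_neq0 y0 det''.
have y1 := Im_moebius y0 det'.
have -> : (a%:~R * z + b%:~R) / (c%:~R * z + d%:~R) = (a'%:~R * z + b'%:~R) / (c%:~R * z + d%:~R) + q%:~R.
  by apply: (mulIf V0); rewrite [RHS]mulrDl !divfK // aE /b' !(intrD, intrM, intrB); ring.
rewrite fT //.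
have -> : ((- c)%:~R * z + (- d)%:~R) / (a'%:~R * z + b'%:~R) = - ((a'%:~R * z + b'%:~R) / (c%:~R * z + d%:~R))^-1.
  by rewrite invf_div -mulNr; congr (_ / _); rewrite !intrN mulNr opprD.
rewrite fS // => H; apply: (mulfI (expf_neq0 k U0)); rewrite mulrCA -H.
by rewrite exprMn exprVn mulrA [_ * (_ * _)]mulrCA mulfV ?mulr1 // expf_neq0.
Qed.

Lemma det_mx2 (g : 'M[int]_2) : \det g = g 0 0 * g 1 1 - g 0 1 * g 1 0.
Proof.
rewrite (expand_det_row _ 0) big_ord_recl big_ord1 /cofactor !det_mx11 !mxE /=.
rewrite expr0 expr1 mul1r mulN1r mulrN.
by congr (g _ _ * g _ _ - g _ _ * g _ _); apply: val_inj.
Qed.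

Lemma eisG_function k : exists F : C -> C, forall z, 0 < complex.Im z -> qlim (fun n => ratr (eisG k n)) z (F z).
Proof.
have [B hB] := eisG_growth k.
have /choice[F hF] z : exists l, 0 < complex.Im z -> qlim (fun n => ratr (eisG k n)) z l.
  have [y0|y0] := boolP (0 < complex.Im z); last by exists 0.
  by have [l hl] := qlim_ex y0 hB; exists l.
by exists F.
Qed.

(** Invariance under translation is visible on q. For the inversion, the square sums at -1/z and z^k
    times those at z are the same sequence, so their limits agree. *)
Lemma eisG_Mspace k : (4 <= k)%N -> ~~ odd k -> Mspace R k (eisG k).
Proof.
move=> k4 ek; have [F hF] := eisG_function k.
have hE : fourier_expansion F (fun n => ratr (eisG k n)).
  move=> z y0; apply/ctendsP; apply: eq_ctends (hF z y0) => n.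
  by apply: eq_bigr => r _; rewrite (fmorph_rat (real_complex R)).
have [B hB] := eisG_growth k.
exists F; last exact: hE.
split; last by exists (fun n => ratr (eisG k n)); exact: hE.
  by move=> z y0; apply: (@qlim_derivable _ B k.+1 F z hB hF y0).
move=> g z det y0.
apply: (modular_SL2 ek _ _ _ y0) => [{y0} {}z b y0|{y0} {}z y0|]; last by rewrite -det det_mx2.
  apply: ctends_unique (hF z y0).
  have yb : 0 < complex.Im (z + b%:~R) by rewrite cImD cIm_int addr0.
  by apply: eq_ctends (hF _ yb) => n; rewrite qz_int.
have z0 : z != 0 by apply: contraTneq y0 => ->; rewrite ltxx.
have yz : 0 < complex.Im (- z^-1).
  have := @Im_moebius 0 (-1) 1 0 z y0 (erefl _).
  by rewrite mul0r add0r mul1r addr0 mulN1r.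
have c0 : 2 * ((- tpi) ^+ k / (k.-1)`!%:R) != 0 :> C.
  by rewrite !mulf_neq0 ?invr_eq0 ?pnatr_eq0 -?lt0n ?fact_gt0 // expf_neq0 // oppr_eq0 tpi_neq0.
apply: (mulfI c0); rewrite [RHS]mulrCA.
have h1 := square_sum_cvg yz k4 ek (hF _ yz).
apply: (ctends_unique h1); apply: eq_ctends (ctendsMl (z ^+ k) (square_sum_cvg y0 k4 ek (hF z y0))) => N.
by rewrite square_sum_inv.
Qed.
End Modularity.

(** * Linear combinations and products of modular forms *)

Section ModularFormSpaces.
Implicit Types (u w z x h : C) (M N n k J j m r : nat) (t : R) (a b : qseries).

Lemma ctendsM (u v : nat -> C) (l m : C) : ctends u l -> ctends v m ->
  ctends (fun n => u n * v n) (l * m).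
Proof.
move=> /ctendsP ul /ctendsP vm; apply/ctendsP.
exact: (cvgM ul vm).
Qed.

Lemma triangle_sum (V : nmodType) (F : nat -> nat -> V) n :
  \sum_(0 <= m < n) \sum_(i < m.+1) F i (m - i)%N =
  \sum_(0 <= r < n) \sum_(0 <= s < n - r) F r s.
Proof.
elim: n => [|n IH]; first by rewrite !big_nil.
rewrite big_nat_recr //= IH [RHS]big_nat_recr //= subSnn big_nat1.
rewrite big_ord_recr /= subnn addrA; congr (_ + _).
rewrite -(big_mkord xpredT (fun i => F i (n - i)%N)) -big_split /=.
apply: eq_big_nat => r /andP[_ rn].
by rewrite subSn ?(ltnW rn) // big_nat_recr.
Qed.

(** Convergence at z - v, half as high as z, bounds the terms there, being differences of partial
    sums within 1 of the limit; q(z) = q(z - v) q(v) gives the geometric factor. No growth of the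
    coefficients is assumed. *)
Lemma qterm_geometric (a : nat -> C) (f : C -> C) z : 0 < complex.Im z ->
  (forall z, 0 < complex.Im z -> ctends (fun n => \sum_(0 <= r < n) a r * qz z ^+ r) (f z)) ->
  exists2 A : R, 0 <= A & forall n, nc (a n * qz z ^+ n) <= A * nc (qz ((complex.Im z / 2)%:C * 'i)) ^+ n.
Proof.
move=> y0 hf; set v := (_ / 2)%:C * 'i.
have yv : 0 < complex.Im (z - v).
  by rewrite cImD cImN /v cImM /=; lra.
have [N hN] := hf _ yv _ ltr01.
have bnd n : (N <= n)%N -> nc (a n * qz (z - v) ^+ n) <= 2.
  move=> Nn; have h1 := hN _ Nn; have h2 := hN _ (leqW Nn).
  have -> : a n * qz (z - v) ^+ n = (\sum_(0 <= r < n.+1) a r * qz (z - v) ^+ r - f (z - v))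
      - (\sum_(0 <= r < n) a r * qz (z - v) ^+ r - f (z - v)).
    by rewrite big_nat_recr //=; ring.
  by apply: le_trans (ncB _ _) _; lra.
exists (2 + \sum_(0 <= r < N) nc (a r * qz (z - v) ^+ r)).
  by apply: addr_ge0 => //; apply: sumr_ge0 => r _; apply: nc_ge0.
move=> n; have -> : a n * qz z ^+ n = a n * qz (z - v) ^+ n * qz v ^+ n.
  by rewrite -mulrA -exprMn -qzD subrK.
rewrite ncM ncX; apply: ler_wpM2r; first by rewrite exprn_ge0 ?nc_ge0.
have [/bnd h|nN] := leqP N n.
  by apply: le_trans h _; rewrite lerDl; apply: sumr_ge0 => r _; apply: nc_ge0.
rewrite big_mkord (bigD1 (Ordinal nN)) //= addrCA lerDl; apply: addr_ge0 => //.
by apply: sumr_ge0 => r _; apply: nc_ge0.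
Qed.

(** The product of the partial sums exceeds the triangle r + s < n by at most n^2 terms, each
    O(rho^n). *)
Lemma cauchy_product (a b : nat -> C) (f g : C -> C) :
  (forall z, 0 < complex.Im z -> ctends (fun n => \sum_(0 <= r < n) a r * qz z ^+ r) (f z)) ->
  (forall z, 0 < complex.Im z -> ctends (fun n => \sum_(0 <= r < n) b r * qz z ^+ r) (g z)) ->
  forall z, 0 < complex.Im z ->
  ctends (fun n => \sum_(0 <= r < n) (\sum_(i < r.+1) a i * b (r - i)%N) * qz z ^+ r) (f z * g z).
Proof.
move=> hf hg z y0; have [A A0 hA] := qterm_geometric y0 hf; have [B B0 hB] := qterm_geometric y0 hg.
set v := (_ / 2)%:C * 'i in hA hB.
have yv : 0 < complex.Im v by rewrite /v cImM /=; lra.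
have [D D0 hD] := qterm_bound 2 yv.
set rho := nc (qz v) in hA hB hD.
have rho0 : 0 <= rho by apply: nc_ge0.
have rho1 : rho <= 1 by apply/ltW/qz_lt1.
have h0 : ctends (fun n => \sum_(0 <= r < n) (\sum_(i < r.+1) a i * b (r - i)%N) * qz z ^+ r
    - (\sum_(0 <= r < n) a r * qz z ^+ r) * (\sum_(0 <= r < n) b r * qz z ^+ r)) 0.
  apply: (@ctends_harmonic _ _ (A * B * D)) => n; rewrite subr0.
  have n0 : 0 < n.+1%:R :> R by rewrite ltr0n.
  pose F r s := a r * qz z ^+ r * (b s * qz z ^+ s).
  have -> : \sum_(0 <= r < n) (\sum_(i < r.+1) a i * b (r - i)%N) * qz z ^+ r =
      \sum_(0 <= r < n) \sum_(0 <= s < n - r) F r s.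
    rewrite -triangle_sum; apply: eq_bigr => r _; rewrite mulr_suml; apply: eq_bigr => i _.
    by rewrite /F mulrACA -exprD subnKC // -ltnS.
  rewrite -ncN opprB mulr_suml -sumrB; apply: le_trans (nc_sum _ _ _) _.
  apply: le_trans (_ : \sum_(0 <= r < n) \sum_(0 <= s < n) A * B * rho ^+ n <= _).
    rewrite big_nat_cond [leRHS]big_nat_cond; apply: ler_sum => r /andP[/andP[_ rn] _].
    rewrite mulr_sumr [X in X - _](big_cat_nat (leq0n (n - r)) (leq_subr r n)) //= addrAC subrr add0r.
    apply: le_trans (nc_sum _ _ _) _; rewrite [leRHS](big_cat_nat (leq0n (n - r)) (leq_subr r n)) //=.
    apply: ler_wpDl; first by apply: sumr_ge0 => s _; rewrite mulr_ge0 ?exprn_ge0 // mulr_ge0.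
    rewrite big_nat_cond [leRHS]big_nat_cond; apply: ler_sum => s /andP[/andP[rs _] _].
    rewrite ncM; apply: le_trans (ler_pM _ _ (hA r) (hB s)) _; rewrite ?nc_ge0 //.
    rewrite mulrACA -exprD; apply: ler_wpM2l; first exact: mulr_ge0.
    by apply: ler_wiXn2l => //; rewrite addnC -leq_subLR leq_subCl in rs *.
  rewrite !sumr_const_nat subn0 -!mulrnA -[leLHS]mulr_natr -!mulrA.
  apply: ler_wpM2l => //; apply: ler_wpM2l => //.
  apply: le_trans (_ : n.+1%:R ^+ 2 * rho ^+ n <= _).
    by rewrite mulrC natrM -expr2; apply: ler_wpM2r; rewrite ?exprn_ge0 // lerXn2r ?nnegrE // ler_nat.
  apply: le_trans (hD n) _; apply: ler_wpM2l => //.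
  by rewrite lef_pV2 ?posrE ?exprn_gt0 // expr2 ler_peMr ?(ltW n0) // ler1n.
have h1 := ctendsM (hf z y0) (hg z y0); have := ctendsD h0 h1.
by rewrite add0r; apply: eq_ctends => n; rewrite subrK.
Qed.

Lemma fourierE (f : C -> C) (a : nat -> C) : fourier_expansion f a <->
  (forall z, 0 < complex.Im z -> ctends (fun n => \sum_(0 <= r < n) a r * qz z ^+ r) (f z)).
Proof. by split=> h z y0; [apply/ctendsP; apply: h|apply/ctendsP; apply: h]. Qed.

Lemma Mspace_eq k a b : a =1 b -> Mspace R k a -> Mspace R k b.
Proof. by move=> /funext ->. Qed.

Lemma Mspace_scale k a (c : rat) : Mspace R k a -> Mspace R k (fun n => c * a n).
Proof.
move=> [f [hol aut _] /fourierE hf].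
have hE : fourier_expansion (fun z => ratr c * f z) (fun n => ratr (c * a n)).
  apply/fourierE => z y0; apply: eq_ctends (ctendsMl (ratr c) (hf z y0)) => n.
  by rewrite mulr_sumr; apply: eq_bigr => r _; rewrite rmorphM mulrA.
exists (fun z => ratr c * f z); last exact: hE.
split; last by exists (fun n => ratr (c * a n)).
  by move=> z y0; apply: (@derivableZ _ _ _ (f : R[i]^o -> R[i]^o) (ratr c : R[i]) z 1); apply: hol.
by move=> g z det y0; rewrite aut // mulrCA.
Qed.

Lemma Mspace_add k a b : Mspace R k a -> Mspace R k b -> Mspace R k (fun n => a n + b n).
Proof.
move=> [f [holf autf _] /fourierE hf] [g [holg autg _] /fourierE hg].
have hE : fourier_expansion (fun z => f z + g z) (fun n => ratr (a n + b n)).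
  apply/fourierE => z y0; apply: eq_ctends (ctendsD (hf z y0) (hg z y0)) => n.
  by rewrite -big_split; apply: eq_bigr => r _; rewrite rmorphD mulrDl.
exists (fun z => f z + g z); last exact: hE.
split; last by exists (fun n => ratr (a n + b n)).
  by move=> z y0; apply: (@derivableD _ _ _ (f : R[i]^o -> R[i]^o) g z 1); [apply: holf|apply: holg].
by move=> h z det y0; rewrite autf // autg // mulrDr.
Qed.

Lemma Mspace_mul k j a b : Mspace R k a -> Mspace R j b -> Mspace R (k + j) (qmul a b).
Proof.
move=> [f [holf autf _] /fourierE hf] [g [holg autg _] /fourierE hg].
have hE : fourier_expansion (fun z => f z * g z) (fun n => ratr (qmul a b n)).
  apply/fourierE => z y0; apply: eq_ctends (cauchy_product hf hg y0) => n.
  apply: eq_bigr => r _; rewrite /qmul rmorph_sum; congr (_ * _); apply: eq_bigr => i _.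
  by rewrite rmorphM.
exists (fun z => f z * g z); last exact: hE.
split; last by exists (fun n => ratr (qmul a b n)).
  by move=> z y0; apply: (@derivableM _ _ (f : R[i]^o -> R[i]^o) g z 1); [apply: holf|apply: holg].
by move=> h z det y0; rewrite autf // autg // exprD mulrACA.
Qed.

Lemma Mspace_sum k I (s : seq I) (P : pred I) (a : I -> qseries) : Mspace R k (fun=> 0) ->
  (forall i, P i -> Mspace R k (a i)) -> Mspace R k (fun n => \sum_(i <- s | P i) a i n).
Proof.
move=> h0 ha; elim: s => [|i s IH].
  by apply: Mspace_eq h0 => n; rewrite big_nil.
have [Pi|nPi] := boolP (P i).
  by apply: Mspace_eq (Mspace_add (ha i Pi) IH) => n; rewrite big_cons Pi.
by apply: Mspace_eq IH => n; rewrite big_cons (negbTE nPi).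
Qed.
End ModularFormSpaces.

End ComplexAnalysis.

(** The remaining j are odd with 3 <= j <= w - 3, so both factors have even weight >= 4. *)
Lemma weight2_form_Mspace (R : realType) p : prime p -> (5 <= p)%N -> Mspace R (2 + p.-1)%N (weight2_form p).
Proof.
move=> p_pr p5; have op : odd p by case: (even_prime p_pr) p5 => [->|].
have ew : ~~ odd p.-1 by case: (p) p5 op.
pose w := p.-1; rewrite add2n -/w; have w4 : (4 <= w)%N by rewrite /w; lia.
have mG : Mspace R w.+2 (eisG w.+2) by apply: eisG_Mspace; rewrite ?negbK //=; lia.
have m0 : Mspace R w.+2 (fun=> 0).
  by apply: Mspace_eq (Mspace_scale 0 mG) => n; rewrite mul0r.
pose P (j : 'I_w.+1) := [&& odd j, j != 1 :> nat & j != w.-1 :> nat]%N.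
pose T (j : 'I_w.+1) n : rat := 'C(w, j)%:R * qmul (eisG (w - j).+1) (eisG j.+1) n.
have mS : Mspace R w.+2 (fun n => \sum_(j | P j) T j n).
  apply: Mspace_sum m0 _ => j /and3P[oj j1 jw]; apply: Mspace_scale.
  have jlt := ltn_ord j; have jw' : (j != w :> nat) by apply: contraNneq ew => jE; rewrite -/w -jE.
  have -> : w.+2 = ((w - j).+1 + j.+1)%N by lia.
  by apply: Mspace_mul; apply: eisG_Mspace; move: ew oj; rewrite -/w /= ?oddB; lia.
apply: Mspace_eq (Mspace_add (Mspace_add (Mspace_scale (w.+3%:R / w.+1%:R / (4 * w%:R * ecst w)) mG)
  (Mspace_scale (- 2 / (4 * w%:R * ecst w)) mS)) (Mspace_scale (- p%:R) mG)) => n.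
by rewrite /weight2_form -/w; ring.
Qed.

Theorem theorem1p1 (R : realType) (p k0 n : nat) :
  prime p -> (5 <= p)%N ->
  ~~ odd k0 -> (2 <= k0 <= p - 3)%N ->
  exists f : qseries,
    [/\ Mspace R (k0 + (p - 1))%N f,
        qpintegral p f
      & qcongr p 2 (eisG (k0 + n.+1 * (p - 1))%N)
                   (qmul (qexp (eisE (p - 1)%N) n) f)].
Proof.
move=> p_pr p5 ek /andP[k2 kp3]; rewrite !subn1.
(* Hence p - 1 does not divide k0, the regularity that Kummer's congruence requires. *)
have kp : (k0 < p.-1)%N by lia.
have op : odd p by case: (even_prime p_pr) p5 => [->|].
have ew : ~~ odd p.-1 by case: (p) p5 op.
have mG : Mspace R (k0 + p.-1)%N (eisG (k0 + p.-1)).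
  by apply: eisG_Mspace; rewrite ?oddD ?(negbTE ek) //; lia.
suff [H mH cH] : exists2 H, Mspace R (k0 + p.-1)%N H &
    forall i, dvp p 2 (H i - qmul (eisE p.-1) (eis_stab p k0) i).
  have [fi fc] := eisG_congr p_pr p5 k2 kp n cH.
  exists (fun i => n.+1%:R * eisG (k0 + p.-1) i - n%:R * H i); split=> //.
  apply: Mspace_eq (Mspace_add (Mspace_scale n.+1%:R mG) (Mspace_scale (- n%:R) mH)) => i.
  by rewrite mulNr.
have [k02|k02] := eqVneq k0 2%N.
  exists (weight2_form p); first by rewrite k02; apply: weight2_form_Mspace.
  by move=> i; apply: weight2_form_congr.
have k3 : (3 <= k0)%N by rewrite ltn_neqAle eq_sym k02.
have k4 : (4 <= k0)%N by rewrite ltn_neqAle k3 andbT; apply: contraNneq ek => <-.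
exists (qmul (eisE p.-1) (eisG k0)); last by move=> i; apply: eis_stab_high.
rewrite addnC; apply: Mspace_mul; last exact: eisG_Mspace.
by apply: Mspace_scale; apply: eisG_Mspace => //; lia.
Qed.
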